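(* Let $(R,\mathfrak m,K)$ be an equidimensional reduced F-finite local ring of prime characteristic $p>0$ and Krull dimension $d$. The closure operation obtained from the lim Cohen-Macaulay sequence $\mathcal M:=\{R^{1/p^n}\}_n$ (equivalently $\{F^n_*(R)\}_n$) and either $\nu$ or $\operatorname{rank}$ is the usual tight closure. That is, for this choice of $\mathcal M$ and for all finitely generated $R$-modules $A\subseteq B$, $A^{*\mathcal M,\operatorname{rank}}_B=A^{*\mathcal M,\nu}_B=A^*_B$, where $A^*_B$ is the tight closure of $A$ in $B$.
   Context: F-finite means the Frobenius endomorphism is module-finite; equidimensional means $\dim(R/\mathfrak p)=\dim R$ for every minimal prime $\mathfrak p$. $F^n_*(R)$ is $R$ viewed as an $R$-module by restriction of scalars along the $n$-fold Frobenius; for $R$ reduced, $F^n_*(R)\cong R^{1/p^n}$. $\ell$ is length, $\nu(M)=\dim_K(K\otimes_RM)$. A finitely generated $R$-module $M$ has rank $r$ if $\ell_{R_{\mathfrak p}}(M_{\mathfrak p})=r\,\ell_{R_{\mathfrak p}}(R_{\mathfrak p})$ for every minimal prime $\mathfrak p$ of $R$ with $\dim(R/\mathfrak p)=\dim R$. (A sequence $\{M_n\}_n$ of nonzero finitely generated $R$-modules is lim Cohen-Macaulay if for some, equivalently every, system of parameters $\underline x$ of $R$, the Koszul homology satisfies $\ell(H_i(\underline x;M_n))=\mathrm o(\nu(M_n))$ for all $i\ge1$.) Closure: let $\mathcal M=\{M_n\}_n$ be a sequence of nonzero finitely generated $R$-modules and $\alpha$ a positive-integer-valued function on the $M_n$.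 For finitely generated $R$-modules $A\subseteq B$ with $B/A$ of finite length, $A^{*\mathcal M,\alpha}_B$ is the largest submodule $A'$ with $A\subseteq A'\subseteq B$ such that $\ell\big(\operatorname{Im}(M_n\otimes_R(A'/A)\to M_n\otimes_R(B/A))\big)=\mathrm o(\alpha(M_n))$ as $n\to\infty$. In general $A^{*\mathcal M,\alpha}_B=\bigcap_{t}(A+\mathfrak m^tB)^{*\mathcal M,\alpha}_B$. Here $\alpha$ is $\nu$ or $\operatorname{rank}$. Tight closure: for $A\subseteq B$ finitely generated, let $\mathcal F^n$ be base change along the $n$-fold Frobenius $R\to R$, let $b^{p^n}$ be the image $1\otimes b\in\mathcal F^n(B)$ of $b\in B$, and let $A^{[p^n]}_B$ be the image of $\mathcal F^n(A)\to\mathcal F^n(B)$. Then $b\in A^*_B$ iff there is $c\in R$ in no minimal prime of $R$ with $c\,b^{p^n}\in A^{[p^n]}_B$ for all $n\gg0$. *)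

(* Defs.v *)
From HB Require Import structures.
From mathcomp Require Import all_boot all_order all_algebra.
From mathcomp Require Import ring.
From mathcomp Require Import boolp classical_sets.
From mathcomp.multinomials Require Import freeg.

Set Implicit Arguments.
Unset Strict Implicit.
Unset Printing Implicit Defensive.

Import Order.TTheory GRing.Theory Num.Theory.
Local Open Scope ring_scope.
Local Open Scope quotient_scope.
Local Open Scope classical_set_scope.

(* Submodules are the library's [submodClosed M], boolean membership predicates.
   This loses no generality: with boolp, every Prop-valued predicate has a
   boolean counterpart. *)

Section Span.
Context (R : comNzRingType) (M : lmodType R).

Definition span (X : set M) : {pred M} :=
  [pred x | `[< forall S : submodClosed M, X `<=` [set` S] -> x \in S >]].

Lemma span_submod_closed X : submod_closed (span X).
Proof.
split=> [|a x y]; first by apply/asboolP=> S _; exact: rpred0.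
move=> /asboolP Xx /asboolP Xy; apply/asboolP=> S XS.
by rewrite rpredD ?rpredZ ?Xx ?Xy.
Qed.

HB.instance Definition _ X :=
  GRing.isSubmodClosed.Build R M (span X) (span_submod_closed X).

End Span.

Lemma span_le (R : comNzRingType) (M : lmodType R) (X : set M)
    (S : submodClosed M) : X `<=` [set` S] -> {subset span X <= S}.
Proof. by move=> XS x /asboolP; apply. Qed.

Section Image.
Context (R : comNzRingType) (M N : lmodType R) (f : {linear M -> N}).

Definition image_mod : {pred N} := [pred y | `[< exists x, f x = y >]].

Lemma image_submod_closed : submod_closed image_mod.
Proof.
split=> [|a _ _ /asboolP[x <-] /asboolP[y <-]]; apply/asboolP.
  by exists 0; rewrite linear0.
by exists (a *: x + y); rewrite linearP.
Qed.

HB.instance Definition _ :=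
  GRing.isSubmodClosed.Build R N image_mod image_submod_closed.

End Image.

Section Kernel.
Context (R : comNzRingType) (M N : lmodType R) (f : {linear M -> N}).

Definition kernel_mod : {pred M} := [pred x | f x == 0].

Lemma kernel_submod_closed : submod_closed kernel_mod.
Proof.
split=> [|a x y]; rewrite !inE ?linear0 // => /eqP x0 /eqP y0.
by rewrite linearP /= x0 y0 scaler0 addr0.
Qed.

HB.instance Definition _ :=
  GRing.isSubmodClosed.Build R M kernel_mod kernel_submod_closed.

End Kernel.

Section SubModule.
Context (R : comNzRingType) (M : lmodType R) (S : submodClosed M).

Record submod : Type := Submod { submod_val : M; _ : submod_val \in S }.

HB.instance Definition _ := [isSub for submod_val].
HB.instance Definition _ := [Choice of submod by <:].
HB.instance Definition _ := [SubChoice_isSubLmodule of submod by <:].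

Definition incl : {linear submod -> M} := (\val : submod -> M).

End SubModule.

Section QuotientModule.
Context (R : comNzRingType) (M : lmodType R) (S : submodClosed M).

Definition submod_zmod : {pred M} := S.

HB.instance Definition _ := GRing.isZmodClosed.Build M submod_zmod
  (GRing.submod_closedB (submodClosedP S)).

Definition quomod : Type := Quotient.quot submod_zmod.

HB.instance Definition _ := GRing.Zmodule.on quomod.
HB.instance Definition _ := Quotient.on quomod.

Definition quo : M -> quomod := \pi_quomod.

Lemma quoP x y : quo x = quo y <-> x - y \in S.
Proof. by split=> [/eqmodP|?]; [|apply/eqmodP]. Qed.

Definition quo_scale (a : R) (x : quomod) : quomod := quo (a *: repr x).

Lemma quo_scaleE a x : quo_scale a (quo x) = quo (a *: x).
Proof.
by apply/quoP; rewrite -scalerBr rpredZ //; apply/quoP; rewrite /quo reprK.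
Qed.

Lemma quo_zmod_morphism : zmod_morphism quo.
Proof. by move=> x y; rewrite /quo !piE. Qed.

Lemma quoD x y : quo (x + y) = quo x + quo y.
Proof. by rewrite /quo !piE. Qed.

Lemma quo_surj x : exists y, x = quo y.
Proof. by exists (repr x); rewrite /quo reprK. Qed.

Fact quo_scaleA a b v : quo_scale a (quo_scale b v) = quo_scale (a * b) v.
Proof. by have [x ->] := quo_surj v; rewrite !quo_scaleE scalerA. Qed.

Fact quo_scale1 : left_id 1 quo_scale.
Proof. by move=> v; have [x ->] := quo_surj v; rewrite quo_scaleE scale1r. Qed.

Fact quo_scaleDr : right_distributive quo_scale +%R.
Proof.
move=> a v w; have [x ->] := quo_surj v; have [y ->] := quo_surj w.
by rewrite -quoD !quo_scaleE scalerDr quoD.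
Qed.

Fact quo_scaleDl v : {morph quo_scale^~ v : a b / a + b}.
Proof.
by move=> a b; have [x ->] := quo_surj v; rewrite !quo_scaleE scalerDl quoD.
Qed.

HB.instance Definition _ := GRing.Zmodule_isLmodule.Build R quomod
  quo_scaleA quo_scale1 quo_scaleDr quo_scaleDl.

HB.instance Definition _ :=
  GRing.isZmodMorphism.Build M quomod quo quo_zmod_morphism.

Fact quo_scalable : scalable quo.
Proof. by move=> a x; rewrite -quo_scaleE. Qed.

HB.instance Definition _ :=
  GRing.isScalable.Build R M quomod *:%R quo quo_scalable.

End QuotientModule.

Section QuotientMap.
Context (R : comNzRingType) (M N : lmodType R) (S : submodClosed M).
Context (f : {linear M -> N}) (fS : forall x, x \in S -> f x = 0).

Lemma quo_repr_val x : f (repr (quo S x)) = f x.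
Proof.
apply/eqP; rewrite -subr_eq0 -linearB; apply/eqP/fS/quoP.
by rewrite /quo reprK.
Qed.

Lemma quo_repr_linear : linear (fun z : quomod S => f (repr z)).
Proof.
move=> a z w; have [x ->] := quo_surj z; have [y ->] := quo_surj w.
by rewrite -linearP !quo_repr_val linearP.
Qed.

End QuotientMap.

Section FreeLift.
Context (R : comNzRingType) (K : choiceType) (M : lmodType R) (u : K -> M).

Definition free_lift : {freeg K / R} -> M := fglift u.

Lemma free_lift_linear : linear free_lift.
Proof.
have B : zmod_morphism free_lift by exact: lift_is_additive.
have F0 : free_lift 0 = 0 by have := B 0 0; rewrite !subrr.
have FD x y : free_lift (x + y) = free_lift x + free_lift y.
  have := B x (- y); rewrite opprK => ->.
  by have := B 0 y; rewrite F0 !sub0r => ->; rewrite opprK.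
have Fsum (s : seq K) (e : K -> {freeg K / R}) :
    free_lift (\sum_(v <- s) e v) = \sum_(v <- s) free_lift (e v).
  exact: (big_morph free_lift FD F0).
move=> a z w; rewrite FD; congr (_ + _); rewrite -{2}[z]freeg_sumE.
have -> : a *: z = \sum_(v <- dom z) << a * coeff v z *g v >> by [].
rewrite !Fsum scaler_sumr; apply: eq_bigr => v _.
by rewrite /free_lift !liftU scalerA.
Qed.

HB.instance Definition _ :=
  GRing.isLinear.Build R {freeg K / R} M *:%R free_lift free_lift_linear.

Lemma free_liftU k : free_lift << k >> = u k.
Proof. by rewrite /free_lift liftU scale1r. Qed.

End FreeLift.

(* P with scalars restricted along f. *)
Definition restr (R S : comNzRingType) (f : {rmorphism R -> S})
  (P : lmodType S) : Type := P.

Section Restriction.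
Context (R S : comNzRingType) (f : {rmorphism R -> S}) (P : lmodType S).
Local Notation restr := (restr f P).

HB.instance Definition _ := GRing.Zmodule.on restr.

Definition restr_scale (a : R) (x : restr) : restr := f a *: (x : P).

Fact restr_scaleA a b v : restr_scale a (restr_scale b v) = restr_scale (a * b) v.
Proof. by rewrite /restr_scale scalerA rmorphM. Qed.

Fact restr_scale1 : left_id 1 restr_scale.
Proof. by move=> v; rewrite /restr_scale rmorph1 scale1r. Qed.

Fact restr_scaleDr : right_distributive restr_scale +%R.
Proof. by move=> a v w; rewrite /restr_scale scalerDr. Qed.

Fact restr_scaleDl v : {morph restr_scale^~ v : a b / a + b}.
Proof. by move=> a b; rewrite /restr_scale rmorphD scalerDl. Qed.

HB.instance Definition _ := GRing.Zmodule_isLmodule.Build R restr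
  restr_scaleA restr_scale1 restr_scaleDr restr_scaleDl.

End Restriction.

(* For f : R -> S, an S-module P and an R-module N, [tensor f P N] is the tensor
   product over R of P (seen as an R-module through f) and N, with its S-module
   structure coming from P: the free S-module on P * N modulo the bilinearity
   relations.  For f = idfun it is the tensor product of two R-modules; for
   P = S^o it is the base change of N along f. *)
Section Tensor.
Context (R S : comNzRingType) (f : {rmorphism R -> S}).
Context (P : lmodType S) (N : lmodType R).

Definition fgen (x : P) (y : N) : {freeg (P * N)%type / S} :=
  [freeg [:: (1, (x, y))]].

Definition tensor_rel : set {freeg (P * N)%type / S} :=
  [set z | [\/ exists x x' y, z = fgen (x + x') y - fgen x y - fgen x' y,
               exists x y y', z = fgen x (y + y') - fgen x y - fgen x y',
               exists s x y, z = fgen (s *: x) y - s *: fgen x y |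
               exists r x y, z = fgen x (r *: y) - fgen (f r *: x) y]].

Definition tensor : Type := quomod (span tensor_rel).

HB.instance Definition _ := GRing.Lmodule.on tensor.

Definition tens (x : P) (y : N) : tensor := quo (span tensor_rel) (fgen x y).

Lemma tensDl x x' y : tens (x + x') y = tens x y + tens x' y.
Proof.
rewrite /tens -raddfD; apply/quoP/asboolP => T; apply.
by rewrite /tensor_rel /=; constructor 1; exists x, x', y; rewrite opprD addrA.
Qed.

Lemma tensDr x y y' : tens x (y + y') = tens x y + tens x y'.
Proof.
rewrite /tens -raddfD; apply/quoP/asboolP => T; apply.
by rewrite /tensor_rel /=; constructor 2; exists x, y, y'; rewrite opprD addrA.
Qed.

Lemma tensZl s x y : tens (s *: x) y = s *: tens x y.
Proof.
rewrite /tens -linearZ; apply/quoP/asboolP => T; apply.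
by rewrite /tensor_rel /=; constructor 3; exists s, x, y.
Qed.

Lemma tensZr r x y : tens x (r *: y) = f r *: tens x y.
Proof.
rewrite -tensZl /tens; apply/quoP/asboolP => T; apply.
by rewrite /tensor_rel /=; constructor 4; exists r, x, y.
Qed.

End Tensor.

Section TensorMap.
Context (R S : comNzRingType) (f : {rmorphism R -> S}).
Context (P P' : lmodType S) (N N' : lmodType R).
Context (g : {linear P -> P'}) (h : {linear N -> N'}).

Definition free_tensor_map : {linear {freeg (P * N)%type / S} -> tensor f P' N'} :=
  free_lift (fun u => tens f (g u.1) (h u.2)).

(* The map induced by g and h, computed on an arbitrary representative. *)
Definition tensor_map (z : tensor f P N) : tensor f P' N' :=
  free_tensor_map (repr z).

Lemma free_tensor_mapU x y : free_tensor_map (fgen x y) = tens f (g x) (h y).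
Proof. exact: free_liftU. Qed.

Lemma free_tensor_map_rel z :
  z \in span (@tensor_rel R S f P N) -> free_tensor_map z = 0.
Proof.
suff H : @tensor_rel R S f P N `<=` [set` kernel_mod free_tensor_map].
  by move=> /(span_le H) /eqP.
move=> {}z; rewrite /= inE => zrel; apply/eqP; move: zrel.
case=> [[x [x' [y ->]]]|[x [y [y' ->]]]|[s [x [y ->]]]|[r [x [y ->]]]].
- rewrite 2!linearB /= !free_tensor_mapU.
  have -> : g (x + x') = g x + g x' by exact: linearD.
  by rewrite tensDl addrAC addrK subrr.
- rewrite 2!linearB /= !free_tensor_mapU.
  have -> : h (y + y') = h y + h y' by exact: linearD.
  by rewrite tensDr addrAC addrK subrr.
- rewrite linearB linearZ /= !free_tensor_mapU.
  have -> : g (s *: x) = s *: g x by exact: linearZ_LR.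
  by rewrite tensZl subrr.
- rewrite linearB /= !free_tensor_mapU.
  have -> : g (f r *: x) = f r *: g x by exact: linearZ_LR.
  have -> : h (r *: y) = r *: h y by exact: linearZ_LR.
  by rewrite tensZr tensZl subrr.
Qed.

Lemma tensor_map_tens x y : tensor_map (tens f x y) = tens f (g x) (h y).
Proof.
by rewrite -free_tensor_mapU; exact: (quo_repr_val free_tensor_map_rel).
Qed.

Fact tensor_map_linear : linear tensor_map.
Proof. exact: (quo_repr_linear free_tensor_map_rel). Qed.

HB.instance Definition _ := GRing.isLinear.Build S
  (tensor f P N) (tensor f P' N') *:%R tensor_map tensor_map_linear.

End TensorMap.

Section Localization.
Context (R : comNzRingType) (P : prime_idealr R).

Record loc_den : Type := LocDen { den_val : R; _ : den_val \notin P }.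

HB.instance Definition _ := [isSub for den_val].
HB.instance Definition _ := [Choice of loc_den by <:].

Definition den_mul (s t : loc_den) : loc_den.
Proof.
exists (den_val s * den_val t).
by rewrite prime_idealrM negb_or (valP s) (valP t).
Defined.

Definition den_one : loc_den.
Proof. by exists 1; rewrite idealr1. Defined.

Definition loc_eq (x y : R * loc_den) : bool :=
  `[< exists u : loc_den,
        den_val u * (x.1 * den_val y.2 - y.1 * den_val x.2) = 0 >].

Fact loc_eq_equiv : equiv_class_of loc_eq.
Proof.
split=> [x|x y|y x z].
- by apply/asboolP; exists den_one; rewrite subrr mulr0.
- by apply/asboolP/asboolP => -[u e]; exists u; rewrite -opprB mulrN e oppr0.
- move=> /asboolP[u eu] /asboolP[v ev]; apply/asboolP.
  exists (den_mul (den_mul u v) y.2) => /=.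
  move: (x.1) (y.1) (z.1) (den_val x.2) (den_val y.2) (den_val z.2)
        (den_val u) (den_val v) eu ev => a b c s t r {}u {}v eu ev.
  rewrite (_ : _ * _ = v * r * (u * (a * t - b * s)) +
                       u * s * (v * (b * r - c * t))); last by ring.
  by rewrite eu ev !mulr0 addr0.
Qed.

Canonical loc_equivRel := EquivRelPack loc_eq_equiv.
Canonical loc_encModRel := defaultEncModRel loc_eq.

(* The localization of R at the prime ideal P. *)
Definition loc : Type := {eq_quot loc_eq}.

HB.instance Definition _ : EqQuotient _ loc_eq loc := EqQuotient.on loc.
HB.instance Definition _ := Choice.on loc.

Definition frac (a : R) (s : loc_den) : loc := \pi_loc (a, s).

Lemma fracP a s b t : frac a s = frac b t <->
  exists u : loc_den, den_val u * (a * den_val t - b * den_val s) = 0.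
Proof. by split=> [/eqmodP/asboolP|H] //; apply/eqmodP/asboolP. Qed.

Lemma frac_surj x : exists a s, x = frac a s.
Proof. by exists (repr x).1, (repr x).2; rewrite /frac -surjective_pairing reprK. Qed.

Lemma frac_repr a s :
  exists u : loc_den, den_val u * ((repr (frac a s)).1 * den_val s
    - a * den_val (repr (frac a s)).2) = 0.
Proof. by apply/fracP; rewrite /frac -surjective_pairing reprK. Qed.

Definition loc_add (x y : loc) : loc :=
  frac ((repr x).1 * den_val (repr y).2 + (repr y).1 * den_val (repr x).2)
       (den_mul (repr x).2 (repr y).2).

Definition loc_mul (x y : loc) : loc :=
  frac ((repr x).1 * (repr y).1) (den_mul (repr x).2 (repr y).2).

Definition loc_opp (x : loc) : loc := frac (- (repr x).1) (repr x).2.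

Lemma loc_addE a s b t : loc_add (frac a s) (frac b t) =
  frac (a * den_val t + b * den_val s) (den_mul s t).
Proof.
apply/fracP; have [u eu] := frac_repr a s; have [v ev] := frac_repr b t.
exists (den_mul u v) => /=; move: eu ev.
case: (repr _) => a' s'; case: (repr _) => b' t' /=.
move: (den_val s) (den_val t) (den_val u) (den_val v) (den_val s') (den_val t').
move=> {}s {}t {}u {}v {}s' {}t' eu ev.
rewrite (_ : _ * _ = v * t * t' * (u * (a' * s - a * s')) +
                     u * s * s' * (v * (b' * t - b * t'))); last by ring.
by rewrite eu ev !mulr0 addr0.
Qed.

Lemma loc_mulE a s b t :
  loc_mul (frac a s) (frac b t) = frac (a * b) (den_mul s t).
Proof.
apply/fracP; have [u eu] := frac_repr a s; have [v ev] := frac_repr b t.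
exists (den_mul u v) => /=; move: eu ev.
case: (repr _) => a' s'; case: (repr _) => b' t' /=.
move: (den_val s) (den_val t) (den_val u) (den_val v) (den_val s') (den_val t').
move=> {}s {}t {}u {}v {}s' {}t' eu ev.
rewrite (_ : _ * _ = v * b' * t * (u * (a' * s - a * s')) +
                     u * a * s' * (v * (b' * t - b * t'))); last by ring.
by rewrite eu ev !mulr0 addr0.
Qed.

Lemma loc_oppE a s : loc_opp (frac a s) = frac (- a) s.
Proof.
apply/fracP; have [u eu] := frac_repr a s; exists u => /=.
by rewrite !mulNr -opprD mulrN eu oppr0.
Qed.

Lemma frac_eq a s b t : a * den_val t = b * den_val s -> frac a s = frac b t.
Proof. by move=> e; apply/fracP; exists den_one; rewrite e subrr mulr0. Qed.

Fact loc_addA : associative loc_add.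
Proof.
move=> x y z; have [a [s ->]] := frac_surj x; have [b [t ->]] := frac_surj y.
by have [c [r ->]] := frac_surj z; rewrite !loc_addE; apply: frac_eq => /=; ring.
Qed.

Fact loc_addC : commutative loc_add.
Proof.
move=> x y; have [a [s ->]] := frac_surj x; have [b [t ->]] := frac_surj y.
by rewrite !loc_addE; apply: frac_eq => /=; ring.
Qed.

Fact loc_add0 : left_id (frac 0 den_one) loc_add.
Proof.
move=> x; have [a [s ->]] := frac_surj x.
by rewrite !loc_addE; apply: frac_eq => /=; ring.
Qed.

Fact loc_addN : left_inverse (frac 0 den_one) loc_opp loc_add.
Proof.
move=> x; have [a [s ->]] := frac_surj x.
by rewrite loc_oppE !loc_addE; apply: frac_eq => /=; ring.
Qed.

HB.instance Definition _ :=
  GRing.isZmodule.Build loc loc_addA loc_addC loc_add0 loc_addN.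

Fact loc_mulA : associative loc_mul.
Proof.
move=> x y z; have [a [s ->]] := frac_surj x; have [b [t ->]] := frac_surj y.
by have [c [r ->]] := frac_surj z; rewrite !loc_mulE; apply: frac_eq => /=; ring.
Qed.

Fact loc_mulC : commutative loc_mul.
Proof.
move=> x y; have [a [s ->]] := frac_surj x; have [b [t ->]] := frac_surj y.
by rewrite !loc_mulE; apply: frac_eq => /=; ring.
Qed.

Fact loc_mul1 : left_id (frac 1 den_one) loc_mul.
Proof.
move=> x; have [a [s ->]] := frac_surj x.
by rewrite !loc_mulE; apply: frac_eq => /=; ring.
Qed.

Fact loc_mulDl : left_distributive loc_mul loc_add.
Proof.
move=> x y z; have [a [s ->]] := frac_surj x; have [b [t ->]] := frac_surj y.
have [c [r ->]] := frac_surj z.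
by rewrite !(loc_addE, loc_mulE); apply: frac_eq => /=; ring.
Qed.

Fact loc_oner_neq0 : frac 1 den_one != 0.
Proof.
apply/eqP => /fracP[u /=]; rewrite mul0r subr0 !mulr1 => u0.
by have := valP u; rewrite /= u0 idealr0.
Qed.

HB.instance Definition _ := GRing.Zmodule_isComNzRing.Build loc
  loc_mulA loc_mulC loc_mul1 loc_mulDl loc_oner_neq0.

Definition loc_map (a : R) : loc := frac a den_one.

Fact loc_map_zmod_morphism : zmod_morphism loc_map.
Proof.
move=> a b; rewrite /loc_map -[- frac b _]/(loc_opp _) loc_oppE.
by rewrite -[RHS]/(loc_add _ _) loc_addE; apply: frac_eq => /=; ring.
Qed.

Fact loc_map_monoid_morphism : monoid_morphism loc_map.
Proof.
split=> // a b; rewrite /loc_map -[RHS]/(loc_mul _ _) loc_mulE.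
by apply: frac_eq => /=; ring.
Qed.

HB.instance Definition _ :=
  GRing.isZmodMorphism.Build R loc loc_map loc_map_zmod_morphism.
HB.instance Definition _ :=
  GRing.isMonoidMorphism.Build R loc loc_map loc_map_monoid_morphism.

Definition loc_mod (M : lmodType R) : lmodType loc := tensor loc_map loc^o M.

End Localization.

Section CommutativeAlgebra.
Context (R : comNzRingType).

Definition fin_gen (M : lmodType R) : Prop :=
  exists (k : nat) (e : 'I_k -> M),
    forall x, exists c : 'I_k -> R, x = \sum_i c i *: e i.

Definition noetherian : Prop := forall I : submodClosed R^o, fin_gen (submod I).

Definition maximal_ideal (m : idealr R) : Prop :=
  forall J : idealr R, {subset m <= J} -> {subset J <= m}.

Definition local_ring (m : idealr R) : Prop :=
  maximal_ideal m /\ forall J : idealr R, maximal_ideal J -> J =i m.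

Definition minimal_prime (P : prime_idealr R) : Prop :=
  forall Q : prime_idealr R, {subset Q <= P} -> {subset P <= Q}.

Definition reduced_ring : Prop := forall (x : R) (n : nat), x ^+ n = 0 -> x = 0.

(* Only Q_0 < Q_1 < ... < Q_k matter: k counts the strict inclusions. *)
Definition prime_chain (k : nat) : Prop :=
  exists Q : nat -> prime_idealr R, forall i, (i < k)%N ->
    {subset Q i <= Q i.+1} /\ ~ {subset Q i.+1 <= Q i}.

Definition krull_dim (d : nat) : Prop :=
  prime_chain d /\ forall k, prime_chain k -> (k <= d)%N.

(* M has a composition series with l factors. *)
Definition has_length (M : lmodType R) (l : nat) : Prop :=
  exists N : nat -> submodClosed M,
    [/\ forall x, x \in N 0 -> x = 0,
        forall x, x \in N l &
        forall i, (i < l)%N ->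
          [/\ {subset N i <= N i.+1}, ~ {subset N i.+1 <= N i} &
              forall T : submodClosed M,
                {subset N i <= T} -> {subset T <= N i.+1} ->
                {subset T <= N i} \/ {subset N i.+1 <= T}]].

Definition has_basis_card (V : lmodType R) (k : nat) : Prop :=
  exists e : 'I_k -> V,
    forall v, exists! c : {ffun 'I_k -> R}, v = \sum_i c i *: e i.

End CommutativeAlgebra.

Definition same_krull_dim (R S : comNzRingType) : Prop :=
  exists d, krull_dim R d /\ krull_dim S d.

Definition equidimensional (R : comNzRingType) : Prop :=
  forall P : prime_idealr R, minimal_prime P ->
    same_krull_dim {ideal_quot P} R.

Section NuRank.
Context (R : comNzRingType) (m : idealr R).

(* K (x)_R M as a module over K = R / m. *)
Definition residue_mod (M : lmodType R) : lmodType {ideal_quot m} :=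
  tensor (\pi_{ideal_quot m} : {rmorphism R -> {ideal_quot m}})
         ({ideal_quot m} : comNzRingType)^o M.

(* xget picks the unique such number (0 if there is none). *)
Definition nu (M : lmodType R) : nat :=
  xget 0%N [set k | has_basis_card (residue_mod M) k].

Definition has_rank (M : lmodType R) (r : nat) : Prop :=
  forall P : prime_idealr R, minimal_prime P ->
    same_krull_dim {ideal_quot P} R ->
    exists2 l, has_length (loc P)^o l & has_length (loc_mod P M) (r * l).

Definition rank (M : lmodType R) : nat := xget 0%N [set r | has_rank M r].

End NuRank.

Section Frobenius.
Context (R : comNzRingType) (p : nat) (charRp : p \in [pchar R]).

Definition frob (n : nat) : R -> R := iter n (pFrobenius_aut charRp).

Fact frob_zmod_morphism n : zmod_morphism (frob n).
Proof. by elim: n => // n IH x y; rewrite /frob /= [iter n _ _]IH rmorphB. Qed.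

Fact frob_monoid_morphism n : monoid_morphism (frob n).
Proof.
elim: n => // n [IH1 IHM]; split=> [|x y]; rewrite /frob /=.
  by rewrite [iter n _ _]IH1 rmorph1.
by rewrite [iter n _ _]IHM rmorphM.
Qed.

HB.instance Definition _ n :=
  GRing.isZmodMorphism.Build R R (frob n) (frob_zmod_morphism n).
HB.instance Definition _ n :=
  GRing.isMonoidMorphism.Build R R (frob n) (frob_monoid_morphism n).

Lemma frobE n x : frob n x = x ^+ (p ^ n).
Proof.
elim: n => [|n IH]; first by rewrite expr1.
by rewrite /frob /= [iter n _ _]IH pFrobenius_autE -exprM expnSr.
Qed.

(* F^n_*(R): the module structure is r . x = r^(p^n) x. *)
Definition frob_push (n : nat) : lmodType R := restr (frob n) R^o.

Definition F_finite : Prop := fin_gen (frob_push 1).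

(* The n-th Frobenius base change of B, an R-module through its left factor. *)
Definition frob_base_change (n : nat) (B : lmodType R) : lmodType R :=
  tensor (frob n) R^o B.

Definition frob_elt (n : nat) (B : lmodType R) (b : B) : frob_base_change n B :=
  tens (frob n) (1 : R^o) b.

Definition frob_power (n : nat) (B : lmodType R) (A : submodClosed B) :
    submodClosed (frob_base_change n B) :=
  image_mod (tensor_map (f := frob n) (idfun : {linear R^o -> R^o}) (incl A)).

Definition tight_closure (B : lmodType R) (A : submodClosed B) : set B :=
  [set b | exists2 c : R,
     forall P : prime_idealr R, minimal_prime P -> c \notin P &
     exists n0, forall n, (n0 <= n)%N ->
       c *: frob_elt n b \in frob_power n A].

End Frobenius.

Section Closure.
Context (R : comNzRingType) (m : idealr R).
Context (M : nat -> lmodType R) (alpha : lmodType R -> nat).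

(* The length of X n is finite for large n and is o(a n). *)
Definition length_littleo (X : nat -> lmodType R) (a : nat -> nat) : Prop :=
  forall e : rat, 0 < e -> exists n0, forall n, (n0 <= n)%N ->
    exists2 l, has_length (X n) l & l%:R <= e * (a n)%:R.

Context (B : lmodType R).
Implicit Types A : submodClosed B.

(* A' / A, as a submodule of B / A. *)
Definition subquo A A' : submodClosed (quomod A) :=
  image_mod (quo A \o incl A').

(* Im (N (x) A'/A -> N (x) B/A) *)
Definition tensor_image A A' (N : lmodType R) : lmodType R :=
  submod (image_mod (tensor_map (f := idfun : {rmorphism R -> R})
    (idfun : {linear N -> N}) (incl (subquo A A')))).

Definition admissible A A' : Prop :=
  {subset A <= A'} /\
  length_littleo (fun n => tensor_image A A' (M n)) (fun n => alpha (M n)).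

(* A' is the closure of A, when B / A has finite length. *)
Definition is_closure A A' : Prop :=
  admissible A A' /\ forall A'', admissible A A'' -> {subset A'' <= A'}.

Definition ideal_pow (t : nat) : submodClosed R^o :=
  span [set x : R^o | exists2 a : 'I_t -> R,
    forall i, a i \in m & x = \prod_i a i].

(* A + m^t B *)
Definition add_pow A (t : nat) : submodClosed B :=
  span [set x : B | x \in A \/ exists2 c, c \in ideal_pow t & exists b, x = c *: b].

(* For B / A of finite length this agrees with [is_closure], as A + m^t B = A for
   large t. *)
Definition seq_closure A : set B :=
  [set b | forall t : nat, exists2 A', is_closure (add_pow A t) A' & b \in A'].

End Closure.

(* Main.v *)
Require Import Defs.
From mathcomp.multinomials Require Import freeg.
From HB Require Import structures.
From mathcomp Require Import all_boot all_order all_algebra.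
From mathcomp Require Import ring zify.
From mathcomp Require Import boolp classical_sets.

Set Implicit Arguments.
Unset Strict Implicit.
Unset Printing Implicit Defensive.

Import Order.TTheory GRing.Theory Num.Theory.
Local Open Scope ring_scope.
Local Open Scope quotient_scope.
Local Open Scope classical_set_scope.

(* The rank r of F_*(R) is the same at every minimal prime P: going down a maximal
   chain of primes from m to P multiplies [k(-) : k(-)^p] by at least p at each
   step, so that [k(P) : k(P)^p] is at least p^d [K : K^p]; but F^n_*(R) has
   O((p^d [K : K^p])^n) generators, and no fewer than its rank at P, so equality
   holds.  Hence rank and nu of F^n_*(R) are both of order r^n.

   As the rank is constant, there are maps R^r -> F_*(R) -> R^r with both
   composites equal to some c in no minimal prime.  Iterating them gives maps
   R^(r^n) -> F^n_*(R) -> R^(r^n) whose composites are c^2 for every n.  If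
   c^2 b^q were not in A^[q] for some b in A', then for q = p^k the images of r^n
   basis vectors would force the image of F^(k+n)_*(R) (x) A'/A to have length at
   least r^n, which is not o(r^(k+n)).  So smallness implies c^2 b^q in A^[q] for
   every q, with c independent of B, A and b; Krull's intersection theorem then
   removes the terms m^t B.  Conversely, if c kills the Frobenius powers of the
   generators of A' and m^t B is contained in A, the image is a quotient of
   copies of R/(c, m^[p^(n+s)]), whose length is of order p^(-n) r^n. *)

(** * Ideals of noetherian local rings *)

(** Two uniformities carry the argument. First, the ranks of F_*(R) at the minimal primes must
    coincide. Here equidimensionality enters: every minimal prime is the bottom of a chain of d
    strict inclusions, so each gets the same lower bound. Generators are counted only up to a
    constant factor, so the upper bound becomes sharp only after n-th roots, which is why all n are
    needed. Second, the multiplier must not depend on n. Naive composition yields c^(1 + 1/p + 1/p^2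
    + ...), whose exponent stays at most 2; padding each step with powers of c makes it exactly c^2.
    This multiplier acts as a test element: it puts every small submodule inside the tight closure,
    so that a largest small submodule exists, and it survives the intersection over t. Lengths at a
    prime are measured by chains of submodules of R-modules, with the denominators kept as a set
    [W]; localized modules are built only where the definition of rank demands them. *)

Section Submodules.
Context (R : comNzRingType) (M : zmodType) (act : R -> M -> M).

(** Scalar multiplication is a plain function rather than an instance, so that the one type R
    carries the structures of all F^n_*(R) at once and an ideal is a submodule for each of them. *)
Definition is_action : Prop :=
  [/\ forall a x y, act a (x - y) = act a x - act a y,
      forall a b x, act (a - b) x = act a x - act b x,
      forall a b x, act a (act b x) = act (a * b) x &
      forall x, act 1 x = x].

Definition subm (N : set M) : Prop :=
  [/\ N 0, forall x y, N x -> N y -> N (x - y) & forall a x, N x -> N (act a x)].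

Context (N : set M) (Nsub : subm N).

Lemma subm0 : N 0. Proof. by case: Nsub. Qed.

Lemma submB x y : N x -> N y -> N (x - y). Proof. by case: Nsub => _ + _; apply. Qed.

Lemma submZ a x : N x -> N (act a x). Proof. by case: Nsub => _ _; apply. Qed.

Lemma submN x : N x -> N (- x).
Proof. by move=> Nx; rewrite -sub0r; apply: submB => //; exact: subm0. Qed.

Lemma submD x y : N x -> N y -> N (x + y).
Proof. by move=> Nx Ny; rewrite -[y]opprK; apply: submB => //; exact: submN. Qed.

Lemma subm_sum (I : Type) (s : seq I) (F : I -> M) :
  (forall i, N (F i)) -> N (\sum_(i <- s) F i).
Proof. by move=> NF; elim/big_ind: _ => //; [exact: subm0|exact: submD]. Qed.

Lemma submBr x y : N y -> N (x - y) -> N x.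
Proof. by move=> Ny Nxy; rewrite -(subrK y x); apply: submD. Qed.

End Submodules.

Arguments submB {R M act N} Nsub {x y} Nx Ny.
Arguments submD {R M act N} Nsub {x y} Nx Ny.
Arguments submN {R M act N} Nsub {x} Nx.
Arguments submZ {R M act N} Nsub a {x} Nx.
Arguments subm_sum {R M act N} Nsub {I} s {F} NF.
Arguments submBr {R M act N} Nsub {x y} Ny Nxy.

Section Ideals.
Context (R : comNzRingType).
Implicit Types (I J P : set R).

Definition ideal I : Prop := subm (fun a x : R => a * x) I.

Lemma mul_action : is_action (fun a x : R => a * x).
Proof. by split=> *; rewrite ?mulrBr ?mulrBl ?mulrA ?mul1r. Qed.

Definition primei P : Prop :=
  [/\ ideal P, ~ P 1 & forall a b, P (a * b) -> P a \/ P b].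

Lemma primeiX P a n : primei P -> P (a ^+ n) -> P a.
Proof.
move=> [Pid P1 PM]; elim: n => [|n IH]; first by rewrite expr0.
by rewrite exprS => /PM[].
Qed.

Lemma primei_prod P (T : Type) (s : seq T) (F : T -> R) :
  primei P -> (forall i, ~ P (F i)) -> ~ P (\prod_(i <- s) F i).
Proof.
move=> [Pid P1 PM] PF; elim/big_rec: _ => // i x _ Px /PM[] //; exact: PF.
Qed.

Definition adjoin I a : set R := [set x | exists y r, I y /\ x = y + r * a].
Definition colon I a : set R := [set x | I (a * x)].

Lemma adjoin_ideal I a : ideal I -> ideal (adjoin I a).
Proof.
move=> Iid; split=> [|x y [x' [r [Ix ->]]] [y' [s [Iy ->]]]|b _ [y [r [Iy ->]]]].
- by exists 0, 0; rewrite mul0r addr0; split=> //; exact: (subm0 Iid).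
- exists (x' - y'), (r - s); split; first exact: (submB Iid Ix Iy).
  by rewrite mulrBl opprD addrACA.
- by exists (b * y), (b * r); rewrite mulrDr mulrA; split=> //; exact: (submZ Iid _ Iy).
Qed.

Lemma sub_adjoin I a : I `<=` adjoin I a.
Proof. by move=> x Ix; exists x, 0; rewrite mul0r addr0. Qed.

Lemma adjoin_elt I a : ideal I -> adjoin I a a.
Proof. by move=> Iid; exists 0, 1; rewrite mul1r add0r; split=> //; exact: (subm0 Iid). Qed.

Lemma adjoin_le I J a : ideal J -> I `<=` J -> J a -> adjoin I a `<=` J.
Proof.
move=> Jid IJ Ja _ [y [r [Iy ->]]]; apply: (submD Jid); first exact: IJ.
exact: (submZ Jid).
Qed.

Lemma colon_ideal I a : ideal I -> ideal (colon I a).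
Proof.
move=> Iid; split=> [|x y|b x]; rewrite /colon /= ?mulr0.
- exact: (subm0 Iid).
- by rewrite mulrBr; exact: (submB Iid).
- by rewrite mulrCA; exact: (submZ Iid _).
Qed.

Lemma sub_colon I a : ideal I -> I `<=` colon I a.
Proof. by move=> Iid x Ix; exact: (submZ Iid _ Ix). Qed.

Lemma idealT : ideal [set: R]. Proof. by []. Qed.

Lemma ideal0 : ideal [set 0 : R].
Proof. by split=> [//|x y -> ->|a x ->] /=; rewrite ?subr0 ?mulr0. Qed.

Lemma ideal1 I : ideal I -> I 1 -> forall x, I x.
Proof. by move=> Iid I1 x; rewrite -[x]mulr1; apply: (submZ Iid _ I1). Qed.

Definition geni (X : set R) : set R :=
  [set x | forall J, ideal J -> X `<=` J -> J x].

Lemma geni_ideal X : ideal (geni X).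
Proof.
split=> [J Jid _|x y Xx Xy J Jid XJ|a x Xx J Jid XJ].
- exact: (subm0 Jid).
- by apply: (submB Jid (Xx _ _ _) (Xy _ _ _)).
- by apply: (submZ Jid _ (Xx _ _ _)).
Qed.

Lemma sub_geni X : X `<=` geni X. Proof. by move=> x Xx J _; apply. Qed.

Lemma geni_le X J : ideal J -> X `<=` J -> geni X `<=` J.
Proof. by move=> Jid XJ x; apply. Qed.

Definition addi I J : set R := [set x | exists y z, [/\ I y, J z & x = y + z]].

Lemma addi_ideal I J : ideal I -> ideal J -> ideal (addi I J).
Proof.
move=> Iid Jid; split=> [|_ _ [y [z [Iy Jz ->]]] [y' [z' [Iy' Jz' ->]]]|a _ [y [z [Iy Jz ->]]]].
- by exists 0, 0; rewrite addr0; split=> //; [exact: subm0 Iid|exact: subm0 Jid].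
- exists (y - y'), (z - z'); rewrite opprD addrACA; split=> //.
    exact: (submB Iid Iy Iy').
  exact: (submB Jid Jz Jz').
- exists (a * y), (a * z); rewrite mulrDr; split=> //.
    exact: (submZ Iid _ Iy).
  exact: (submZ Jid _ Jz).
Qed.

Lemma addi_le I J K : ideal K -> I `<=` K -> J `<=` K -> addi I J `<=` K.
Proof. by move=> Kid IK JK _ [y [z [/IK Ky /JK Kz ->]]]; exact: (submD Kid Ky Kz). Qed.

Lemma sub_addil I J : ideal J -> I `<=` addi I J.
Proof. by move=> Jid x Ix; exists x, 0; rewrite addr0; split=> //; exact: (subm0 Jid). Qed.

Lemma sub_addir I J : ideal I -> J `<=` addi I J.
Proof. by move=> Iid x Ix; exists 0, x; rewrite add0r; split=> //; exact: (subm0 Iid). Qed.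

End Ideals.

Section IdealStructures.
Context (R : comNzRingType).

Lemma idealr_ideal (I : idealr R) : ideal [set x | x \in I].
Proof. by split=> [|x y|a x] /=; [exact: rpred0|exact: rpredB|exact: idealMr]. Qed.

Lemma prime_idealr_primei (P : prime_idealr R) : primei [set x | x \in P].
Proof.
split; first exact: idealr_ideal.
  by rewrite /= idealr1.
by move=> a b /=; rewrite prime_idealrM => /orP.
Qed.

Lemma ideal_idealr (I : set R) : ideal I -> ~ I 1 ->
  exists J : idealr R, forall x, x \in J <-> I x.
Proof.
move=> Iid I1; pose S : {pred R} := [pred x | `[< I x >]].
have Scl : idealr_closed S.
  split=> [||a x y /asboolP Ix /asboolP Iy].
  - by apply/asboolP; exact: (subm0 Iid).
  - by apply/negP => /asboolP.
  - by apply/asboolP; apply: (submD Iid _ Iy); exact: (submZ Iid _ Ix).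
pose b := isIdealr.Build R S Scl.
pose J : idealr R := HB.pack S b.
by exists J => x; split=> /asboolP.
Qed.

Lemma primei_prime_idealr (P : set R) : primei P ->
  exists Q : prime_idealr R, forall x, x \in Q <-> P x.
Proof.
move=> [Pid P1 PM]; pose S : {pred R} := [pred x | `[< P x >]].
have Scl : idealr_closed S.
  split=> [||a x y /asboolP Ix /asboolP Iy].
  - by apply/asboolP; exact: (subm0 Pid).
  - by apply/negP => /asboolP.
  - by apply/asboolP; apply: (submD Pid _ Iy); exact: (submZ Pid _ Ix).
have SM : prime_idealr_closed S.
  by move=> a b /asboolP/PM[|] ?; apply/orP; [left|right]; apply/asboolP.
pose b := isIdealr.Build R S Scl.
pose b' := isPrimeIdealrClosed.Build R S SM.
pose J : prime_idealr R := HB.pack S b b'.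
by exists J => x; split=> /asboolP.
Qed.

End IdealStructures.

(** A counterexample always has a strictly larger counterexample; choosing repeatedly produces a
    chain that never stabilizes. *)
Lemma acc_ind (T : Type) (cl : set T -> Prop) (Phi : set T -> Prop) :
  (forall N : nat -> set T, (forall n, cl (N n)) -> (forall n, N n `<=` N n.+1) ->
     exists n, forall i, N i `<=` N n) ->
  (forall I, cl I -> (forall J, cl J -> I `<=` J -> ~ (J `<=` I) -> Phi J) -> Phi I) ->
  forall I, cl I -> Phi I.
Proof.
move=> acc IH I0 I0cl; apply: contrapT => nI0.
pose bad I := cl I /\ ~ Phi I.
have step (x : {I | bad I}) : {y : {I | bad I} | sval x `<=` sval y /\ ~ (sval y `<=` sval x)}.
  apply: cid; case: x => I [Icl nI] /=; apply: contrapT => nex; apply: nI.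
  apply: IH => // J Jcl IJ nJI; apply: contrapT => nJ; apply: nex.
  by exists (exist _ J (conj Jcl nJ)).
pose f := fix f n := match n with
  | 0 => exist _ I0 (conj I0cl nI0) | n.+1 => sval (step (f n)) end.
pose N n := sval (f n).
have NS n : N n `<=` N n.+1 /\ ~ (N n.+1 `<=` N n) by rewrite /N /=; case: (step (f n)).
have [n|n|n nmax] := acc N.
- by rewrite /N; case: (f n) => ? [].
- exact: (NS n).1.
- exact: (NS n).2 (nmax n.+1).
Qed.

Section Noetherian.
Context (R : comNzRingType) (Rnoeth : noetherian R).
Implicit Types (I J P : set R).

Lemma ideal_fg I : ideal I -> exists (k : nat) (e : 'I_k -> R),
  (forall i, I (e i)) /\ forall x, I x -> exists c : 'I_k -> R, x = \sum_i c i * e i.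
Proof.
move=> Iid; pose S : submodClosed R^o := Defs.span (I : set R^o).
have SP x : x \in S <-> I x.
  split=> [/asboolP H|Ix]; last by apply/asboolP => T; apply.
  pose p : {pred R^o} := [pred x | `[< I x >]].
  have pcl : submod_closed p.
    split=> [|a y z /asboolP Iy /asboolP Iz]; apply/asboolP; first exact: (subm0 Iid).
    by apply: (submD Iid _ Iz); exact: (submZ Iid _ Iy).
  pose T : submodClosed R^o := HB.pack p (GRing.isSubmodClosed.Build R R^o p pcl).
  have IT : I `<=` [set` T] by move=> y Iy /=; apply/asboolP.
  by have /asboolP := H T IT.
have [k [e eP]] := Rnoeth S; exists k, (fun i => \val (e i)); split.
  by move=> i; apply/SP; exact: (valP (e i)).
move=> x /SP xS; have [c xE] := eP (Submod xS); exists c.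
by rewrite -[LHS]/(incl S (Submod xS)) xE linear_sum; apply: eq_bigr => i _; rewrite linearZ.
Qed.

Lemma ideal_acc (J : nat -> set R) : (forall n, ideal (J n)) ->
  (forall n, J n `<=` J n.+1) -> exists n, forall i, J i `<=` J n.
Proof.
move=> Jid JS.
have Jle i j : (i <= j)%N -> J i `<=` J j.
  elim: j => [|j IHj]; first by rewrite leqn0 => /eqP->.
  by rewrite leq_eqVlt => /orP[/eqP->//|/IHj h] x /h /JS.
pose U := \bigcup_n J n.
have Uid : ideal U.
  split=> [|x y [i _ xi] [j _ yj]|a x [i _ xi]].
  - by exists 0 => //; exact: (subm0 (Jid 0)).
  - exists (maxn i j) => //; apply: (submB (Jid _)).
      exact: (Jle _ _ (leq_maxl i j) _ xi).
    exact: (Jle _ _ (leq_maxr i j) _ yj).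
  - by exists i => //; exact: (submZ (Jid i) _ xi).
have [k [e [eU eP]]] := ideal_fg Uid.
have [g gP] : {g : 'I_k -> nat & forall i, J (g i) (e i)}.
  exact: choice (fun i => let: ex_intro2 n _ h := eU i in ex_intro _ n h).
exists (\max_i g i) => l x Jx; have [c ->] := eP x (ex_intro2 _ _ l I Jx).
apply: (subm_sum (Jid _)) => i; apply: (submZ (Jid _)).
by apply: (Jle (g i) _ _ _ (gP i)); exact: (leq_bigmax i).
Qed.

Lemma noeth_ind (Phi : set R -> Prop) :
  (forall I, ideal I -> (forall J, ideal J -> I `<=` J -> ~ (J `<=` I) -> Phi J) ->
     Phi I) ->
  forall I, ideal I -> Phi I.
Proof. exact: acc_ind ideal_acc. Qed.

(** If ab lies in I but a and b do not, then I + Ra and I : a are strictly larger than I and are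
    linked by the exact sequence 0 -> R/(I : a) -> R/I -> R/(I + Ra) -> 0. Statements that pass
    along such sequences thus reduce to the domains R/P. *)
Lemma devissage (Phi : set R -> Prop) :
  (forall I, ideal I -> I 1 -> Phi I) ->
  (forall P, primei P ->
     (forall J, ideal J -> P `<=` J -> ~ (J `<=` P) -> Phi J) -> Phi P) ->
  (forall I a, ideal I -> Phi (adjoin I a) -> Phi (colon I a) -> Phi I) ->
  forall I, ideal I -> Phi I.
Proof.
move=> PhiT Phip Phic; apply: noeth_ind => I Iid IH.
have [I1|nI1] := pselect (I 1); first exact: PhiT.
have [Ip|nIp] := pselect (forall a b, I (a * b) -> I a \/ I b).
  by apply: Phip => // J; apply: IH.
have [a [b [Iab nIa nIb]]] : exists a b, [/\ I (a * b), ~ I a & ~ I b].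
  apply: contrapT => nex; apply: nIp => a b Iab; apply: contrapT => /not_orP[nIa nIb].
  by apply: nex; exists a, b.
apply: (Phic _ a Iid); apply: IH.
- exact: adjoin_ideal.
- exact: sub_adjoin.
- by move=> /(_ _ (adjoin_elt a Iid)).
- exact: colon_ideal.
- exact: sub_colon.
- by move=> /(_ b Iab).
Qed.

(* A shortest list of primes whose intersection is nilpotent consists of minimal
   primes, and each member is missed by an element lying in all the others. *)
Lemma minimal_primes_list (Rred : reduced_ring R) :
  exists (s : nat) (P : 'I_s -> set R) (t : 'I_s -> R),
    [/\ forall i, primei (P i), forall i, ~ P i (t i),
        forall i x, P i x -> t i * x = 0,
        forall i j, j != i -> P j (t i) &
        forall Q, primei Q -> exists i, P i `<=` Q].
Proof.
pose good s (P : 'I_s -> set R) :=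
  (forall i, primei (P i)) /\ forall x, (forall i, P i x) -> x = 0.
have ex : exists s, `[< exists P : 'I_s -> set R, good s P >].
  (* For a general ideal the common elements of the primes only have a power in I; for I = 0
     reducedness makes them zero. *)
  suff H : forall I, ideal I -> exists ps : seq (set R),
      (forall i : 'I_(size ps), primei (nth I ps i)) /\
      forall x, (forall i : 'I_(size ps), nth I ps i x) -> exists k, I (x ^+ k).
    have [ps [psp psx]] := H _ (ideal0 R).
    exists (size ps); apply/asboolP; exists (fun i => nth [set 0] ps i); split=> // x /psx[k].
    exact: Rred.
  apply: devissage => [I Iid I1|P Pp _|I a Iid].
  - by exists [::]; split=> [[]//|x _]; exists 0%N; rewrite expr0.
  - exists [:: P]; split=> [i|x /(_ ord0) Px]; first by rewrite ord1.
    by exists 1%N.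
  - move=> [ps1 [p1 x1]] [ps2 [p2 x2]]; exists (ps1 ++ ps2); split=> [[i ilt]|x xP] /=.
      rewrite size_cat in ilt; rewrite nth_cat; case: ltnP => h.
        by rewrite (set_nth_default (adjoin I a)) //; exact: (p1 (Ordinal h)).
      have h' : (i - size ps1 < size ps2)%N by rewrite ltn_subLR.
      by rewrite (set_nth_default (colon I a)) //; exact: (p2 (Ordinal h')).
    have [k [y [r [Iy xk]]]] : exists k, adjoin I a (x ^+ k).
      apply: x1 => i.
      have h : (i < size (ps1 ++ ps2))%N by rewrite size_cat ltn_addr.
      have := xP (Ordinal h); rewrite /= nth_cat ltn_ord.
      by rewrite (set_nth_default (adjoin I a)).
    have [l xl] : exists k, colon I a (x ^+ k).
      apply: x2 => i.
      have h : (size ps1 + i < size (ps1 ++ ps2))%N by rewrite size_cat ltn_add2l.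
      have := xP (Ordinal h); rewrite /= nth_cat ltnNge leq_addr /= addKn.
      by rewrite (set_nth_default (colon I a)).
    exists (k + l)%N; rewrite exprD xk mulrDl -mulrA; apply: (submD Iid); last exact: submZ.
    by rewrite mulrC; exact: submZ.
case: (ex_minnP ex) => s /asboolP[P [Pp P0]] smin.
(* Dropping [P i] from a shortest list must fail, and the failure is a nonzero element of all the
   other primes. *)
have tP i : {t | (forall j, j != i -> P j t) /\ t != 0}.
  apply: cid; apply: contrapT => nex.
  case: s i P Pp P0 smin nex {ex} => [[]//|s] i P Pp P0 smin nex.
  suff : (s.+1 <= s)%N by rewrite ltnn.
  apply: smin; apply/asboolP; exists (fun j => P (lift i j)); split=> [j//|x xP].
  apply/eqP; apply: contrapT => /negP x0; apply: nex; exists x; split=> // j ji.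
  by have [k ->|e] := unliftP i j; [exact: xP|rewrite e eqxx in ji].
exists s, P, (fun i => sval (tP i)); split=> //.
- move=> i; case: (tP i) => t [tj t0] /= Pt; move/eqP: t0; apply; apply: P0 => j.
  by have [->//|/tj] := eqVneq j i.
- move=> i x Px; case: (tP i) => t [tj t0] /=; apply: P0 => j.
  have [Pid _ _] := Pp j.
  have [->|/tj Pt] := eqVneq j i; first by have [Pi _ _] := Pp i; exact: (submZ Pi _ Px).
  by rewrite mulrC; exact: (submZ Pid _ Pt).
- by move=> i j; case: (tP i) => t [tj t0] /= /tj.
- move=> Q Qp; apply: contrapT => nex.
  have yP i : {y | P i y /\ ~ Q y}.
    apply: cid; apply: contrapT => nex'; apply: nex; exists i => x Px.
    by apply: contrapT => Qx; apply: nex'; exists x.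
  apply: (primei_prod (s := index_enum 'I_s) Qp (fun i => (svalP (yP i)).2)).
  rewrite (P0 (\prod_i _)); first by case: Qp => Qid _ _; exact: (subm0 Qid).
  move=> i; rewrite (bigD1 i) //= mulrC; case: (Pp i) => Pid _ _; apply: (submZ Pid).
  exact: (svalP (yP i)).1.
Qed.

End Noetherian.

Section Local.
Context (R : comNzRingType) (m : idealr R) (Rnoeth : noetherian R).
Context (Rlocal : local_ring m).

(** Noetherian induction takes the place of Zorn's lemma: a proper ideal that is not maximal lies in
    a strictly larger proper one. *)
Lemma local_max (I : set R) : ideal I -> ~ I 1 -> I `<=` [set x | x \in m].
Proof.
move: I; apply: (noeth_ind Rnoeth) => I Iid IH I1.
have [J JP] := ideal_idealr Iid I1.
have [Jmax|nJmax] := pselect (maximal_ideal J).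
  by move=> x /JP; rewrite (Rlocal.2 _ Jmax).
have [K [JK nKJ]] : exists K : idealr R, {subset J <= K} /\ ~ {subset K <= J}.
  by apply: contrapT => nex; apply: nJmax => K JK; apply: contrapT => nKJ; apply: nex; exists K.
have : [set x | x \in K] `<=` [set x | x \in m].
  apply: IH; rewrite /= ?idealr1 //.
  - exact: idealr_ideal.
  - by move=> x /JP /JK.
  - by move=> KI; apply: nKJ => x /KI /JP.
by move=> Km x /JP /JK /Km.
Qed.

Lemma local_unit x : x \notin m -> exists y, y * x = 1.
Proof.
move=> xm; apply: contrapT => nex.
have xid := adjoin_ideal x (ideal0 R).
suff : x \in m by rewrite (negPf xm).
apply: (local_max xid); last exact: (adjoin_elt x (ideal0 R)).
by move=> [y [r [-> e]]]; apply: nex; exists r; rewrite e add0r.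
Qed.

Lemma local_primei : primei [set x | x \in m].
Proof.
split; first exact: idealr_ideal.
  by rewrite /= idealr1.
move=> a b /= abm; case: (boolP (a \in m)) => [|/local_unit[y ya]]; [by left|right].
by rewrite -[b]mul1r -ya -mulrA idealMr.
Qed.

End Local.

(** * Length after localization *)

Definition mulclosed (R : comNzRingType) (W : set R) : Prop :=
  W 1 /\ forall s t, W s -> W t -> W (s * t).

Lemma mulclosed1 (R : comNzRingType) : mulclosed [set 1 : R].
Proof. by split=> // s t -> ->; rewrite /= mulr1. Qed.

Lemma mulclosed_primei (R : comNzRingType) (P : set R) : primei P -> mulclosed (~` P).
Proof. by move=> [_ P1 PM]; split=> // s t Ps Pt /PM[]. Qed.

Section Action.
Context (R : comNzRingType) (M : zmodType) (act : R -> M -> M) (actP : is_action act).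

Lemma act_act0 a : act a 0 = 0.
Proof. by case: actP => aB _ _ _; have := aB a 0 0; rewrite !subrr. Qed.

Lemma act_actD a x y : act a (x + y) = act a x + act a y.
Proof.
have [aB _ _ _] := actP.
have aN : act a (- y) = - act a y by have := aB a 0 y; rewrite act_act0 !sub0r.
by rewrite -{1}[y]opprK aB aN opprK.
Qed.

Lemma subm_zero : subm act [set 0].
Proof. by split=> [//|x y -> ->|a x ->] /=; rewrite ?subr0 ?act_act0. Qed.

End Action.

Section Chains.
Context (R : comNzRingType) (M : zmodType) (act : R -> M -> M) (W : set R).
Implicit Types (N X : set M).

(* A chain of length k from N to N' all of whose steps stay proper after
   localization at W; for W the complement of a prime Q, the supremum of the
   possible k is the length of (N'/N)_Q. *)
Fixpoint chain k N N' : Prop :=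
  match k with
  | 0 => N `<=` N'
  | k.+1 => exists N1 x, [/\ subm act N1, N `<=` N1, N1 x,
              forall s, W s -> ~ N (act s x) & chain k N1 N']
  end.

Definition lenle N N' l : Prop := forall k, chain k N N' -> (k <= l)%N.

Lemma chain_sub k N N' : chain k N N' -> N `<=` N'.
Proof. by elim: k N => [//|k IH] N [N1 [x [_ NN1 _ _ /IH]]]; exact: subset_trans. Qed.

Lemma chain_le k N0 N N0' N' : N0 `<=` N -> N' `<=` N0' -> chain k N N' -> chain k N0 N0'.
Proof.
move=> + le'; elim: k N0 N => [|k IH] N0 N le0 /=.
  by move=> NN' x /le0 /NN' /le'.
move=> [N1 [x [N1s NN1 N1x Nx ch]]]; exists N1, x; split=> //.
- exact: (subset_trans le0 NN1).
- by move=> s Ws /le0; exact: Nx.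
- by apply: IH ch.
Qed.

Lemma chain_cat k k' N N' N'' : chain k N N' -> chain k' N' N'' -> chain (k + k') N N''.
Proof.
elim: k N => [|k IH] N /=; first by move=> NN'; exact: chain_le.
by move=> [N1 [x [? ? ? ? ch]]] ch'; exists N1, x; split=> //; exact: IH.
Qed.

Lemma lenle_le l N0 N N0' N' : N0 `<=` N -> N' `<=` N0' -> lenle N0 N0' l -> lenle N N' l.
Proof. by move=> le0 le' H k ch; apply: H; exact: chain_le ch. Qed.

Lemma lenleW l l' N N' : (l <= l')%N -> lenle N N' l -> lenle N N' l'.
Proof. by move=> ll' H k /H kl; exact: leq_trans kl ll'. Qed.

Lemma chain_seq (N : nat -> set M) k :
  (forall i, (i < k)%N -> [/\ subm act (N i.+1), N i `<=` N i.+1 &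
     exists2 x, N i.+1 x & forall s, W s -> ~ N i (act s x)]) ->
  chain k (N 0%N) (N k).
Proof.
elim: k N => [|k IH] N H; first by move=> x.
have [s0 l0 [x Nx xN]] := H 0%N isT.
exists (N 1%N), x; split=> //; apply: (IH (fun i => N i.+1)) => i ik.
exact: (H i.+1).
Qed.

Definition addm N N' : set M := [set z | exists x y, [/\ N x, N' y & z = x + y]].

Lemma addm_subm N N' : is_action act -> subm act N -> subm act N' -> subm act (addm N N').
Proof.
move=> actP Ns Ns'; split.
- by exists 0, 0; rewrite addr0; split=> //; [exact: subm0 Ns|exact: subm0 Ns'].
- move=> _ _ [x [y [Nx Ny ->]]] [x' [y' [Nx' Ny' ->]]].
  exists (x - x'), (y - y'); rewrite opprD addrACA; split=> //.
    exact: (submB Ns).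
  exact: (submB Ns').
- move=> a _ [x [y [Nx Ny ->]]]; exists (act a x), (act a y); split.
  + exact: (submZ Ns).
  + exact: (submZ Ns').
  + exact: act_actD.
Qed.

Lemma setI_subm N N' : subm act N -> subm act N' -> subm act (N `&` N').
Proof.
move=> [N0 NB NZ] [N0' NB' NZ']; split=> // [x y [? ?] [? ?]|a x [? ?]]; split; auto.
Qed.

(** Subadditivity of length. A chain X_i is replaced by the two chains of all X_i ∩ N' and all X_i +
    N'; by the modular law each proper step stays proper in at least one of them. *)
Lemma lenle_cat N N' N'' l l' : is_action act -> mulclosed W ->
  subm act N -> subm act N' -> subm act N'' -> N `<=` N' -> N' `<=` N'' ->
  lenle N N' l -> lenle N' N'' l' -> lenle N N'' (l + l').
Proof.
move=> actP WP Ns Ns' Ns'' NN' NN'' H H' k.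
have [aB aBl aA a1] := actP; have [W1 WM] := WP.
suff main : forall X, subm act X -> chain k X N'' -> exists k1 k2,
    [/\ (k <= k1 + k2)%N, chain k1 (X `&` N') N' & chain k2 (addm X N') N''].
  move=> /(main _ Ns)[k1 [k2 [kk c1 c2]]]; apply: (leq_trans kk); apply: leq_add.
    by apply: H; apply: chain_le c1 => // x Nx; split=> //; exact: NN'.
  apply: H'; apply: chain_le c2 => // x Nx; exists 0, x; rewrite add0r; split=> //.
  exact: (subm0 Ns).
elim: k => [|k IH] X Xs.
  move=> XN; exists 0%N, 0%N; split=> // [x []//|_ [x [y [/XN Nx /NN'' Ny ->]]]].
  exact: (submD Ns'').
move=> [X1 [x [X1s XX1 X1x Xx /(IH _ X1s)[k1 [k2 [kk c1 c2]]]]]].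
have [strict|nstrict] := pselect (exists2 y, addm X1 N' y &
    forall s, W s -> ~ addm X N' (act s y)).
  case: strict => y X1y yX; exists k1, k2.+1; rewrite addnS ltnS; split=> //.
    by apply: chain_le c1 => // z [/XX1].
  exists (addm X1 N'), y; split=> //; first exact: addm_subm.
  by move=> _ [z [w [/XX1 ? ? ->]]]; exists z, w.
(* The sum does not grow, so some multiple of [x] splits as z + n with z in [X]; then [n] witnesses
   the growth of the intersection with N'. *)
have [s Ws [z [n [Xz Nn sx]]]] : exists2 s, W s & addm X N' (act s x).
  apply: contrapT => nex; apply: nstrict; exists x.
    by exists x, 0; rewrite addr0; split=> //; exact: (subm0 Ns').
  by move=> s Ws XN; apply: nex; exists s.
exists k1.+1, k2; rewrite addSn ltnS; split=> //.
  exists (X1 `&` N'), n; split=> //.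
  - exact: setI_subm.
  - by move=> y [/XX1].
  - split=> //; rewrite (_ : n = act s x - z); last by rewrite sx addrAC subrr add0r.
    by apply: (submB X1s); [exact: (submZ X1s)|exact: XX1].
  - move=> t Wt [Xn _]; apply: (Xx (t * s)); first exact: WM.
    rewrite -aA sx (_ : z + n = n - (- z)); last by rewrite opprK addrC.
    by rewrite aB; apply: (submB Xs) => //; apply: (submZ Xs); exact: (submN Xs).
by apply: chain_le c2 => // _ [y [w [/XX1 ? ? ->]]]; exists y, w.
Qed.

Lemma lenle0 N N' : W 1 -> (forall x, act 1 x = x) -> N' `<=` N -> lenle N N' 0.
Proof.
move=> W1 a1 le [//|k] [N1 [x [_ _ N1x Nx /chain_sub ch]]].
by case: (Nx 1 W1); rewrite a1; apply: le; exact: ch.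
Qed.

End Chains.

(** * Transport of chains along linear maps *)

Section Transfer.
Context (R : comNzRingType) (W : set R) (M1 M2 : zmodType).
Context (act1 : R -> M1 -> M1) (act2 : R -> M2 -> M2).

Definition act_linear (f : M1 -> M2) : Prop :=
  (forall x y, f (x - y) = f x - f y) /\ forall a x, f (act1 a x) = act2 a (f x).

Context (f : M1 -> M2) (fP : act_linear f).

Lemma act_linear0 : f 0 = 0.
Proof. by have := fP.1 0 0; rewrite !subrr. Qed.

Lemma preimage_subm N : subm act2 N -> subm act1 (f @^-1` N).
Proof.
move=> Ns; split=> [|x y|a x]; rewrite /preimage /= ?act_linear0 ?fP.1 ?fP.2.
- exact: (subm0 Ns).
- exact: (submB Ns).
- exact: (submZ Ns).
Qed.

(** Length does not grow under the surjection N1'/N1 -> N2'/N2: a chain downstairs is pulled back,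
    and its witnesses are lifted modulo N2. *)
Lemma lenle_surj N1 N1' N2 N2' l : is_action act2 -> subm act1 N1' ->
  N1 `<=` N1' -> (forall x, N1 x -> N2 (f x)) ->
  (forall z, N2' z -> exists n y, [/\ N2 n, N1' y & z = n + f y]) ->
  lenle act1 W N1 N1' l -> subm act2 N2 -> lenle act2 W N2 N2' l.
Proof.
move=> actP2 N1's N11 fN1 N2'P H N2s k ch; apply: H.
suff main X : subm act2 X -> N2 `<=` X -> chain act2 W k X N2' ->
    chain act1 W k (N1' `&` f @^-1` X) N1'.
  by apply: chain_le (main _ N2s _ ch) => // x N1x; split; [exact: N11|exact: fN1].
elim: k X {ch} => [|k IH] X Xs N2X; first by move=> _ x [].
move=> [X1 [x [X1s XX1 X1x Xx ch]]].
have [n [y [N2n N1y xE]]] : exists n y, [/\ N2 n, N1' y & x = n + f y].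
  by apply: N2'P; exact: (chain_sub ch).
have X1n : X1 n by apply: XX1; exact: N2X.
exists (N1' `&` f @^-1` X1), y; split.
- exact: (setI_subm N1's (preimage_subm X1s)).
- by move=> z [N1z /XX1].
- split=> //; rewrite /preimage /= (_ : f y = x - n); last by rewrite xE addrAC subrr add0r.
  exact: (submB X1s).
- move=> s Ws [_]; rewrite /preimage /= fP.2 => Xy; apply: (Xx s Ws).
  have [aB _ _ _] := actP2.
  by rewrite xE act_actD //; apply: (submD Xs) => //; apply: (submZ Xs); exact: N2X.
- by apply: IH => //; exact: subset_trans XX1.
Qed.

(** Here [f] embeds N1'/N1 into N2'/N2, so images enlarged by N2 keep the steps proper. *)
Lemma chain_inj k N1 N1' N2 N2' : is_action act2 -> subm act1 N1 -> subm act2 N2 ->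
  subm act2 N2' -> N2 `<=` N2' ->
  (forall x, N1' x -> N2' (f x)) -> (forall x, N1' x -> N2 (f x) -> N1 x) ->
  chain act1 W k N1 N1' -> chain act2 W k N2 N2'.
Proof.
move=> actP2 N1s N2s N2's N22 fN fI ch.
suff main X : subm act1 X -> N1 `<=` X -> chain act1 W k X N1' ->
    chain act2 W k (addm (f @` X) N2) N2'.
  apply: chain_le (main _ N1s _ ch) => // x N2x.
  exists 0, x; split=> //; last by rewrite add0r.
  by exists 0; [exact: subm0 N1s|exact: act_linear0].
elim: k X {ch} => [|k IH] X Xs N1X.
  by move=> XN _ [_ [y [[x /XN Xx <-] /N22 Ny ->]]]; apply: (submD N2's) => //; exact: fN.
move=> [X1 [x [X1s XX1 X1x Xx ch]]].
have imS Y : subm act1 Y -> subm act2 (f @` Y).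
  move=> Ys; split=> [|_ _ [y Yy <-] [z Yz <-]|a _ [y Yy <-]].
  - by exists 0; [exact: subm0 Ys|exact: act_linear0].
  - by exists (y - z); [exact: (submB Ys)|exact: fP.1].
  - by exists (act1 a y); [exact: (submZ Ys)|exact: fP.2].
exists (addm (f @` X1) N2), (f x); split.
- by apply: addm_subm => //; exact: imS.
- by move=> _ [_ [z [[y /XX1 Xy <-] N2z ->]]]; exists (f y), z; split=> //; exists y.
- by exists (f x), 0; rewrite addr0; split=> //; exact: subm0 N2s.
- move=> s Ws [_ [z [[y Xy <-] N2z e]]]; apply: (Xx s Ws); apply: (submBr Xs Xy).
  apply: N1X; apply: fI; last by rewrite fP.1 fP.2 e addrC addKr.
  by apply: (chain_sub ch); apply: (submB X1s); [exact: (submZ X1s)|exact: XX1].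
- by apply: IH => //; exact: subset_trans XX1.
Qed.

Lemma lenle_inj l N1 N1' N2 N2' : is_action act2 -> subm act1 N1 -> subm act2 N2 ->
  subm act2 N2' -> N2 `<=` N2' ->
  (forall x, N1' x -> N2' (f x)) -> (forall x, N1' x -> N2 (f x) -> N1 x) ->
  lenle act2 W N2 N2' l -> lenle act1 W N1 N1' l.
Proof. by move=> ? ? ? ? ? ? ? H k ch; apply: H; exact: chain_inj ch. Qed.

End Transfer.

(** N2'/N2 is a quotient of [k] copies of N1'/N1; the copies are peeled off one at a time by
    subadditivity. *)
Lemma lenle_gens (R : comNzRingType) (W : set R) (M1 M2 : zmodType)
    (act1 : R -> M1 -> M1) (act2 : R -> M2 -> M2) (k : nat) (f : 'I_k -> M1 -> M2)
    N1 N1' N2 N2' l :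
  is_action act2 -> mulclosed W -> (forall i, act_linear act1 act2 (f i)) ->
  subm act1 N1' -> N1 `<=` N1' -> (forall i x, N1 x -> N2 (f i x)) -> subm act2 N2 ->
  (forall z, N2' z -> exists n y,
     [/\ N2 n, forall i, N1' (y i) & z = n + \sum_i f i (y i)]) ->
  lenle act1 W N1 N1' l -> lenle act2 W N2 N2' (k * l).
Proof.
move=> actP WP fP N1's N11 fN N2s N2'P H.
pose S k (f : 'I_k -> M1 -> M2) := [set z | exists n (y : 'I_k -> M1),
  [/\ N2 n, forall i, N1' (y i) & z = n + \sum_i f i (y i)]].
suff : lenle act2 W N2 (S k f) (k * l) by apply: lenle_le.
have Ss j (g : 'I_j -> M1 -> M2) : (forall i, act_linear act1 act2 (g i)) -> subm act2 (S j g).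
  move=> gP; split.
  - exists 0, (fun=> 0); rewrite add0r big1 => [|i _]; last exact: act_linear0.
    by split=> // [|i]; [exact: subm0 N2s|exact: subm0 N1's].
  - move=> _ _ [n [y [N2n Ny ->]]] [n' [y' [N2n' Ny' ->]]].
    exists (n - n'), (fun i => y i - y' i); split; first exact: (submB N2s).
      by move=> i; exact: (submB N1's).
    rewrite opprD addrACA -sumrB; congr (_ + _); apply: eq_bigr => i _.
    by rewrite (gP i).1.
  - move=> a _ [n [y [N2n Ny ->]]]; exists (act2 a n), (fun i => act1 a (y i)).
    split; [exact: (submZ N2s)|by move=> i; exact: (submZ N1's)|].
    rewrite act_actD //; congr (_ + _).
    rewrite (big_morph (act2 a) (act_actD actP a) (act_act0 actP a)).
    by apply: eq_bigr => i _; rewrite (gP i).2.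
elim: k f fP fN {N2'P} => [|k IH] f fP fN.
  have [_ _ _ a1] := actP; apply: lenle0 => //; first by case: WP.
  by move=> _ [n [y [N2n _ ->]]]; rewrite big_ord0 addr0.
pose g i := f (widen_ord (leqnSn k) i).
have gP i : act_linear act1 act2 (g i) by exact: fP.
rewrite mulSn addnC; apply: (lenle_cat actP WP N2s (Ss _ g gP) (Ss _ f fP)).
- by move=> x N2x; exists x, (fun=> 0); rewrite big1 ?addr0 => [|i _];
    [split=> // i; exact: subm0 N1's|exact: act_linear0 (fP _)].
- move=> _ [n [y [N2n Ny ->]]].
  exists n, (fun i => if unlift ord_max i is Some j then y j else 0); split=> //.
    by move=> i; case: unliftP => [j _|_]; [exact: Ny|exact: subm0 N1's].
  rewrite big_ord_recr /= unlift_none (act_linear0 (fP _)) addr0; congr (_ + _).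
  apply: eq_bigr => i _; congr (f _ _).
  case: unliftP => [j e|/(congr1 val) /= e]; last by have := ltn_ord i; rewrite e ltnn.
  by congr y; apply: val_inj; have := congr1 val e; rewrite /= /bump leqNgt ltn_ord.
- by apply: IH => [i|i x]; [exact: fP|exact: fN].
- apply: (lenle_surj (fP ord_max) actP N1's N11 _ _ H); last exact: Ss.
    move=> x N1x; exists (f ord_max x), (fun=> 0); rewrite big1 ?addr0 => [|i _].
      by split=> [|i|//]; [exact: fN|exact: subm0 N1's].
    exact: (act_linear0 (fP _)).
  move=> _ [n [y [N2n Ny ->]]]; rewrite big_ord_recr /= addrA.
  exists (n + \sum_(i < k) g i (y (widen_ord (leqnSn k) i))), (y ord_max); split=> //.
  by exists n, (fun i => y (widen_ord (leqnSn k) i)).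
Qed.

Lemma chain_act (R : comNzRingType) (W W' : set R) (M : zmodType) (act act' : R -> M -> M)
    k N N' :
  (forall X, subm act X -> subm act' X) ->
  (forall s, W' s -> exists2 s', W s' & forall x, act' s x = act s' x) ->
  chain act W k N N' -> chain act' W' k N N'.
Proof.
move=> subE strE; elim: k N => [//|k IH] N [N1 [x [N1s NN1 N1x Nx ch]]].
exists N1, x; split=> //; [exact: subE| |exact: IH].
by move=> s /strE[s' Ws' ->]; exact: Nx.
Qed.

(** * Ordinary length and the Jordan-Hölder theorem *)

Section Length.
Context (R : comNzRingType) (M : lmodType R).
Local Notation act := (fun (a : R) (x : M) => a *: x).
Local Notation chain1 := (chain act [set 1]).
Local Notation lenle1 := (lenle act [set 1]).

Lemma scale_action : is_action act.
Proof. by split=> *; rewrite ?scalerBr ?scalerBl ?scalerA ?scale1r. Qed.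

Lemma subm_submod (S : submodClosed M) : subm act [set x | x \in S].
Proof.
split=> [|x y /= xS yS|a x /=]; [exact: rpred0| |exact: rpredZ].
by rewrite -scaleN1r rpredD ?rpredZ.
Qed.

Lemma submod_subm (N : set M) : subm act N ->
  exists S : submodClosed M, forall x, x \in S <-> N x.
Proof.
move=> Ns; pose p : {pred M} := [pred x | `[< N x >]].
have pcl : submod_closed p.
  split=> [|a y z /asboolP Ny /asboolP Nz]; apply/asboolP; first exact: (subm0 Ns).
  by apply: (submD Ns _ Nz); exact: (submZ Ns _ Ny).
pose T : submodClosed M := HB.pack p (GRing.isSubmodClosed.Build R M p pcl).
by exists T => x; split=> /asboolP.
Qed.

(** A simple factor admits no chain of two steps, so subadditivity bounds every chain by the number
    of factors. *)
Lemma has_length_lenle l : has_length M l -> lenle1 [set 0] [set: M] l.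
Proof.
move=> [N [N0 Nl Nstep]].
suff H j : (j <= l)%N -> lenle1 [set x | x \in N 0%N] [set x | x \in N j] j.
  by apply: lenle_le (H l _) => // x _; exact: Nl.
elim: j => [_|j IH jl]; first by apply: lenle0 => // x; rewrite scale1r.
have Nle i : (i <= l)%N -> {subset N 0%N <= N i}.
  elim: i => [_ x //|i IHi] il x /(IHi (ltnW il)); have [s _ _] := Nstep i il; exact: s.
have [sj nj Tj] := Nstep j jl.
apply: (@lenleW _ _ _ _ (j + 1)); first by rewrite addn1.
apply: (lenle_cat scale_action (mulclosed1 R) (subm_submod _) (subm_submod (N j))
  (subm_submod _) _ _ (IH (ltnW jl))).
- by move=> x /(Nle _ (ltnW jl)).
- by move=> x; exact: sj.
move=> [|[|k]] // [N1 [x [N1s NN1 N1x Nx [N2 [y [N2s N12 N2y N1y /chain_sub ch]]]]]].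
have [T TP] := submod_subm N1s.
have [||H|H] := Tj T.
- by move=> z /NN1 /TP.
- by move=> z /TP /N12 /ch.
- by case: (Nx 1 erefl); rewrite /= scale1r; apply: H; apply/TP.
- by case: (N1y 1 erefl); rewrite scale1r; apply/TP; apply: H; exact: ch.
Qed.

Lemma has_length_chain l : has_length M l -> chain1 l [set 0] [set: M].
Proof.
move=> [N [N0 Nl Nstep]].
suff : chain1 l [set x | x \in N 0%N] [set x | x \in N l].
  by apply: chain_le => // x ->; exact: rpred0.
apply: (chain_seq (N := fun i => [set x | x \in N i])) => i il.
have [si ni _] := Nstep i il; split; [exact: subm_submod|by move=> x; exact: si|].
apply: contrapT => nex; apply: ni => x Nx; apply: contrapT => nNx; apply: nex.
by exists x => // _ ->; rewrite scale1r.
Qed.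

Lemma has_length_unique l l' : has_length M l -> has_length M l' -> l = l'.
Proof.
move=> H H'; apply/eqP; rewrite eqn_leq.
by rewrite (has_length_lenle H' (has_length_chain H)) (has_length_lenle H (has_length_chain H')).
Qed.

Lemma chain_has_length k : chain1 k [set 0] [set: M] ->
  lenle1 [set 0] [set: M] k -> has_length M k.
Proof.
suff main (X : submodClosed M) : chain1 k [set x | x \in X] [set: M] ->
    lenle1 [set x | x \in X] [set: M] k -> exists N : nat -> submodClosed M,
    [/\ N 0%N = X, forall x, x \in N k & forall i, (i < k)%N ->
      [/\ {subset N i <= N i.+1}, ~ {subset N i.+1 <= N i} &
       forall T : submodClosed M, {subset N i <= T} -> {subset T <= N i.+1} ->
         {subset T <= N i} \/ {subset N i.+1 <= T}]].
  have zs := subm_zero scale_action.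
  have [Z ZP] := submod_subm zs.
  move=> ch H; have [||N [N0 Nk Ni]] := main Z.
  - by apply: chain_le ch => // x /ZP.
  - by apply: lenle_le H => // x ->; apply/ZP.
  by exists N; split=> // x; rewrite N0 => /ZP.
elim: k X => [|k IH] X.
  move=> _ H; exists (fun=> X); split=> // x; apply: contrapT => xX.
  suff /H : chain1 1 [set x | x \in X] [set: M] by [].
  by exists [set: M], x; split=> // _ ->; rewrite scale1r.
move=> [X1 [x [X1s XX1 X1x Xx ch]]] H.
have {}Xx : x \notin X by apply/negP => xX; case: (Xx 1 erefl); rewrite /= scale1r.
have [S SP] := submod_subm X1s.
have [||N [N0 Nk Ni]] := IH S.
- by apply: chain_le ch => // y /SP.
- move=> j chj; rewrite -ltnS; apply: H; exists X1, x; split=> //.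
    by move=> _ -> /=; rewrite scale1r; exact/negP.
  by apply: chain_le chj => // y /SP.
exists (fun i => if i is j.+1 then N j else X); split=> // -[_|i ik]; last exact: Ni.
rewrite N0; split=> [y /XX1 /SP //|/(_ x)|T XT TS].
  by move=> /(_ ((SP x).2 X1x)) xX; rewrite xX in Xx.
apply: contrapT => /not_orP[nTX nST].
have [y [Ty nXy]] : exists y, y \in T /\ y \notin X.
  apply: contrapT => nex; apply: nTX => y Ty; apply: contrapT => /negP Xy.
  by apply: nex; exists y.
have [z [Sz nTz]] : exists z, z \in S /\ z \notin T.
  apply: contrapT => nex; apply: nST => z Sz; apply: contrapT => /negP Tz.
  by apply: nex; exists z.
(* A submodule strictly between the first two terms would refine a chain whose length is already
   maximal. *)
suff /H : chain1 k.+2 [set x | x \in X] [set: M] by rewrite ltnn.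
exists [set x | x \in T], y; split=> //; first exact: subm_submod.
  by move=> _ -> /=; rewrite scale1r; exact/negP.
exists X1, z; split=> //.
- by move=> w /TS /SP.
- exact/SP.
- by move=> _ -> /=; rewrite scale1r; exact/negP.
Qed.

Lemma lenle_has_length l : lenle1 [set 0] [set: M] l ->
  exists2 k, has_length M k & (k <= l)%N.
Proof.
move=> H; pose ex k := `[< chain1 k [set 0] [set: M] >].
have ex0 : exists k, ex k by exists 0%N; apply/asboolP.
have exl k : ex k -> (k <= l)%N by move/asboolP/H.
case: (ex_maxnP ex0 exl) => k /asboolP ch kmax; exists k; last by apply: H.
by apply: chain_has_length => // j chj; apply: kmax; apply/asboolP.
Qed.

End Length.

(** * The rank of the Frobenius pushforward *)

Lemma subrBACA (V : zmodType) (x y z w : V) : x - y - (z - w) = x - z - (y - w).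
Proof. by rewrite !opprB [w - z]addrC addrACA [- y + w]addrC. Qed.

Lemma widen_ordS k (i : 'I_k) : widen_ord (leqnSn k) i = lift ord_max i.
Proof. by apply: val_inj; rewrite /= /bump leqNgt ltn_ord. Qed.

Section Independence.
Context (R : comNzRingType) (M : zmodType) (act : R -> M -> M) (actP : is_action act).

Definition lincomb k (u : 'I_k -> M) (c : 'I_k -> R) : M := \sum_i act (c i) (u i).

Lemma lincombB k (u : 'I_k -> M) c c' :
  lincomb u (fun i => c i - c' i) = lincomb u c - lincomb u c'.
Proof. by case: actP => _ aBl _ _; rewrite -sumrB; apply: eq_bigr => i _. Qed.

Lemma lincombZ k (u : 'I_k -> M) a c : act a (lincomb u c) = lincomb u (fun i => a * c i).
Proof.
rewrite /lincomb (big_morph (act a) (act_actD actP a) (act_act0 actP a)).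
by apply: eq_bigr => i _; case: actP => _ _ + _; apply.
Qed.

Lemma act0 x : act 0 x = 0.
Proof. by case: actP => _ aBl _ _; have := aBl 0 0 x; rewrite !subrr. Qed.

Lemma lincomb0 k (u : 'I_k -> M) : lincomb u (fun=> 0) = 0.
Proof. by apply: big1 => i _; exact: act0. Qed.

Lemma lincombD k (u : 'I_k -> M) c c' :
  lincomb u (fun i => c i + c' i) = lincomb u c + lincomb u c'.
Proof.
have -> : (fun i => c i + c' i) = (fun i => c i - (0 - c' i)).
  by apply/funext => i; rewrite sub0r opprK.
by rewrite !lincombB lincomb0 sub0r opprK.
Qed.

Lemma lincomb_delta k (u : 'I_k -> M) j a :
  lincomb u (fun i => a * (i == j)%:R) = act a (u j).
Proof.
rewrite /lincomb (bigD1 j) //= eqxx mulr1 big1 ?addr0 // => i /negPf->.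
by rewrite mulr0 act0.
Qed.

Lemma lincomb_subm k (u : 'I_k -> M) c N : subm act N -> (forall i, N (u i)) -> N (lincomb u c).
Proof. by move=> Ns Nu; apply: (subm_sum Ns) => i; exact: (submZ Ns _ (Nu i)). Qed.

(** When P is prime and [I] contains PM, this is linear independence over k(P) of the images of [u]
    in the localization of M/I at P, with denominators cleared. *)
Definition indep (I : set M) (P : set R) k (u : 'I_k -> M) : Prop :=
  forall c, I (lincomb u c) -> forall i, P (c i).

(** The chain consists of I plus the spans of the first j elements; if a multiple s u_j fell into
    the j-th term, it would give a relation with coefficient s at u_j, forcing s into P. *)
Lemma indep_chain I P k (u : 'I_k -> M) N : subm act I -> subm act N -> I `<=` N ->
  (forall i, N (u i)) -> indep I P u -> chain act (~` P) k I N.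
Proof.
move=> Is Ns IN Nu uP.
pose X j := [set z | exists2 c : 'I_k -> R,
  forall i : 'I_k, (j <= i)%N -> c i = 0 & I (z - lincomb u c)].
suff : chain act (~` P) k (X 0%N) (X k).
  apply: chain_le.
    by move=> x Ix; exists (fun=> 0) => //; rewrite lincomb0 subr0.
  move=> x [c _ /IN Nx]; rewrite -(subrK (lincomb u c) x); apply: (submD Ns Nx).
  exact: lincomb_subm.
have [_ _ aA a1] := actP.
apply: chain_seq => j jk; split.
- split=> [|x y [c c0 Ix] [c' c0' Iy]|a x [c c0 Ix]].
  + by exists (fun=> 0) => //; rewrite lincomb0 subr0; exact: subm0 Is.
  + exists (fun i => c i - c' i) => [i ji|]; first by rewrite c0 ?c0' ?subr0.
    by rewrite lincombB subrBACA; exact: (submB Is).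
  + exists (fun i => a * c i) => [i ji|]; first by rewrite c0 ?mulr0.
    by rewrite -lincombZ; case: actP => <- _ _ _; exact: (submZ Is _ Ix).
- by move=> x [c c0 Ix]; exists c => // i /ltnW; exact: c0.
- exists (u (Ordinal jk)).
    exists (fun i => 1 * (i == Ordinal jk)%:R) => [i|].
      by move=> ji; rewrite -val_eqE /= gtn_eqF ?mulr0.
    by rewrite lincomb_delta a1 subrr; exact: subm0 Is.
  move=> s Ps [c c0 Ix]; apply: Ps.
  have := uP (fun i => s * (i == Ordinal jk)%:R - c i).
  rewrite lincombB lincomb_delta => /(_ Ix (Ordinal jk)).
  by rewrite eqxx mulr1 c0 // subr0.
Qed.

Lemma indep_max I P b : (forall k (u : 'I_k -> M), indep I P u -> (k <= b)%N) ->
  exists r, (exists u : 'I_r -> M, indep I P u) /\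
    forall k (u : 'I_k -> M), indep I P u -> (k <= r)%N.
Proof.
move=> Hb; pose ex k := `[< exists u : 'I_k -> M, indep I P u >].
have ex0 : exists k, ex k.
  by exists 0%N; apply/asboolP; exists (fun=> 0) => c _ [].
have exb k : ex k -> (k <= b)%N by move=> /asboolP[u /Hb].
case: (ex_maxnP ex0 exb) => r /asboolP ur rmax; exists r; split=> // k u uP.
by apply: rmax; apply/asboolP; exists u.
Qed.

(** Adjoining [x] to a maximal independent family creates a relation; the coefficient of [x] in it
    cannot lie in P, so it serves as the denominator [s]. *)
Lemma indep_span I P r (u : 'I_r -> M) : subm act I ->
  (forall a x, P a -> I (act a x)) -> indep I P u ->
  (forall u' : 'I_r.+1 -> M, ~ indep I P u') ->
  forall x, exists2 s, ~ P s & exists c, I (act s x - lincomb u c).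
Proof.
move=> Is PI uP umax x; apply: contrapT => nex.
pose u' (i : 'I_r.+1) := if unlift ord_max i is Some j then u j else x.
apply: (umax u') => c.
have -> : lincomb u' c = lincomb u (fun i => c (lift ord_max i)) + act (c ord_max) x.
  rewrite /lincomb big_ord_recr /= /u' unlift_none; congr (_ + _).
  apply: eq_bigr => i _.
  by rewrite widen_ordS liftK.
move=> Ic.
have Pmax : P (c ord_max).
  apply: contrapT => nP; apply: nex; exists (c ord_max) => //.
  exists (fun i => 0 - c (lift ord_max i)).
  by rewrite lincombB lincomb0 sub0r opprK addrC.
move=> i; have [j ->|->//] := unliftP ord_max i.
apply: (uP (fun i => c (lift ord_max i))).
by have := submB Is Ic (PI _ x Pmax); rewrite addrK.
Qed.

Lemma lenle_span (W : set R) (J : set R) I k (e : 'I_k -> M) l :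
  mulclosed W -> subm act I -> ideal J -> (forall a i, J a -> I (act a (e i))) ->
  (forall x, exists n c, I n /\ x = n + lincomb e c) ->
  lenle (fun a x : R => a * x) W J [set: R] l -> lenle act W I [set: M] (k * l).
Proof.
move=> WP Is Jid JI eP; have [_ aBl aA _] := actP.
apply: (lenle_gens (f := fun i a => act a (e i))) => // [i|i a|z _].
- by split=> [a b|a b]; rewrite ?aBl ?aA.
- exact: JI.
- by have [n [c [In ->]]] := eP z; exists n, c.
Qed.

End Independence.

(** R/P localized at P is a field: the witness [x] of a first step lies outside P, so it is itself a
    denominator, and it moves every [y] into N1. *)
Lemma lenle_primei (R : comNzRingType) (P : set R) : primei P ->
  lenle (fun a x : R => a * x) (~` P) P [set: R] 1.
Proof.
move=> [Pid P1 PM] [|[|k]] // [N1 [x [N1s PN1 N1x Px [N2 [y [_ _ _ Ny _]]]]]].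
case: (Ny x); first by move=> Px1; apply: (Px 1 P1); rewrite mul1r.
by rewrite mulrC; exact: (submZ N1s _ N1x).
Qed.

Section Frobenius.
Context (R : comNzRingType) (p : nat) (charRp : p \in [pchar R]).
Implicit Types (I J P Q X Y : set R).

Lemma exprpB n (x y : R) : (x - y) ^+ (p ^ n) = x ^+ (p ^ n) - y ^+ (p ^ n).
Proof. by rewrite -!(frobE charRp) rmorphB. Qed.

Lemma exprpD n (x y : R) : (x + y) ^+ (p ^ n) = x ^+ (p ^ n) + y ^+ (p ^ n).
Proof. by rewrite -!(frobE charRp) rmorphD. Qed.

Lemma exprp_sum n (T : Type) (s : seq T) (F : T -> R) :
  (\sum_(i <- s) F i) ^+ (p ^ n) = \sum_(i <- s) F i ^+ (p ^ n).
Proof.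
rewrite -(frobE charRp) rmorph_sum; apply: eq_bigr => i _; exact: frobE.
Qed.

Lemma pprime : prime p. Proof. exact: pcharf_prime charRp. Qed.

Lemma pexp_gt0 n : (0 < p ^ n)%N. Proof. by rewrite expn_gt0 prime_gt0 ?pprime. Qed.

Lemma ideal_exprp n I a x : ideal I -> I a -> I (a ^+ (p ^ n) * x).
Proof.
move=> Iid Ia; rewrite mulrC; apply: (submZ Iid).
by rewrite -(prednK (pexp_gt0 n)) exprSr; exact: (submZ Iid).
Qed.

(* R with this action is F^n_*(R). *)
Definition frob_act n (a x : R) : R := a ^+ (p ^ n) * x.

Lemma frob_act_action n : is_action (frob_act n).
Proof.
split=> [a x y|a b x|a b x|x]; rewrite /frob_act.
- by rewrite mulrBr.
- by rewrite exprpB mulrBl.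
- by rewrite mulrA exprMn.
- by rewrite expr1n mul1r.
Qed.

Lemma frob_act_ideal n I : ideal I -> subm (frob_act n) I.
Proof.
by move=> Iid; split=> [|x y Ix Iy|a x]; [exact: subm0 Iid|exact: (submB Iid)|exact: (submZ Iid)].
Qed.

Lemma frob_act_subm n k X : subm (frob_act n) X -> subm (frob_act (n + k)) X.
Proof.
move=> Xs; split=> [|x y Ix Iy|a x Xx]; [exact: subm0 Xs|exact: (submB Xs)|].
by rewrite /frob_act expnD mulnC exprM; exact: (submZ Xs).
Qed.

Lemma frob_act_chain W n k l N N' : (forall s i, W s -> W (s ^+ i)) ->
  chain (frob_act n) W l N N' -> chain (frob_act (n + k)) W l N N'.
Proof.
move=> WX; apply: chain_act => [X|s Ws]; first exact: frob_act_subm.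
exists (s ^+ (p ^ k)) => [|x]; first exact: WX.
by rewrite /frob_act expnD mulnC exprM.
Qed.

(* The maximal number of elements of F_*(R) that are independent modulo P,
   that is [k(P) : k(P)^p]. *)
Definition frank P r : Prop :=
  (exists u : 'I_r -> R, indep (frob_act 1) P P u) /\
  forall k (u : 'I_k -> R), indep (frob_act 1) P P u -> (k <= r)%N.

Definition fgens n k (e : 'I_k -> R) : Prop :=
  forall x, exists c, x = lincomb (frob_act n) e c.

Lemma frank_exists P k (e : 'I_k -> R) : primei P -> fgens 1 e -> exists r, frank P r.
Proof.
move=> Pp eP; have [Pid _ _] := Pp; have actP := frob_act_action 1.
have Ps := frob_act_ideal 1 Pid.
have bound : lenle (frob_act 1) (~` P) P [set: R] (k * 1).
  apply: (lenle_span (e := e) actP (mulclosed_primei Pp) Ps Pid _ _ (lenle_primei Pp)).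
    by move=> a i; exact: ideal_exprp.
  move=> x; have [c ->] := eP x; exists 0, c; rewrite add0r; split=> //.
  exact: subm0 Pid.
apply: (indep_max (b := k * 1)) => j u uP; apply: bound.
by apply: (indep_chain actP Ps _ _ _ uP); rewrite //; exact: frob_act_ideal.
Qed.

Lemma frank_unique P r r' : frank P r -> frank P r' -> r = r'.
Proof.
move=> [[u uP] umax] [[u' uP'] umax']; apply/eqP; rewrite eqn_leq.
by rewrite (umax' _ _ uP) (umax _ _ uP').
Qed.

Lemma frank_gt0 P r : primei P -> frank P r -> (0 < r)%N.
Proof.
move=> Pp [_ /(_ 1%N (fun=> 1))]; apply => c; rewrite /lincomb big_ord1 /frob_act mulr1 => Pc i.
by rewrite ord1; exact: (primeiX Pp Pc).
Qed.

(* [F_*(k(Q))] has dimension r over [k(Q)]. *)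
Lemma chain_frank n Q r k X Y : primei Q -> frank Q r -> subm (frob_act n) X ->
  chain (frob_act n) (~` Q) k X Y -> subm (frob_act n) Y ->
  chain (frob_act n.+1) (~` Q) (k * r) X Y.
Proof.
move=> Qp [[w wP] _] + + Ys; elim: k X => [//|k IH] X Xs [X1 [x [X1s XX1 X1x Xx ch]]].
rewrite mulSn; apply: chain_cat (IH _ X1s ch).
have tw Z : subm (frob_act n) Z -> subm (frob_act n.+1) Z by rewrite -addn1; exact: frob_act_subm.
(* A combination of the w_j^(p^n) x with coefficients c_j acting by p^(n+1)-th powers equals (sum of
   c_j^p w_j)^(p^n) x. A relation therefore forces that sum into Q, and the step at [x] refines into
   r steps. *)
apply: (indep_chain (frob_act_action _) (tw _ Xs) (tw _ X1s) XX1
  (u := fun j => w j ^+ (p ^ n) * x)).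
  by move=> i; exact: (submZ X1s).
move=> c Xc; apply: wP; apply: contrapT => Qc; apply: (Xx _ Qc).
rewrite /frob_act exprp_sum mulr_suml; move: Xc; congr X; apply: eq_bigr => i _.
by rewrite /frob_act exprMn -exprM -expnD add1n mulrA.
Qed.

End Frobenius.

(** * Approximate bases of F^n_*(R) *)

Section Splitting.
Context (R : comNzRingType) (p : nat) (charRp : p \in [pchar R]).
Implicit Types (I J P Q X Y : set R).

(* Linear maps R^T -> F^n_*(R), given by the images u of the basis vectors, and
   F^n_*(R) -> R^T, given by its coordinates alpha, whose two composites are
   multiplication by g. *)
Definition quasi_basis n (T : finType) (u : T -> R) (alpha : T -> R -> R) g : Prop :=
  [/\ forall i x y, alpha i (x - y) = alpha i x - alpha i y,
      forall i a x, alpha i (a ^+ (p ^ n) * x) = a * alpha i x,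
      forall x, \sum_i alpha i x ^+ (p ^ n) * u i = g ^+ (p ^ n) * x &
      forall i j, alpha i (u j) = g * (i == j)%:R].

Lemma quasi_basis0 n (T : finType) (u : T -> R) alpha g i :
  quasi_basis n u alpha g -> alpha i 0 = 0.
Proof. by case=> aB _ _ _; have := aB i 0 0; rewrite !subrr. Qed.

Lemma quasi_basisD n (T : finType) (u : T -> R) alpha g i x y : quasi_basis n u alpha g ->
  alpha i (x + y) = alpha i x + alpha i y.
Proof.
move=> H; have a0 := quasi_basis0 i H; case: H => aB _ _ _.
have aN : alpha i (- y) = - alpha i y by have := aB i 0 y; rewrite a0 !sub0r.
by rewrite -{1}[y]opprK aB aN opprK.
Qed.

Lemma quasi_basis_sum n (T : finType) (u : T -> R) alpha g i (S : Type) (s : seq S) F :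
  quasi_basis n u alpha g ->
  alpha i (\sum_(j <- s) F j) = \sum_(j <- s) alpha i (F j).
Proof.
by move=> H; apply: big_morph => [x y|]; [exact: (quasi_basisD _ _ _ H)|exact: quasi_basis0 H].
Qed.

(** One denominator serves all x: it is the product of the denominators of the finitely many
    generators [e]. *)
Lemma frank_span P k (e : 'I_k -> R) r (u : 'I_r -> R) : primei P -> fgens p 1 e ->
  indep (frob_act p 1) P P u ->
  (forall k (u' : 'I_k -> R), indep (frob_act p 1) P P u' -> (k <= r)%N) ->
  exists s, ~ P s /\ forall x, exists c, P (frob_act p 1 s x - lincomb (frob_act p 1) u c).
Proof.
move=> Pp eP uP umax; have [Pid P1 PM] := Pp.
have actP := frob_act_action charRp 1; have [aB _ aA _] := actP.
have Ps := frob_act_ideal p 1 Pid.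
have spanx x : exists2 s, ~ P s & exists c, P (frob_act p 1 s x - lincomb (frob_act p 1) u c).
  apply: (indep_span actP Ps _ uP) => [a y|u' /umax]; last by rewrite ltnn.
  exact: ideal_exprp.
have sP j : exists s, ~ P s /\ exists c, P (frob_act p 1 s (e j) - lincomb (frob_act p 1) u c).
  by have [s ? ?] := spanx (e j); exists s.
have [s0 s0P] := choice sP; pose s := \prod_j s0 j; exists s; split.
  by apply: primei_prod => // j; exact: (s0P j).1.
move=> x; have [c ->] := eP x.
have : forall j, exists b, P (frob_act p 1 s (e j) - lincomb (frob_act p 1) u b).
  move=> j; have [_ [b Pb]] := s0P j.
  exists (fun i => (\prod_(j' | j' != j) s0 j') * b i).
  by rewrite -lincombZ // /s (bigD1 j) //= mulrC -aA -aB; exact: (submZ Ps).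
move=> /choice[b bP]; exists (fun i => \sum_j c j * b j i).
have -> : lincomb (frob_act p 1) u (fun i => \sum_j c j * b j i) =
    \sum_j frob_act p 1 (c j) (lincomb (frob_act p 1) u (b j)).
  under eq_bigr do rewrite lincombZ //.
  rewrite exchange_big; apply: eq_bigr => i _ /=.
  by rewrite /frob_act -mulr_suml exprp_sum.
rewrite lincombZ // -sumrB; apply: (subm_sum Pid) => j.
by rewrite mulrC -aA -aB; apply: (submZ Ps).
Qed.

(** The coordinates of s x in [u] are determined only modulo P. Multiplied by [t], which kills P,
    they become well defined, hence linear in x. That they are multiples of [t] is what allows
    gluing over several primes. *)
Lemma quasi_basis_prime P t k (e : 'I_k -> R) r :
  primei P -> ~ P t -> (forall x, P x -> t * x = 0) -> fgens p 1 e -> frank p P r ->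
  exists (u : 'I_r -> R) alpha s, [/\ ~ P s, quasi_basis 1 u alpha (t * s) &
    forall i x, exists y, alpha i x = t * y].
Proof.
move=> Pp Pt tP eP [[u uP] umax]; have [Pid P1 PM] := Pp.
have actP := frob_act_action charRp 1.
have Ps := frob_act_ideal p 1 Pid.
have p0 := prime_gt0 (pprime charRp).
have [s [Ps0 aP]] := frank_span Pp eP uP umax.
have [A AP] := choice aP.
pose alpha i x := t * A x i.
have alphaE x b i : P (frob_act p 1 s x - lincomb (frob_act p 1) u b) -> alpha i x = t * b i.
  move=> Pb; apply/eqP; rewrite -subr_eq0 -mulrBr; apply/eqP/tP.
  apply: (uP (fun i => A x i - b i)); rewrite lincombB //.
  have := submB Pid Pb (AP x); rewrite opprB addrC addrA subrK.
  by [].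
exists u, alpha, s; split=> //; last by move=> i x; exists (A x i).
have [aB aBl aA _] := actP.
have tqP y : P y -> t ^+ (p ^ 1) * y = 0.
  by move=> /tP ty; rewrite expn1 -(prednK p0) exprSr -mulrA ty mulr0.
split=> [i x y|i a x|x|i j].
- rewrite /alpha -mulrBr; apply: (alphaE _ (fun i => A x i - A y i)).
  by rewrite lincombB // aB subrBACA; exact: (submB Pid).
- rewrite /alpha mulrCA; apply: (alphaE _ (fun i => a * A x i)).
  by rewrite -lincombZ // -[a ^+ _ * x]/(frob_act p 1 a x) aA mulrC -aA -aB; apply: (submZ Ps).
- under eq_bigr do rewrite /alpha exprMn -mulrA.
  rewrite -mulr_sumr exprMn -mulrA; apply/eqP; rewrite eq_sym -subr_eq0 -mulrBr.
  by rewrite tqP //; exact: AP.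
- rewrite -mulrA; apply: (alphaE _ (fun i => s * (i == j)%:R)).
  by rewrite lincomb_delta // subrr; exact: subm0 Pid.
Qed.

Lemma mulr_sum_orth n (y z : 'I_n -> R) : (forall i j, j != i -> y i * z j = 0) ->
  (\sum_i y i) * (\sum_i z i) = \sum_i y i * z i.
Proof.
move=> yz; rewrite mulr_suml; apply: eq_bigr => i _.
by rewrite mulr_sumr (bigD1 i) //= big1 ?addr0 // => j; exact: yz.
Qed.

(** The products t_i t_j with i different from j vanish, so the t_i act like idempotents of the
    total ring of fractions and the families at the single primes can be added. This needs the same
    r at every prime. *)
Lemma quasi_basis_glue n (P : 'I_n -> set R) (t : 'I_n -> R) k (e : 'I_k -> R) r :
  (forall i, primei (P i)) -> (forall i, ~ P i (t i)) ->
  (forall i x, P i x -> t i * x = 0) -> (forall i j, j != i -> P j (t i)) ->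
  fgens p 1 e -> (forall i, frank p (P i) r) ->
  exists (u : 'I_r -> R) alpha c, quasi_basis 1 u alpha c /\ forall i, ~ P i c.
Proof.
move=> Pp Pt tP tPj eP fr.
have H i : exists z : ('I_r -> R) * ('I_r -> R -> R) * R,
    [/\ ~ P i z.2, quasi_basis 1 z.1.1 z.1.2 (t i * z.2) &
    forall j x, exists y, z.1.2 j x = t i * y].
  have [u [a [s [? ? ?]]]] := quasi_basis_prime (Pp i) (Pt i) (tP i) eP (fr i).
  by exists (u, a, s).
have [f fP] := choice H.
pose u i := (f i).1.1; pose a i := (f i).1.2; pose s i := (f i).2.
have sP i : ~ P i (s i) by have [] := fP i.
have qP i : quasi_basis 1 (u i) (a i) (t i * s i) by have [] := fP i.
have aP i j x : exists y, a i j x = t i * y by have [_ _] := fP i; apply.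
have p0 := prime_gt0 (pprime charRp).
have tt i j : j != i -> t i * t j = 0.
  by move=> ji; rewrite mulrC; apply: tP; exact: tPj.
have ta i j l x : j != i -> t j * a i l x = 0.
  by move=> ji; have [y ->] := aP i l x; rewrite mulrA tt ?mul0r // eq_sym.
have tqE (x : R) i : t i ^+ (p ^ 1) * x = t i ^+ p.-1 * (t i * x).
  by rewrite expn1 -{1}(prednK p0) exprSr mulrA.
(* One factor t_i comes from the constant t_i s_i at the i-th prime, the other from the t_i^p put in
   front of [u i], which the coordinates release as t_i. *)
pose c := \sum_i t i ^+ 2 * s i.
exists (fun j => \sum_i t i ^+ (p ^ 1) * u i j), (fun j x => \sum_i a i j x), c; split; last first.
  move=> i; rewrite /c (bigD1 i) //= => Pc; have [Pid _ PM] := Pp i.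
  have Ps : P i (\sum_(j | j != i) t j ^+ 2 * s j).
    rewrite big_mkcond; apply: (subm_sum Pid) => j; case: eqP => [_|/eqP ji] /=.
      exact: subm0 Pid.
    rewrite mulrC; apply: (submZ Pid); rewrite expr2; apply: (submZ Pid).
    by apply: tPj; rewrite eq_sym.
  have := submB Pid Pc Ps; rewrite addrK => /PM[/(primeiX (Pp i))|]; last exact: sP.
  exact: Pt.
split=> [j x y|j b x|x|j l].
- by rewrite -sumrB; apply: eq_bigr => i _; case: (qP i) => -> _ _ _.
- by rewrite mulr_sumr; apply: eq_bigr => i _; case: (qP i) => _ -> _ _.
- have -> : c ^+ (p ^ 1) * x =
      \sum_i \sum_j t i ^+ (p ^ 1) * (a i j x ^+ (p ^ 1) * u i j).
    rewrite exprp_sum // mulr_suml; apply: eq_bigr => i _; rewrite -mulr_sumr.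
    by case: (qP i) => _ _ -> _; rewrite !exprMn !mulrA.
  rewrite exchange_big; apply: eq_bigr => j _ /=.
  rewrite exprp_sum // mulr_sum_orth => [|i i' ii'].
    by apply: eq_bigr => i _; rewrite mulrCA.
  have [y ->] := aP i j x.
  by rewrite mulrA -exprMn mulrAC tt // mul0r expr0n expn_eq0 gtn_eqF //= mul0r.
- have -> : \sum_i a i j (\sum_i' t i' ^+ (p ^ 1) * u i' l) = \sum_i t i * a i j (u i l).
    apply: eq_bigr => i _; rewrite (quasi_basis_sum _ _ _ (qP i)) (bigD1 i) //=.
    case: (qP i) => _ aZ _ _; rewrite aZ big1 ?addr0 // => i' ii'; rewrite aZ.
    exact: ta.
  rewrite /c mulr_suml; apply: eq_bigr => i _; case: (qP i) => _ _ _ ->.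
  by rewrite expr2 !mulrA.
Qed.

Lemma quasi_basis_id g : quasi_basis 0 (fun _ : 'I_1 => 1) (fun _ x => g * x) g.
Proof.
split=> [_ x y|_ a x|x|i j]; rewrite ?mulrBr ?expn0 ?expr1 //; first by rewrite mulrCA.
  by rewrite big_ord1 mulr1.
by rewrite !ord1 eqxx.
Qed.

(* Composing F_*(R) ~ R^S with F^n_*(R) ~ R^T; the factor h = c^(p-2) in the
   middle keeps the constant equal to c^2, independently of n. *)
Lemma quasi_basis_comp n (S T : finType) (w : S -> R) gamma c (u : T -> R) alpha :
  quasi_basis 1 w gamma c -> quasi_basis n u alpha (c ^+ 2) ->
  quasi_basis n.+1 (fun ij : S * T => w ij.1 ^+ (p ^ n) * (c ^+ (p - 2)) ^+ (p ^ n) * u ij.2)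
    (fun ij x => gamma ij.1 (alpha ij.2 x)) (c ^+ 2).
Proof.
move=> [gB gZ gs gd] [aB aZ as_ ad].
have p2 := prime_gt1 (pprime charRp).
(* [alpha] contributes c^2, which the padding completes to c^p; [gamma] pulls that out as c and adds
   its own c, so the constant is c^2 again. *)
have cp : c ^+ (p - 2) * c ^+ 2 = c ^+ (p ^ 1) by rewrite -exprD subnK // expn1.
have g0 i : gamma i 0 = 0 by have := gB i 0 0; rewrite !subrr.
split=> [[i j] x y|[i j] b x|x|[i j] [i' j']] /=.
- by rewrite aB gB.
- by rewrite -add1n expnD exprM aZ gZ.
- rewrite -(pair_bigA _ (fun i j => gamma i (alpha j x) ^+ (p ^ n.+1) *
    (w i ^+ (p ^ n) * (c ^+ (p - 2)) ^+ (p ^ n) * u j))) /= exchange_big /=.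
  have E j : \sum_i gamma i (alpha j x) ^+ (p ^ n.+1) *
      (w i ^+ (p ^ n) * (c ^+ (p - 2)) ^+ (p ^ n) * u j) =
      (c ^+ (p ^ 1)) ^+ (p ^ n) * (c ^+ (p - 2)) ^+ (p ^ n) * (alpha j x ^+ (p ^ n) * u j).
    transitivity ((\sum_i gamma i (alpha j x) ^+ (p ^ 1) * w i) ^+ (p ^ n) *
        (c ^+ (p - 2)) ^+ (p ^ n) * u j).
      rewrite exprp_sum // !mulr_suml; apply: eq_bigr => i _.
      by rewrite exprMn -(exprM _ (p ^ 1)) -expnD add1n !mulrA.
    by rewrite gs exprMn; ring.
  rewrite (eq_bigr _ (fun j _ => E j)) -mulr_sumr as_ mulrA -!exprMn -mulrA cp.
  by rewrite -expr2 (exprAC c (p ^ 1) 2) -(exprM (c ^+ 2)) -expnD add1n.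
- have -> : w i' ^+ (p ^ n) * c ^+ (p - 2) ^+ (p ^ n) * u j' =
    (w i' * c ^+ (p - 2)) ^+ (p ^ n) * u j' by rewrite exprMn.
  rewrite aZ ad; have [<-|jj'] := eqVneq j j'.
    by rewrite mulr1 -mulrA cp mulrC gZ gd xpair_eqE eqxx andbT mulrA expr2.
  by rewrite !mulr0 g0 xpair_eqE (negPf jj') andbF mulr0.
Qed.

Lemma quasi_basis_reindex n (S T : finType) (h : S -> T) (u : T -> R) alpha g :
  bijective h -> quasi_basis n u alpha g ->
  quasi_basis n (fun i => u (h i)) (fun i => alpha (h i)) g.
Proof.
move=> hb [aB aZ as_ ad]; split=> // [x|i j].
  by rewrite -as_ (reindex h) //; exact: onW_bij.
by rewrite ad (inj_eq (bij_inj hb)).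
Qed.

Lemma quasi_basis_iter r (w : 'I_r -> R) gamma c : quasi_basis 1 w gamma c ->
  forall n, exists (u : 'I_(r ^ n) -> R) alpha, quasi_basis n u alpha (c ^+ 2).
Proof.
move=> H; elim=> [|n [u [alpha IH]]].
  exists (fun=> 1), (fun _ x => c ^+ 2 * x); exact: quasi_basis_id.
have E : #|{: 'I_r * 'I_(r ^ n)}| = (r ^ n.+1)%N by rewrite card_prod !card_ord expnS.
have hb : bijective (fun i : 'I_(r ^ n.+1) => enum_val (cast_ord (esym E) i)).
  exists (fun x => cast_ord E (enum_rank x)) => x.
    by rewrite enum_valK cast_ordKV.
  by rewrite cast_ordK enum_rankK.
by have := quasi_basis_reindex hb (quasi_basis_comp H IH); eexists; eexists; eassumption.
Qed.

End Splitting.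

(** * Chains of primes and growth of lengths *)

Lemma lenle_exact (R : comNzRingType) (M : zmodType) (act : R -> M -> M) W N N' l :
  N `<=` N' -> lenle act W N N' l -> exists2 L, chain act W L N N' & lenle act W N N' L.
Proof.
move=> NN' H; pose ex k := `[< chain act W k N N' >].
have ex0 : exists k, ex k by exists 0%N; apply/asboolP.
have exl k : ex k -> (k <= l)%N by move/asboolP/H.
case: (ex_maxnP ex0 exl) => k /asboolP ch kmax; exists k => // j chj.
by apply: kmax; apply/asboolP.
Qed.

Section IdealLength.
Context (R : comNzRingType) (act : R -> R -> R) (W : set R).
Context (actP : is_action act) (actM : forall a b x, act a (b * x) = b * act a x).
Context (WP : mulclosed W).
Implicit Types (I J K : set R).

Lemma act_ideal I : ideal I -> subm act I.
Proof.
move=> Iid; split=> [|x y Ix Iy|a x Ix]; [exact: subm0 Iid|exact: (submB Iid)|].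
by rewrite -[x]mulr1 actM mulrC; exact: (submZ Iid).
Qed.

Lemma mul_act_linear a : act_linear act act (fun x => a * x).
Proof. by split=> [x y|b x]; rewrite ?mulrBr ?actM. Qed.

(** Multiplication by [a] maps R/(J : a) onto (J + Ra)/J. *)
Lemma lenle_adjoin J a l1 l2 : ideal J ->
  lenle act W (colon J a) [set: R] l1 -> lenle act W (adjoin J a) [set: R] l2 ->
  lenle act W J [set: R] (l1 + l2).
Proof.
move=> Jid H1; have aid := adjoin_ideal a Jid; have cid := colon_ideal a Jid.
apply: (lenle_cat actP WP (act_ideal Jid) (act_ideal aid) (act_ideal (idealT R))) => //.
  exact: sub_adjoin.
apply: (lenle_surj (mul_act_linear a) actP (act_ideal (idealT R)) _ _ _ H1) => //.
  by move=> _ [y [r [Jy ->]]]; exists y, r; rewrite mulrC.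
exact: act_ideal.
Qed.

(** Each quotient of K + (x^i) by K + (x^(i+1)) is an image of R/(K + (x)) under multiplication by
    x^i. *)
Lemma lenle_powers K x l j : ideal K -> lenle act W (adjoin K x) [set: R] l ->
  lenle act W (adjoin K (x ^+ j)) [set: R] (j * l).
Proof.
move=> Kid H; elim: j => [|j IH].
  have [W1 _] := WP; have [_ _ _ a1] := actP; apply: lenle0 => // y _.
  by exists 0, y; rewrite expr0 mulr1 add0r; split=> //; exact: subm0 Kid.
have aid i := act_ideal (adjoin_ideal (x ^+ i) Kid).
rewrite mulSn; apply: (lenle_cat actP WP (aid j.+1) (aid j) (act_ideal (idealT R)) _ _ _ IH) => //.
  by move=> _ [y [r [Ky ->]]]; exists y, (r * x); rewrite exprS mulrA.
apply: (lenle_surj (mul_act_linear (x ^+ j)) actP (act_ideal (idealT R)) _ _ _ H) => //.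
- move=> _ [y [r [Ky ->]]]; exists (x ^+ j * y), r; split; first exact: (submZ Kid).
  by rewrite mulrDr mulrCA exprSr.
- by move=> _ [y [r [Ky ->]]]; exists y, r; rewrite [r * _]mulrC; split=> //; exact: sub_adjoin.
Qed.

End IdealLength.

(** * Comparison of the ranks at adjacent primes *)

Section Kunz.
Context (R : comNzRingType) (p : nat) (charRp : p \in [pchar R]) (Rnoeth : noetherian R).
Implicit Types (I J P Q X Y : set R).
Local Notation mul := (fun a x : R => a * x).

Lemma frob_act0 : frob_act p 0 = mul :> (R -> R -> R).
Proof. by apply/funext => a; apply/funext => x; rewrite /frob_act expn0 expr1. Qed.

Lemma frob_actM n (a b x : R) : frob_act p n a (b * x) = b * frob_act p n a x.
Proof. by rewrite /frob_act mulrCA. Qed.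

(** By dévissage only primes T strictly above P matter: if T lies in Q it equals Q and contributes
    one step at most, otherwise R/T vanishes at Q. *)
Lemma lenle_adjacent P Q : primei P -> primei Q ->
  (forall T, primei T -> P `<=` T -> T `<=` Q -> T `<=` P \/ Q `<=` T) ->
  forall I, ideal I -> P `<=` I -> ~ (I `<=` P) ->
  exists l, lenle mul (~` Q) I [set: R] l.
Proof.
move=> Pp Qp adj; have WP := mulclosed_primei Qp; have [Q1 _] := WP.
apply: (devissage Rnoeth) => [I Iid I1 _ _|T Tp _ PT nTP|I a Iid H1 H2 PI nIP].
- by exists 0%N; apply: lenle0 => // [x|x _]; [rewrite mul1r|exact: ideal1].
- have [Tid _ _] := Tp; have [TQ|nTQ] := pselect (T `<=` Q).
    have [/nTP//|QT] := adj T Tp PT TQ; exists 1%N.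
    by apply: lenle_le (lenle_primei Qp).
  have [s [Ts Qs]] : exists s, T s /\ ~ Q s.
    apply: contrapT => nex; apply: nTQ => s Ts; apply: contrapT => Qs.
    by apply: nex; exists s.
  exists 0%N => -[//|k] [N1 [x [_ _ _ Tx _]]].
  by case: (Tx s Qs); rewrite mulrC; exact: (submZ Tid).
- have [||l1 Hl1] := H1.
  + by apply: subset_trans PI _; exact: sub_adjoin.
  + by move=> aP; apply: nIP => x Ix; apply: aP; exact: sub_adjoin.
  have [||l2 Hl2] := H2.
  + by apply: subset_trans PI _; exact: sub_colon.
  + by move=> aP; apply: nIP => x Ix; apply: aP; exact: sub_colon.
  exists (l2 + l1)%N; apply: (lenle_adjoin (mul_action R) _ WP Iid Hl2 Hl1).
  by move=> *; rewrite mulrCA.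
Qed.

(* Both sides count the length at Q of F_*(R/P) modulo x^N: it is
   [k(Q) : k(Q)^p] times the length of R/(P + x^(pN)), and up to a constant
   [k(P) : k(P)^p] times the length of R/(P + x^N). *)
Lemma frank_adjacent P Q r r' k (e : 'I_k -> R) : primei P -> primei Q -> P `<=` Q ->
  ~ (Q `<=` P) ->
  (forall T, primei T -> P `<=` T -> T `<=` Q -> T `<=` P \/ Q `<=` T) ->
  fgens p 1 e -> frank p P r -> frank p Q r' -> (p * r' <= r)%N.
Proof.
move=> Pp Qp PQ nQP adj eP [[u uP] umax] fQ.
have [x [Qx Px]] : exists x, Q x /\ ~ P x.
  apply: contrapT => nex; apply: nQP => s Qs; apply: contrapT => Ps.
  by apply: nex; exists s.
have [Pid P1 PM] := Pp; have [Qid nQ1 QM] := Qp.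
have WP := mulclosed_primei Qp; have [Q1 _] := WP.
have actP n := frob_act_action charRp n.
have mulM : forall a b y : R, a * (b * y) = b * (a * y) by move=> *; rewrite mulrCA.
have finl y : ~ P y -> exists l, lenle mul (~` Q) (adjoin P y) [set: R] l.
  move=> Py; apply: (lenle_adjacent Pp Qp adj); [exact: adjoin_ideal|exact: sub_adjoin|].
  by move=> /(_ _ (adjoin_elt y Pid)).
have [l0 Hl0] := finl x Px.
have [L Lch HL] := lenle_exact (@subsetT _ _) Hl0.
have L0 : (0 < L)%N.
  apply: HL; exists [set: R], 1; split=> // s Qs; rewrite mulr1 => As.
  by apply: Qs; exact: (adjoin_le Qid PQ Qx).
have [s [Ps sP]] := frank_span charRp Pp eP uP umax.
have [C HC] := finl s Ps.
pose A i := adjoin P (x ^+ i).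
have Aid i : ideal (A i) by exact: adjoin_ideal.
(* Since [x] is a nonzerodivisor modulo P, the j quotients of the filtration by powers of [x] are
   copies of R/(P + (x)), so the length is at least j L. *)
have chA j : chain mul (~` Q) (j * L) (A j) [set: R].
  elim: j => [//|j IH]; rewrite mulSn; apply: chain_cat IH.
  apply: (chain_inj (mul_act_linear mulM (x ^+ j)) (mul_action R) _ _ _ _ _ _ Lch).
  - exact: adjoin_ideal.
  - exact: Aid.
  - exact: Aid.
  - by move=> _ [y [b [Py ->]]]; exists y, (b * x); rewrite exprS mulrA.
  - by move=> y _; exists 0, y; rewrite add0r mulrC; split=> //; exact: subm0 Pid.
  - move=> y _ [z [b [Pz e1]]]; exists (y - b * x), b; rewrite subrK; split=> //.
    have : P (x ^+ j * (y - b * x)).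
      by rewrite mulrBr e1 exprSr mulrCA addrK.
    by case/PM => // /(primeiX Pp).
have bound N : (p * N * L * r' <= r * (N * L) + k * C)%N.
  have c1 : chain (frob_act p 1) (~` Q) (p * N * L * r') (A (p * N)%N) [set: R].
    have c0 := chA (p * N)%N; rewrite -frob_act0 in c0.
    exact: (chain_frank charRp Qp fQ (frob_act_ideal p 0 (Aid (p * N)%N)) c0).
  suff : lenle (frob_act p 1) (~` Q) (A (p * N)%N) [set: R] (r * (N * L) + k * C) by apply.
  have As := frob_act_ideal p 1 (Aid (p * N)%N).
  (* [U] is the image of R^r in F_*(R). Modulo x^(pN) it is covered by r copies of R/(P + (x^N)),
     while the rest is killed by [s] modulo [U] and P and costs at most k C, whatever N is. *)
  pose U := [set z | exists c, z = lincomb (frob_act p 1) u c].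
  have Us : subm (frob_act p 1) U.
    split=> [|_ _ [c ->] [c' ->]|a _ [c ->]].
    - by exists (fun=> 0); rewrite lincomb0.
    - by exists (fun i => c i - c' i); rewrite lincombB.
    - by exists (fun i => a * c i); rewrite lincombZ.
  have mids := addm_subm (actP 1) As Us.
  have Amid y : A (p * N)%N y -> addm (A (p * N)%N) U y.
    by move=> Ay; exists y, 0; rewrite addr0; split=> //; exact: subm0 Us.
  apply: (lenle_cat (actP 1) WP As mids) => //.
  - apply: (lenle_gens (act1 := mul) (f := fun i a => frob_act p 1 a (u i)) (N1 := A N)
      (N1' := [set: R]) (actP 1) WP) => //.
    + move=> i; have [_ aBl aA _] := actP 1%N.
      by split=> [a b|a b]; rewrite ?aBl ?aA.
    + move=> i _ [y [b [Py ->]]]; rewrite /frob_act exprpD //.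
      exists (y ^+ (p ^ 1) * u i), (b ^+ (p ^ 1) * u i); split.
        exact: ideal_exprp.
      by rewrite mulrDl exprMn -exprM expn1 mulnC; ring.
    + by move=> _ [y [_ [Ay [c ->] ->]]]; exists y, c.
    + exact: (lenle_powers (mul_action R) mulM WP Pid HL).
  - apply: (lenle_span (J := adjoin P s) (e := e) (actP 1) WP mids) => //.
    + exact: adjoin_ideal.
    + move=> _ i [y [b [Py ->]]]; rewrite /frob_act exprpD // mulrDl; apply: (submD mids).
        by apply: Amid; apply: sub_adjoin; exact: ideal_exprp.
      have [c Pc] := sP (e i); rewrite exprMn -mulrA.
      apply: (submZ mids b); rewrite -[X in addm _ _ X](subrK (lincomb (frob_act p 1) u c)).
      exists (frob_act p 1 s (e i) - lincomb (frob_act p 1) u c), (lincomb (frob_act p 1) u c).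
      by split=> //; [exact: sub_adjoin|exists c].
    + move=> y; have [c ->] := eP y; exists 0, c; rewrite add0r; split=> //.
      exact: subm0 mids.
(* If r < p r', the main terms differ by at least N L, which exceeds the fixed error k C once N > k
   C. *)
rewrite leqNgt; apply/negP => rp.
set N := (k * C).+1; have := bound N.
have -> : (p * N * L * r' = p * r' * (N * L))%N by lia.
have : (r.+1 * (N * L) <= p * r' * (N * L))%N by rewrite leq_mul2r rp orbT.
have : (N <= N * L)%N by rewrite leq_pmulr.
rewrite /N; lia.
Qed.

End Kunz.

Section PrimeChains.
Context (R : comNzRingType).
Implicit Types (I J P Q : set R).

Fixpoint primes_above k P : Prop :=
  primei P /\
  match k with
  | 0 => True
  | k.+1 => exists P', [/\ P `<=` P', ~ (P' `<=` P) & primes_above k P']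
  end.

Lemma primes_above_primei k P : primes_above k P -> primei P.
Proof. by case: k => [|k] []. Qed.

Lemma primes_above_seq k (Q : nat -> set R) : (forall i, primei (Q i)) ->
  (forall i, (i < k)%N -> Q i `<=` Q i.+1 /\ ~ (Q i.+1 `<=` Q i)) ->
  primes_above k (Q 0%N).
Proof.
elim: k Q => [|k IH] Q Qp QS /=; split=> //.
have [le nle] := QS 0%N isT; exists (Q 1%N); split=> //.
by apply: (IH (fun i => Q i.+1)) => // i ik; exact: (QS i.+1).
Qed.

Lemma primes_above_prime_chain k P : primes_above k P -> prime_chain R k.
Proof.
move=> ch; suff [Q [_ Qp QS]] : exists Q : nat -> set R, [/\ Q 0%N = P, forall i, primei (Q i) &
    forall i, (i < k)%N -> Q i `<=` Q i.+1 /\ ~ (Q i.+1 `<=` Q i)].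
  have [T TP] := choice (fun i => primei_prime_idealr (Qp i)).
  exists T => i ik; have [le nle] := QS i ik.
  by split=> [x /TP /le /TP //|nTT]; apply: nle => x /TP /nTT /TP.
elim: k P ch => [|k IH] P [Pp]; first by exists (fun=> P).
move=> [P' [le nle /IH[Q [Q0 Qp QS]]]].
exists (fun i => if i is j.+1 then Q j else P); split=> // [[|i]|[_|i ik]] //.
  by rewrite Q0.
exact: QS.
Qed.

End PrimeChains.

Section LocalRing.
Context (R : comNzRingType) (m : idealr R) (p : nat) (charRp : p \in [pchar R]).
Context (Rnoeth : noetherian R) (Rlocal : local_ring m).
Context (k : nat) (e : 'I_k -> R) (eP : fgens p 1 e).
Implicit Types (I J P Q : set R).
Local Notation mul := (fun a x : R => a * x).
Local Notation M := [set x | x \in m].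

Let Mid : ideal M. Proof. exact: idealr_ideal. Qed.

Lemma frank_primes_above l P r a : primes_above l P ->
  (forall l', primes_above l' P -> (l' <= l)%N) ->
  frank p P r -> frank p M a -> (p ^ l * a <= r)%N.
Proof.
elim: l P r => [|l IH] P r ch lmax fP fM; have Pp := primes_above_primei ch.
  have PM : P `<=` M by case: Pp => Pid P1 _; exact: (local_max Rnoeth Rlocal).
  have MP : M `<=` P.
    move=> x Mx; apply: contrapT => Px; suff /lmax : primes_above 1 P by [].
    split=> //; exists M; split=> //; first by move=> /(_ x Mx).
    by split=> //; exact: (local_primei Rnoeth Rlocal).
  have PE : P = M by apply/seteqP.
  by rewrite PE in fP; rewrite (frank_unique fM fP) mul1n.
case: ch => _ [P' [PP' nP'P ch']]; have P'p := primes_above_primei ch'.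
have [r' fP'] := frank_exists charRp P'p eP.
have l'max l' : primes_above l' P' -> (l' <= l)%N.
  by move=> c; rewrite -ltnS; apply: lmax; split=> //; exists P'.
apply: (@leq_trans (p * r')).
  by rewrite expnS -mulnA leq_mul2l (IH P' r') ?orbT.
apply: (frank_adjacent charRp Rnoeth Pp P'p PP' nP'P _ eP fP fP') => T Tp PT TP'.
apply: contrapT => /not_orP[nTP nP'T].
suff /lmax : primes_above l.+2 P by rewrite ltnn.
by split=> //; exists T; split=> //; split=> //; exists P'.
Qed.

(** F^(n+1)_*(K) is covered by [a] copies of F^n_*(K), through the maps sending x to x^p u_i. *)
Lemma lenle_residue a : frank p M a ->
  forall n, lenle (frob_act p n) [set 1] M [set: R] (a ^ n).
Proof.
move=> [[u uP] umax]; have Mp := local_primei Rnoeth Rlocal.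
elim=> [|n IH].
  rewrite frob_act0 expn0 => -[|[|j]] // [N1 [x [N1s MN1 N1x Mx [N2 [y [_ _ _ Ny _]]]]]].
  case: (Ny 1 erefl).
  have [z zx] : exists z, z * x = 1.
    by apply: (local_unit Rnoeth Rlocal); apply/negP => xm; apply: (Mx 1 erefl); rewrite /= mul1r.
  by rewrite mul1r -[y]mulr1 -zx mulrA; exact: (submZ N1s).
have actP := frob_act_action charRp n.+1.
rewrite expnS; apply: (lenle_gens (act1 := frob_act p n) (f := fun i x => x ^+ (p ^ 1) * u i)
  (N1 := M) (N1' := [set: R]) actP (mulclosed1 R)) => //.
- move=> i; split=> [x y|b x]; first by rewrite exprpB // mulrBl.
  by rewrite /frob_act exprMn -exprM -expnD addn1 mulrA.
- by move=> i x; exact: ideal_exprp.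
- exact: frob_act_ideal.
- move=> z _; have [s [Ms sP]] := frank_span charRp Mp eP uP umax.
  have [t ts] := local_unit Rnoeth Rlocal (introN idP Ms).
  have [c Mc] := sP z.
  exists (frob_act p 1 t (frob_act p 1 s z - lincomb (frob_act p 1) u c)), (fun i => t * c i).
  split=> //; first exact: (submZ (frob_act_ideal p 1 Mid)).
  have [aB _ aA a1] := frob_act_action charRp 1.
  rewrite aB aA ts a1 (lincombZ (frob_act_action charRp 1)).
  exact: esym (subrK (lincomb (frob_act p 1) u (fun i => t * c i)) z).
Qed.

(* The Frobenius power m^[p^n]. *)
Definition max_power n : set R := geni [set x | exists2 y, M y & x = y ^+ (p ^ n)].

Lemma max_power_ideal n : ideal (max_power n). Proof. exact: geni_ideal. Qed.

(** An upper bound of Hilbert-Kunz type, with [d] strictly above the dimension of R/I so that no d -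
    1 occurs. For I = P prime and x in m but not in P, x^(p^n) lies in m^[p^n]; filtering by powers
    of x therefore costs a factor p^n and lowers the dimension by one. *)
Lemma length_growth a : frank p M a -> forall I, ideal I -> forall d,
  (forall P l, I `<=` P -> primes_above l P -> (l < d)%N) ->
  exists C, forall n, exists2 l,
    lenle (frob_act p n) [set 1] (addi I (max_power n)) [set: R] l &
    (l * p ^ n <= C * a ^ n * p ^ (n * d))%N.
Proof.
move=> fM; have W := mulclosed1 R; have actP n := frob_act_action charRp n.
have actM n : forall b c x : R, frob_act p n b (c * x) = c * frob_act p n b x.
  exact: frob_actM.
have mid := max_power_ideal.
apply: (devissage Rnoeth) => [I Iid I1 d _|P Pp IH d Pd|I b Iid H1 H2 d Id].
- exists 0%N => n; exists 0%N => //; have [_ _ _ a1] := actP n.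
  by apply: lenle0 => // x _; apply: sub_addil => //; exact: ideal1.
- have [Pid P1 _] := Pp; have d0 : (0 < d)%N by apply: (Pd P).
  have [[x Mx Px]|nex] := pselect (exists2 x, M x & ~ P x); last first.
    have MP : M `<=` P.
      by move=> x Mx; apply: contrapT => Px; apply: nex; exists x.
    exists 1%N => n; exists (a ^ n)%N.
      apply: (lenle_le _ _ (lenle_residue fM (n := n))) => //.
      by apply: subset_trans MP _; exact: sub_addil.
    by rewrite mul1n leq_mul2l leq_pexp2l ?orbT ?prime_gt0 ?(pprime charRp) // leq_pmulr.
  have xid := adjoin_ideal x Pid.
  have [||T l xT ch|C HC] := IH _ xid _ _ d.-1.
  + exact: sub_adjoin.
  + by move=> /(_ _ (adjoin_elt x Pid)).
  + rewrite -ltnS prednK //; apply: (Pd P) => //; split=> //; exists T; split=> //.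
      by apply: subset_trans xT; exact: sub_adjoin.
    by move=> TP; apply: Px; apply: TP; apply: xT; exact: adjoin_elt.
  exists C => n; have [l Hl lC] := HC n; exists (p ^ n * l)%N.
    pose K := addi P (max_power n).
    have Kid : ideal K by exact: addi_ideal.
    have H : lenle (frob_act p n) [set 1] (adjoin K x) [set: R] l.
      apply: lenle_le Hl => // _ [_ [z [[y [r [Py ->]]] mz ->]]].
      by exists (y + z), r; split; [exists y, z|rewrite addrAC].
    apply: lenle_le (lenle_powers (actP n) (@actM n) W (j := p ^ n) Kid H) => //.
    apply: adjoin_le => //; apply: sub_addir => //; apply: sub_geni; by exists x.
  have -> : (p ^ (n * d) = p ^ n * p ^ (n * d.-1))%N by rewrite -expnD -mulnS prednK.
  by rewrite -mulnA (mulnCA _ (p ^ n)%N) leq_mul2l lC orbT.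
- have aid := adjoin_ideal b Iid; have cid := colon_ideal b Iid.
  have [T l bT|C1 HC1] := H1 d.
    by apply: Id; apply: subset_trans bT; exact: sub_adjoin.
  have [T l bT|C2 HC2] := H2 d.
    by apply: Id; apply: subset_trans bT; exact: sub_colon.
  exists (C1 + C2)%N => n; have [l1 Hl1 lC1] := HC1 n; have [l2 Hl2 lC2] := HC2 n.
  exists (l2 + l1)%N; last by rewrite !mulnDl addnC leq_add.
  have Jid := addi_ideal Iid (mid n).
  apply: (lenle_adjoin (a := b) (actP n) (@actM n) W Jid).
    apply: lenle_le Hl2 => // _ [y [z [Iy mz ->]]].
    by exists (b * y), (b * z); rewrite mulrDr; split=> //; exact: (submZ (mid n)).
  apply: lenle_le Hl1 => // _ [_ [z [[y [r [Iy ->]]] mz ->]]].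
  by exists (y + z), r; split; [exists y, z|rewrite addrAC].
Qed.

Lemma fgens_iter n : exists j (f : 'I_j -> R), fgens p n f.
Proof.
suff [T [f fP]] : exists (T : finType) (f : T -> R), forall x, exists c : T -> R,
    x = \sum_t c t ^+ (p ^ n) * f t.
  exists #|T|, (fun i => f (enum_val i)) => x; have [c ->] := fP x.
  exists (fun i => c (enum_val i)); rewrite [LHS](reindex (@enum_val T predT)) //.
  by apply: onW_bij; exact: enum_val_bij.
elim: n => [|n [T [f fP]]].
  by exists unit, (fun=> 1) => x; exists (fun=> x); rewrite (big_pred1 tt) ?mulr1 // => -[].
exists (T * 'I_k)%type, (fun ti => f ti.1 * e ti.2 ^+ (p ^ n)) => x.
have [c cE] := fP x; have [b bE] := choice (fun t => eP (c t)).
exists (fun ti => b ti.1 ti.2).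
rewrite -(pair_bigA _ (fun t i => b t i ^+ (p ^ n.+1) * (f t * e i ^+ (p ^ n)))) /= cE.
apply: eq_bigr => t _; rewrite [in LHS]bE exprp_sum // mulr_suml; apply: eq_bigr => i _.
by rewrite /frob_act exprMn -(exprM _ (p ^ 1)) -expnD add1n; ring.
Qed.

End LocalRing.

(** Elimination: in its own relation the last generator has coefficient 1 - c with c in m, a unit,
    so it can be substituted into the other relations. *)
Lemma nakayama (R : comNzRingType) (m : idealr R) (M : zmodType) (act : R -> M -> M)
    (N : set M) k (e : 'I_k -> M) :
  noetherian R -> local_ring m -> is_action act -> subm act N ->
  (forall j, exists n c, [/\ N n, forall i, c i \in m & e j = n + lincomb act e c]) ->
  forall j, N (e j).
Proof.
move=> Rnoeth Rlocal actP Ns; have [aB aBl aA a1] := actP.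
have Mid := idealr_ideal m.
elim: k e => [|k IH] e eP; first by case.
pose e' i := e (lift ord_max i).
have lcE c : lincomb act e c =
    lincomb act e' (fun i => c (lift ord_max i)) + act (c ord_max) (e ord_max).
  rewrite /lincomb big_ord_recr /=; congr (_ + _); apply: eq_bigr => i _.
  by rewrite widen_ordS.
have [n [c [Nn cm en]]] := eP ord_max.
have [t tP] : exists t, t * (1 - c ord_max) = 1.
  apply: (local_unit Rnoeth Rlocal); apply/negP => c1.
  have : 1 \in m by rewrite -(subrK (c ord_max) 1); exact: (submD Mid c1 (cm ord_max)).
  by rewrite idealr1.
have {}en : e ord_max = act t n + lincomb act e' (fun i => t * c (lift ord_max i)).
  rewrite -lincombZ // -act_actD //; rewrite -[LHS]a1 -tP -aA aBl a1; congr (act t _).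
  by rewrite {1}en lcE addrA addrK.
have Ne' : forall j, N (e' j).
  apply: IH => j; have [n' [c' [Nn' cm' en']]] := eP (lift ord_max j).
  exists (n' + act (c' ord_max) (act t n)),
    (fun i => c' (lift ord_max i) - (0 - c' ord_max * (t * c (lift ord_max i)))).
  split.
  - by apply: (submD Ns Nn'); apply: (submZ Ns); exact: (submZ Ns).
  - move=> i; rewrite sub0r opprK; apply: (submD Mid); first exact: cm'.
    by rewrite mulrA; apply: (submZ Mid); exact: cm.
  - rewrite /e' en' lcE en act_actD // lincombZ //.
    rewrite lincombB // lincombB // lincomb0 // sub0r opprK.
    by rewrite -addrA; congr (_ + _); rewrite addrCA.
move=> j; have [i ->|->] := unliftP ord_max j; first exact: Ne'.
by rewrite en; apply: (submD Ns); [exact: (submZ Ns)|exact: lincomb_subm].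
Qed.

Lemma chain_weaken (R : comNzRingType) (M : zmodType) (act : R -> M -> M) (W W' : set R)
    k N N' : W `<=` W' -> chain act W' k N N' -> chain act W k N N'.
Proof. by move=> WW'; apply: chain_act => // s /WW' Ws; exists s. Qed.

Lemma leq_of_exp_leq (x y C : nat) : (forall n, x ^ n <= C * y ^ n)%N -> (0 < y)%N ->
  (x <= y)%N.
Proof.
move=> H y0; rewrite leqNgt; apply/negP => yx.
(* Bernoulli's inequality 1 + n/y <= (1 + 1/y)^n with denominators cleared. *)
have bern n : ((n + y) * y ^ n <= y * y.+1 ^ n)%N.
  elim: n => [|n IH]; first by rewrite !expn0 add0n.
  rewrite !expnS; have := leq_mul (leqnn y.+1) IH.
  set A := (y ^ n)%N; set B := (y.+1 ^ n)%N; nia.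
pose n := (C * y).+1.
have h1 : (y * y.+1 ^ n <= y * x ^ n)%N by rewrite leq_mul2l leq_exp2r ?yx ?orbT.
have h2 : (y * x ^ n <= y * (C * y ^ n))%N by rewrite leq_mul2l H orbT.
have := leq_trans (bern n) (leq_trans h1 h2); have yn : (0 < y ^ n)%N by rewrite expn_gt0 y0.
by rewrite mulnA leq_pmul2r // mulnC /n addSn ltnNge leq_addr.
Qed.

(** * The number of generators of F^n_*(R) *)

Section MinimalGenerators.
Context (R : comNzRingType) (m : idealr R) (p : nat) (charRp : p \in [pchar R]).
Context (Rnoeth : noetherian R) (Rlocal : local_ring m).
Context (k : nat) (e : 'I_k -> R) (eP : fgens p 1 e).
Implicit Types (I J P Q : set R).
Local Notation mul := (fun a x : R => a * x).
Local Notation M := [set x | x \in m].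
Local Notation max_power := (max_power m p).

Lemma max_power_pexp n y x : y \in m -> max_power n (y ^+ (p ^ n) * x).
Proof.
move=> my; rewrite mulrC; apply: (submZ (max_power_ideal m p n)); apply: sub_geni.
by exists y.
Qed.

(** Inside F^n_*(R) the ideal m^[p^n] is the submodule m F^n_*(R), so K (x) F^n_*(R) is
    R/m^[p^n]. *)
Lemma max_power_lincomb n j (f : 'I_j -> R) : fgens p n f ->
  max_power n `<=` [set x | exists2 c, forall i, c i \in m & x = lincomb (frob_act p n) f c].
Proof.
move=> fP; have actP := frob_act_action charRp n; have [_ _ aA _] := actP.
have Mid := idealr_ideal m.
apply: geni_le => [|_ [y my ->]] /=.
  split=> [|_ _ [c cm ->] [c' cm' ->]|b _ [c cm ->]].
  - by exists (fun=> 0); [move=> i; exact: subm0 Mid|rewrite lincomb0].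
  - exists (fun i => c i - c' i); last by rewrite lincombB.
    by move=> i; exact: (submB Mid (cm i) (cm' i)).
  - have [B BP] := choice (fun i => fP (b * f i)).
    exists (fun i' => \sum_i c i * B i i').
      by move=> i'; apply: (subm_sum Mid) => i; rewrite mulrC; exact: (submZ Mid _ (cm i)).
    transitivity (\sum_i frob_act p n (c i) (lincomb (frob_act p n) f (B i))).
      by rewrite mulr_sumr; apply: eq_bigr => i _; rewrite -BP /frob_act mulrCA.
    under eq_bigr do rewrite lincombZ //.
    rewrite exchange_big; apply: eq_bigr => i' _ /=.
    by rewrite /frob_act -mulr_suml exprp_sum.
have [c cE] := fP 1; exists (fun i => y * c i).
  by move=> i; rewrite mulrC; exact: (submZ Mid).
by rewrite -lincombZ // -cE /frob_act mulr1.
Qed.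

(** A maximal family independent modulo m^[p^n] lifts a K-basis of F^n_*(R)/m F^n_*(R) and generates
    by Nakayama. Its size is bounded by [length_growth] for I = 0 and d + 1, with C independent of
    n. *)
Lemma minimal_gens a d : frank p M a -> (forall P l, primes_above l P -> (l <= d)%N) ->
  exists C, forall n, exists j (w : 'I_j -> R),
  [/\ indep (frob_act p n) (max_power n) M w,
      forall x, exists c, max_power n (x - lincomb (frob_act p n) w c),
      fgens p n w & (j <= C * (a * p ^ d) ^ n)%N].
Proof.
move=> fM dmax; have Mp := local_primei Rnoeth Rlocal; have Mid := idealr_ideal m.
have [P l _ /dmax //|C HC] := length_growth charRp Rnoeth Rlocal eP fM (ideal0 R) (d := d.+1).
exists C => n; have [l Hl lC] := HC n.
have mid := max_power_ideal m p n; have actP := frob_act_action charRp n.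
have ms := frob_act_ideal p n mid.
have lC' : (l <= C * (a * p ^ d) ^ n)%N.
  have q0 := pexp_gt0 charRp n.
  rewrite -(leq_pmul2r q0); apply: leq_trans lC _.
  rewrite expnMn -expnM (mulnC d) mulnS expnD; lia.
have bnd j (w : 'I_j -> R) : indep (frob_act p n) (max_power n) M w -> (j <= l)%N.
  move=> wP; apply: Hl.
  have := indep_chain actP ms (frob_act_ideal p n (idealT R)) (@subsetT _ _) (fun _ => I) wP.
  move/(chain_weaken (W := [set 1]) _) => H; apply: chain_le (H _) => //.
    by move=> _ [_ [z [-> mz ->]]]; rewrite add0r.
  by move=> _ ->; case: Mp.
have [j [[w wP] wmax]] := indep_max bnd.
have spanw x : exists c, max_power n (x - lincomb (frob_act p n) w c).
  have [|u' /wmax|s Ms [c Ic]] := indep_span actP ms _ wP _ x.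
  - by move=> b y Mb; exact: max_power_pexp.
  - by rewrite ltnn.
  have [t ts] := local_unit Rnoeth Rlocal (introN idP Ms).
  exists (fun i => t * c i); rewrite -lincombZ //; have [aB _ aA a1] := actP.
  by rewrite -[x]a1 -ts -aA -aB; exact: (submZ ms).
exists j, w; split=> //; last by apply: leq_trans (bnd _ _ wP) lC'.
have [j' [f fP]] := fgens_iter charRp eP n.
pose N := [set x | exists c, x = lincomb (frob_act p n) w c].
have Ns : subm (frob_act p n) N.
  split=> [|_ _ [c ->] [c' ->]|b _ [c ->]].
  - by exists (fun=> 0); rewrite lincomb0.
  - by exists (fun i => c i - c' i); rewrite lincombB.
  - by exists (fun i => b * c i); rewrite lincombZ.
have Nf : forall i, N (f i).
  apply: (nakayama Rnoeth Rlocal actP Ns) => i.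
  have [c /(max_power_lincomb fP)[c' cm' fE]] := spanw (f i).
  exists (lincomb (frob_act p n) w c), c'; split=> //; first by exists c.
  by rewrite -fE addrC subrK.
by move=> x; have [c ->] := fP x; exact: (lincomb_subm _ Ns Nf).
Qed.

(** At P, F^n_*(R/P) has a chain of r^n steps, and each generator accounts for at most one of
    them. *)
Lemma frank_exp_le P r n j (w : 'I_j -> R) : primei P -> frank p P r -> fgens p n w ->
  (r ^ n <= j)%N.
Proof.
move=> Pp fP wP; have [Pid P1 _] := Pp.
have ch i : chain (frob_act p i) (~` P) (r ^ i) P [set: R].
  elim: i => [|i IH].
    by exists [set: R], 1; split=> // s Ps; rewrite frob_act0 mulr1.
  rewrite expnSr; apply: (chain_frank charRp Pp fP _ IH).
    exact: frob_act_ideal.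
  exact: frob_act_ideal.
rewrite -[j]muln1; apply: (lenle_span (e := w) _ _ _ Pid _ _ (lenle_primei Pp)) (ch n).
- exact: frob_act_action.
- exact: mulclosed_primei.
- exact: frob_act_ideal.
- by move=> a i; exact: ideal_exprp.
- by move=> x; have [c ->] := wP x; exists 0, c; rewrite add0r; split=> //; exact: subm0 Pid.
Qed.

Lemma frank_eq P r a d : frank p M a -> (forall P l, primes_above l P -> (l <= d)%N) ->
  primes_above d P -> frank p P r -> r = (a * p ^ d)%N.
Proof.
move=> fM dmax Pd fP; have Pp := primes_above_primei Pd.
have [C HC] := minimal_gens fM dmax.
apply/eqP; rewrite eqn_leq [X in _ && (X <= _)%N]mulnC.
rewrite (frank_primes_above charRp Rnoeth Rlocal eP Pd _ fP fM) ?andbT; last by move=> l /dmax.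
apply: (@leq_of_exp_leq _ _ C) => [n|].
  have [j [w [_ _ wP jC]]] := HC n.
  exact: leq_trans (frank_exp_le Pp fP wP) jC.
by rewrite muln_gt0 expn_gt0 (prime_gt0 (pprime charRp)) (frank_gt0 _ fM) //;
  exact: local_primei Rnoeth Rlocal.
Qed.

End MinimalGenerators.

(** * nu and rank of the Frobenius pushforwards *)

Lemma chain_strengthen (R : comNzRingType) (M : zmodType) (act : R -> M -> M) (W W' : set R)
    k N N' : is_action act -> (forall s, W' s -> exists t, W (t * s)) -> subm act N ->
  chain act W k N N' -> chain act W' k N N'.
Proof.
move=> [_ _ aA _] WW'; elim: k N => [//|k IH] N Ns [N1 [x [N1s NN1 N1x Nx ch]]].
exists N1, x; split=> //; last exact: IH.
by move=> s /WW'[t Wts] Nsx; apply: (Nx _ Wts); rewrite -aA; exact: (submZ Ns).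
Qed.

Section TensorLift.
Context (R S : comNzRingType) (f : {rmorphism R -> S}).
Context (P : lmodType S) (N : lmodType R).

Lemma tensor_lift (T : lmodType S) (psi : P -> N -> T) :
  (forall s x x' y, psi (s *: x + x') y = s *: psi x y + psi x' y) ->
  (forall x y y', psi x (y + y') = psi x y + psi x y') ->
  (forall r x y, psi x (r *: y) = psi (f r *: x) y) ->
  exists phi : {linear tensor f P N -> T}, forall x y, phi (tens f x y) = psi x y.
Proof.
move=> psil psir psib.
pose g : {linear {freeg (P * N)%type / S} -> T} := free_lift (fun u => psi u.1 u.2).
have gU (x : P) (y : N) : g (fgen x y) = psi x y by exact: free_liftU.
have psi0 y : psi 0 y = 0.
  by apply: (addrI (psi 0 y)); rewrite addr0 -[X in X + _]scale1r -psil scale1r addr0.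
have g0 z : z \in Defs.span (@tensor_rel R S f P N) -> g z = 0.
  suff H : @tensor_rel R S f P N `<=` [set` kernel_mod g] by move=> /(span_le H) /eqP.
  move=> {}z; rewrite /= inE => zrel; apply/eqP; move: zrel.
  case=> [[x [x' [y ->]]]|[x [y [y' ->]]]|[s [x [y ->]]]|[r [x [y ->]]]].
  - rewrite 2!linearB /= !gU -[x in psi (x + _)]scale1r psil scale1r.
    by rewrite addrAC addrK subrr.
  - by rewrite 2!linearB /= !gU psir addrAC addrK subrr.
  - by rewrite linearB linearZ /= !gU -[s *: x]addr0 psil psi0 addr0 subrr.
  - by rewrite linearB /= !gU psib subrr.
pose h : tensor f P N -> T := fun z => g (repr z).
have hlin : linear h by exact: (quo_repr_linear g0).
pose phi : {linear tensor f P N -> T} :=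
  HB.pack h (GRing.isLinear.Build S (tensor f P N) T *:%R h hlin).
exists phi => x y; rewrite -gU; exact: (quo_repr_val g0).
Qed.

Lemma tens_ind (T : set (tensor f P N)) : subm (fun (a : S) x => a *: x) T ->
  (forall x y, T (tens f x y)) -> forall z, T z.
Proof.
move=> Ts Tt z; have [w ->] := quo_surj z.
rewrite -[w]freeg_sumE linear_sum; apply: (subm_sum Ts) => -[x y].
have -> : << coeff (x, y) w *g (x, y) >> = coeff (x, y) w *: fgen x y.
  have -> : coeff (x, y) w *: fgen x y = \sum_(v <- dom (fgen x y))
    << coeff (x, y) w * coeff v (fgen x y) *g v >> by [].
  by rewrite domU1 big_seq1 coeffU eqxx !mulr1.
by rewrite linearZ; apply: (submZ Ts); exact: Tt.
Qed.

Lemma tens0 (y : N) : tens f (0 : P) y = 0.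
Proof. by have := tensZl f 0 (0 : P) y; rewrite !scale0r. Qed.

Lemma tensr0 (x : P) : tens f x (0 : N) = 0.
Proof. by have := tensZr f 0 x (0 : N); rewrite scale0r rmorph0 scale0r. Qed.

Lemma tensBr (x : P) (y y' : N) : tens f x (y - y') = tens f x y - tens f x y'.
Proof. by rewrite tensDr -[- y']scaleN1r tensZr rmorphN1 scaleN1r. Qed.

Lemma tens_sum (x : P) k (c : 'I_k -> R) (y : 'I_k -> N) :
  tens f x (\sum_i c i *: y i) = \sum_i f (c i) *: tens f x (y i).
Proof.
rewrite (big_morph (tens f x) (tensDr f x) (tensr0 x)).
by apply: eq_bigr => i _; rewrite tensZr.
Qed.

End TensorLift.

Lemma form_lift (R S : comNzRingType) (f : {rmorphism R -> S}) (N : lmodType R) (chi : N -> S) :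
  (forall x y, chi (x + y) = chi x + chi y) -> (forall r x, chi (r *: x) = f r * chi x) ->
  exists phi : {linear tensor f S^o N -> S^o}, forall s y, phi (tens f s y) = s * chi y.
Proof.
move=> chiD chiZ; apply: (@tensor_lift _ _ f S^o N S^o (fun s y => s * chi y)).
- by move=> s x x' y; rewrite mulrDl -mulrA.
- by move=> x y y'; rewrite chiD mulrDr.
- by move=> r x y; rewrite chiZ mulrCA mulrA.
Qed.

(** A property instead of a field structure, because it is applied to R/m and to localizations at
    minimal primes, which are given only as commutative rings. *)
Definition field_like (S : comNzRingType) : Prop := forall x : S, x != 0 -> exists y, y * x = 1.

Section VectorSpaces.
Context (S : comNzRingType) (Sfield : field_like S) (V : lmodType S).
Local Notation act := (fun (a : S) (x : V) => a *: x).

Lemma dual_basis k (v : 'I_k -> V) (phi : 'I_k -> {linear V -> S^o}) :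
  (forall i j, phi i (v j) = (i == j)%:R) ->
  (forall x, exists c, x = lincomb act v c) -> has_basis_card V k.
Proof.
move=> dual span; exists v => x.
have [c ->] := span x; exists [ffun i => c i]; split.
  by apply: eq_bigr => i _; rewrite ffunE.
have phiE i (b : 'I_k -> S) : phi i (\sum_j b j *: v j) = b i.
  rewrite linear_sum (bigD1 i) //= linearZ /= dual eqxx big1 ?addr0 => [|j ji].
    exact: mulr1.
  by rewrite linearZ /= dual eq_sym (negPf ji); exact: mulr0.
by move=> c' e; apply/ffunP => i; rewrite ffunE -(phiE i c) [\sum_j _]e phiE.
Qed.

Lemma primei0 : primei [set 0 : S].
Proof.
split; [exact: ideal0|by move=> /eqP; rewrite oner_eq0|] => a b /= ab.
have [->|/Sfield[c ca]] := eqVneq a 0; first by left.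
by right; rewrite -[b]mul1r -ca -mulrA ab mulr0.
Qed.

(** Since lengths are unique, so are sizes of bases, which pins down the value that [nu] selects. *)
Lemma basis_has_length k : has_basis_card V k -> has_length V k.
Proof.
move=> [v vP]; have actP := scale_action V.
have zs := subm_zero actP.
apply: chain_has_length.
  apply: (@chain_weaken _ _ _ _ (~` [set 0 : S])).
    by move=> _ -> /eqP; rewrite oner_eq0.
  apply: (indep_chain (u := v) actP zs) => // c c0 i /=.
  have [b [_ bu]] := vP 0.
  have b0 : b = [ffun => 0] by apply: bu; rewrite big1 // => j _; rewrite ffunE scale0r.
  have : b = [ffun i => c i] by apply: bu; rewrite -[LHS]c0; apply: eq_bigr => j _; rewrite ffunE.
  by rewrite b0 => /ffunP/(_ i); rewrite !ffunE => ->.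
have main : lenle act (~` [set 0 : S]) [set 0] [set: V] (k * 1).
  apply: (lenle_span (e := v) actP (mulclosed_primei primei0) zs (ideal0 S) _ _
    (lenle_primei primei0)).
    by move=> _ i -> /=; rewrite scale0r.
  by move=> x; have [c [cE _]] := vP x; exists 0, c; rewrite add0r.
move=> j ch; rewrite -[k]muln1; apply: main; apply: (chain_strengthen actP _ zs ch) => s s0.
by have [t ts] := Sfield (introN eqP s0); exists t.
Qed.

End VectorSpaces.

Lemma lincomb_tens (R S : comNzRingType) (f : {rmorphism R -> S}) (N : lmodType R)
    k (v : 'I_k -> tensor f S^o N) (g : S) :
  (forall y, exists c, g *: tens f (1 : S^o) y = lincomb (fun (a : S) x => a *: x) v c) ->
  (exists h, h * g = 1) ->
  forall x, exists c, x = lincomb (fun (a : S) x => a *: x) v c.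
Proof.
move=> span [h hg]; have actP := scale_action (tensor f S^o N).
apply: tens_ind => [|s y].
  split=> [|_ _ [c ->] [c' ->]|a _ [c ->]].
  - by exists (fun=> 0); rewrite lincomb0.
  - by exists (fun i => c i - c' i); rewrite lincombB.
  - by exists (fun i => a * c i); rewrite (lincombZ actP).
have [c cE] := span y; exists (fun i => s * h * c i); rewrite -(lincombZ actP) -cE.
by rewrite scalerA -mulrA hg mulr1 -tensZl; congr (tens f _ y); exact: (esym (mulr1 s)).
Qed.

Section FrobeniusPush.
Context (R : comNzRingType) (m : idealr R) (p : nat) (charRp : p \in [pchar R]).
Local Notation M := [set x | x \in m].

Lemma frob_pushE n (a : R) (x : frob_push charRp n) : a *: x = frob_act p n a x.
Proof. by rewrite /frob_act -(frobE charRp). Qed.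

Lemma lincomb_frob_push n j (w : 'I_j -> R) (c : 'I_j -> R) :
  lincomb (frob_act p n) w c = \sum_i c i *: (w i : frob_push charRp n) :> frob_push charRp n.
Proof. by apply: eq_bigr => i _; rewrite frob_pushE. Qed.

(** The coefficients of x in [w] are chosen arbitrarily, but independence makes them unique modulo
    m; their residues are then linear in x and give the forms dual to the images of [w]. *)
Lemma nuE n j (w : 'I_j -> R) : noetherian R -> local_ring m ->
  indep (frob_act p n) (max_power m p n) M w ->
  (forall x, exists c, max_power m p n (x - lincomb (frob_act p n) w c)) ->
  fgens p n w -> nu m (frob_push charRp n) = j.
Proof.
move=> Rnoeth Rlocal wP wspan wgen.
pose K : comNzRingType := {ideal_quot m}.
pose pi : {rmorphism R -> K} := \pi_{ideal_quot m}.
have piP x : pi x = 0 <-> x \in m.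
  have pi0 : pi 0 = 0 by exact: rmorph0.
  have := Quotient.idealrBE m x 0; rewrite subr0 => ->.
  by rewrite -[\pi 0]/(pi 0) pi0; split=> [e|/eqP //]; apply/eqP.
have Kfield : field_like K.
  move=> x; rewrite -[x]reprK => /eqP nx.
  have [y yx] : exists y, y * repr x = 1.
    by apply: (local_unit Rnoeth Rlocal); apply/negP => /piP.
  by exists (pi y); rewrite -[\pi _]/(pi _) -rmorphM yx rmorph1.
suff basis : has_basis_card (residue_mod m (frob_push charRp n)) j.
  rewrite /nu; apply: xget_unique => // i bi.
  exact: (has_length_unique (basis_has_length Kfield bi) (basis_has_length Kfield basis)).
have actP := frob_act_action charRp n.
have mid := max_power_ideal m p n.
have [c cP] := choice wspan.
have cE x b i : max_power m p n (x - lincomb (frob_act p n) w b) -> pi (c x i) = pi (b i).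
  move=> mb; apply/eqP; rewrite -subr_eq0 -rmorphB; apply/eqP/piP.
  apply: (wP (fun i => c x i - b i)); rewrite lincombB //.
  have := submB mid mb (cP x); rewrite subrBACA subrr sub0r opprB.
  by [].
have chiP i : exists phi : {linear tensor pi K^o (frob_push charRp n) -> K^o},
    forall s y, phi (tens pi s y) = s * pi (c y i).
  apply: form_lift => [x y|r x].
    rewrite -rmorphD; apply: (cE _ (fun i => c x i + c y i)).
    by rewrite lincombD // opprD addrACA; exact: (submD mid).
  rewrite -rmorphM frob_pushE; apply: (cE _ (fun i => r * c x i)).
  have [aB _ _ _] := actP.
  by rewrite -lincombZ // -aB; exact: (submZ (frob_act_ideal p n mid)).
have [phi phiE] := choice chiP.
apply: (dual_basis (v := fun i => tens pi (1 : K^o) (w i : frob_push charRp n)) (phi := phi)).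
  move=> i i'; rewrite phiE mul1r (cE _ (fun i => 1 * (i == i')%:R)).
    by rewrite mul1r rmorph_nat.
  have [_ _ _ a1] := actP.
  by rewrite lincomb_delta // a1 subrr; exact: subm0 mid.
apply: (lincomb_tens (g := 1)); last by exists 1; rewrite mulr1.
move=> y; rewrite scale1r; exists (fun i => pi (c y i)).
have z0 (z : frob_push charRp n) : max_power m p n z -> tens pi (1 : K^o) z = 0.
  move=> /(max_power_lincomb charRp wgen)[b bm ->]; rewrite lincomb_frob_push tens_sum.
  by apply: big1 => i _; rewrite (piP (b i)).2 ?scale0r.
have -> : tens pi (1 : K^o) y = tens pi (1 : K^o) (y - lincomb (frob_act p n) w (c y)) +
    tens pi (1 : K^o) (lincomb (frob_act p n) w (c y) : frob_push charRp n).
  by rewrite -tensDr; congr (tens pi _ _); exact: (esym (subrK _ _)).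
by rewrite z0 ?add0r; [rewrite lincomb_frob_push tens_sum|exact: cP].
Qed.

End FrobeniusPush.

Section Rank.
Context (R : comNzRingType) (p : nat) (charRp : p \in [pchar R]).

Lemma loc_field (P : prime_idealr R) (t : R) : t \notin P ->
  (forall x, x \in P -> t * x = 0) -> field_like (loc P).
Proof.
move=> tP tx x; have [a [s ->]] := frac_surj x.
have [aP|aP] := boolP (a \in P).
  have -> : Defs.frac a s = 0.
    by apply/fracP; exists (LocDen tP); rewrite /= mul0r subr0 mulr1 tx.
  by rewrite eqxx.
move=> _; exists (Defs.frac (den_val s) (LocDen aP)).
rewrite -[LHS]/(loc_mul _ _) loc_mulE; apply: frac_eq => /=.
by rewrite mulr1 mul1r mulrC.
Qed.

Lemma loc_map_neq0 (P : prime_idealr R) g : g \notin P -> loc_map P g != 0.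
Proof.
move=> gP; apply/eqP => /fracP[u /=]; rewrite mul0r subr0 mulr1 => ug.
by have := idealr0 P; rewrite -ug prime_idealrM (negPf gP) (negPf (valP u)).
Qed.

Lemma loc_mod_basis n j (u : 'I_j -> R) alpha g (P : prime_idealr R) t :
  quasi_basis p n u alpha g -> g \notin P -> t \notin P ->
  (forall x, x \in P -> t * x = 0) ->
  has_basis_card (loc_mod P (frob_push charRp n)) j.
Proof.
move=> qb gP tP tx; have [aB aZ as_ ad] := qb.
have Lf := loc_field tP tx.
have [h hg] := Lf _ (loc_map_neq0 gP).
have chiP i : exists phi : {linear tensor (loc_map P) (loc P)^o (frob_push charRp n) -> (loc P)^o},
    forall s y, phi (tens (loc_map P) s y) = s * loc_map P (alpha i y).
  apply: form_lift => [x y|r x].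
    by rewrite -rmorphD; congr (loc_map P _); exact: (quasi_basisD _ _ _ qb).
  by rewrite -rmorphM frob_pushE -aZ.
have [phi phiE] := choice chiP.
(* The factor [h] inverts [g] in the localization and turns alpha_i(u_j) = g δ_ij into exact
   duality. *)
apply: (dual_basis (v := fun i => tens (loc_map P) (h : (loc P)^o) (u i : frob_push charRp n))
  (phi := phi)).
  by move=> i i'; rewrite phiE ad rmorphM mulrA hg mul1r rmorph_nat.
apply: (lincomb_tens (g := loc_map P g)); last by exists h.
move=> y; exists (fun i => loc_map P (alpha i y) * loc_map P g).
rewrite -tensZr.
have -> : g *: y = lincomb (frob_act p n) u (fun i => alpha i y) :> frob_push charRp n.
  by rewrite frob_pushE /frob_act -as_.
rewrite lincomb_frob_push tens_sum; apply: eq_bigr => i _.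
rewrite -scalerA; congr (_ *: _); rewrite -tensZl; congr (tens _ _ _).
by rewrite -[RHS]/(_ * h) mulrC.
Qed.

Lemma rankE n r (u : 'I_(r ^ n) -> R) alpha g :
  quasi_basis p n u alpha g ->
  (forall P : prime_idealr R, minimal_prime P -> g \notin P /\
     exists2 t, t \notin P & forall x, x \in P -> t * x = 0) ->
  (exists2 P : prime_idealr R, minimal_prime P & same_krull_dim {ideal_quot P} R) ->
  rank (frob_push charRp n) = (r ^ n)%N.
Proof.
move=> qb gmin [P0 P0min P0dim].
have len (P : prime_idealr R) : minimal_prime P ->
    has_length (loc P)^o 1 /\ has_length (loc_mod P (frob_push charRp n)) (r ^ n).
  move=> /gmin[gP [t tP tx]]; have Lf := loc_field tP tx; split; last first.
    exact: (basis_has_length Lf (loc_mod_basis qb gP tP tx)).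
  apply: (basis_has_length Lf).
  apply: (dual_basis (v := fun _ : 'I_1 => 1 : (loc P)^o)
    (phi := fun=> idfun : {linear (loc P)^o -> (loc P)^o})).
    by move=> i j; rewrite !ord1 eqxx.
  by move=> x; exists (fun=> x); rewrite /lincomb big_ord1; exact: (esym (mulr1 _)).
rewrite /rank; apply: xget_unique => [P Pmin _|r' rr'].
  by have [l1 ln] := len P Pmin; exists 1%N; rewrite ?muln1.
(* [has_rank] constrains a number only through minimal primes of full dimension; P0 is such a prime
   and determines it. *)
have [l1 ln] := len P0 P0min; have [l Hl Hr] := rr' P0 P0min P0dim.
rewrite (has_length_unique ln Hr) (has_length_unique Hl l1).
by rewrite muln1.
Qed.

End Rank.

(** * Krull's intersection theorem *)

Section NoetherianModules.
Context (R : comNzRingType) (Rnoeth : noetherian R) (M : zmodType) (act : R -> M -> M).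
Context (actP : is_action act) (k : nat) (e : 'I_k -> M).
Context (eP : forall x, exists c, x = lincomb act e c).
Implicit Types (N D : set M).

(** For each j, the ideals of leading coefficients at e_j stabilize; nested submodules with the same
    leading ideals are equal, by induction on the last nonzero coefficient. *)
Lemma module_acc (N : nat -> set M) : (forall n, subm act (N n)) ->
  (forall n, N n `<=` N n.+1) -> exists n, forall i, N i `<=` N n.
Proof.
move=> Ns NS.
have Nle i j : (i <= j)%N -> N i `<=` N j.
  elim: j => [|j IHj]; first by rewrite leqn0 => /eqP->.
  by rewrite leq_eqVlt => /orP[/eqP->//|/IHj h] x /h /NS.
pose lead (j : 'I_k) n := [set a | exists c : 'I_k -> R,
  [/\ forall i : 'I_k, (j < i)%N -> c i = 0, c j = a & N n (lincomb act e c)]].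
have leadid j n : ideal (lead j n).
  split=> [|x y [c [c0 cj Nc]] [c' [c0' cj' Nc']]|a x [c [c0 cj Nc]]].
  - by exists (fun=> 0); rewrite lincomb0 //; split=> //; exact: subm0 (Ns n).
  - exists (fun i => c i - c' i); rewrite lincombB // cj cj'; split=> //.
      by move=> i ji; rewrite c0 ?c0' ?subr0.
    exact: (submB (Ns n)).
  - exists (fun i => a * c i); rewrite -lincombZ // cj; split=> //.
      by move=> i ji; rewrite c0 ?mulr0.
    exact: (submZ (Ns n)).
have stab j : exists n, forall i, lead j i `<=` lead j n.
  apply: (ideal_acc Rnoeth (leadid j)) => n a [c [c0 cj Nc]].
  by exists c; split=> //; exact: NS.
have [g gP] := choice stab.
pose n := \max_j g j; exists n => i x Nx.
suff main l : (l <= k)%N -> forall c : 'I_k -> R, (forall i' : 'I_k, (l <= i')%N -> c i' = 0) ->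
    N (maxn i n) (lincomb act e c) -> N n (lincomb act e c).
  have [c xE] := eP x; rewrite xE; apply: (main k) => //.
    by move=> i'; rewrite leqNgt ltn_ord.
  by rewrite -xE; apply: Nle Nx; exact: leq_maxl.
elim: l => [_ c c0 _|l IH lk c c0 Nc].
  have -> : c = fun=> 0 by apply/funext => i'; exact: c0.
  by rewrite lincomb0 //; exact: subm0 (Ns n).
pose j := Ordinal lk.
have [b [b0 bj Nb]] : lead j n (c j).
  have : lead j (maxn i n) (c j) by exists c.
  move/(gP j) => [b [b0 bj Nb]]; exists b; split=> //.
  by apply: Nle Nb; exact: (leq_bigmax j).
apply: (submBr (Ns n) Nb); rewrite -lincombB //; apply: IH (ltnW lk) _ _ _.
  move=> i'; rewrite leq_eqVlt => /orP[/eqP e'|li]; last by rewrite c0 // b0 ?subr0.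
  by have -> : i' = j by [apply: val_inj]; rewrite bj subrr.
rewrite lincombB //; apply: (submB (Ns _) Nc); apply: Nle Nb; exact: leq_maxr.
Qed.

Lemma submodule_fg D : subm act D -> exists j (f : 'I_j -> M),
  (forall i, D (f i)) /\ forall x, D x -> exists c, x = lincomb act f c.
Proof.
move=> Ds.
suff H : forall I, subm act I -> I `<=` D -> (exists j (f : 'I_j -> M),
    (forall i, D (f i)) /\ forall x, I x -> exists c, x = lincomb act f c) ->
    exists j (f : 'I_j -> M),
    (forall i, D (f i)) /\ forall x, D x -> exists c, x = lincomb act f c.
  have zs := subm_zero actP.
  apply: (H _ zs); first by move=> x ->; exact: subm0 Ds.
  exists 0%N, (fun=> 0); split=> [[]//|x ->]; exists (fun=> 0); by rewrite lincomb0.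
apply: (acc_ind module_acc) => I Is IH ID [j [f [Df fP]]].
have [DI|nDI] := pselect (D `<=` I).
  by exists j, f; split=> // x /DI; exact: fP.
have [x [Dx Ix]] : exists x, D x /\ ~ I x.
  by apply: contrapT => nex; apply: nDI => x Dx; apply: contrapT => Ix; apply: nex; exists x.
have xs : subm act [set z | exists a, z = act a x].
  have [_ aB aA _] := actP; split=> [|_ _ [a ->] [b ->]|b _ [a ->]].
  - by exists 0; rewrite act0.
  - by exists (a - b); rewrite aB.
  - by exists (b * a); rewrite aA.
apply: (IH (addm I [set z | exists a, z = act a x])); first exact: addm_subm.
- by move=> y Iy; exists y, 0; rewrite addr0; split=> //; exact: subm0 xs.
- move=> /(_ x) xI; apply: Ix; apply: xI; exists 0, x; rewrite add0r; split=> //.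
    exact: subm0 Is.
  by exists 1; have [_ _ _ ->] := actP.
- by move=> _ [y [_ [/ID Dy [a ->] ->]]]; apply: (submD Ds Dy); exact: (submZ Ds).
exists j.+1, (fun i => if unlift ord_max i is Some i' then f i' else x); split.
  by move=> i; case: unliftP => [i' _|_].
move=> _ [y [_ [/fP[c ->] [a ->] ->]]].
exists (fun i => if unlift ord_max i is Some i' then c i' else a).
rewrite /lincomb big_ord_recr /= unlift_none; congr (_ + _); apply: eq_bigr => i _.
by rewrite widen_ordS liftK.
Qed.

Context (m : idealr R) (Rlocal : local_ring m).

Lemma ideal_pow_le (J : set R) t : ideal J ->
  (forall a : 'I_t -> R, (forall i, a i \in m) -> J (\prod_i a i)) ->
  forall x, x \in ideal_pow m t -> J x.
Proof.
move=> Jid Ja x xt; have [S SP] := @submod_subm R R^o J Jid; apply/SP.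
by apply: (span_le _ xt) => _ [a am ->] /=; apply/SP; exact: Ja.
Qed.

Lemma ideal_pow_ideal t : ideal [set x | x \in ideal_pow m t].
Proof. exact: (@subm_submod R R^o). Qed.

Lemma ideal_pow_prod t (a : 'I_t -> R) : (forall i, a i \in m) ->
  \prod_i a i \in ideal_pow m t.
Proof. by move=> am; apply/asboolP => S; apply; exists a. Qed.

(** Dévissage avoids counting exponents of generators of m: if m^t1 lies in J + Rb and m^t2 in J :
    b, then m^(t1+t2) lies in J. *)
Lemma ideal_pow_sub J : ideal J -> (forall a, a \in m -> exists i, J (a ^+ i)) ->
  exists t, forall x, x \in ideal_pow m t -> J x.
Proof.
move: J; apply: (devissage Rnoeth) => [J Jid J1 _|P Pp _ Pm|J b Jid H1 H2 Jm].
- by exists 0%N => x _; exact: ideal1.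
- have [Pid _ _] := Pp; exists 1%N; apply: ideal_pow_le => // a am.
  by rewrite big_ord1; have [i /(primeiX Pp)] := Pm _ (am ord0).
- have [a am|t1 t1P] := H1.
    by have [i Ja] := Jm a am; exists i; exact: sub_adjoin.
  have [a am|t2 t2P] := H2.
    by have [i Ja] := Jm a am; exists i; exact: sub_colon.
  exists (t1 + t2)%N; apply: ideal_pow_le => // a am; rewrite big_split_ord /=.
  have [y [r [Jy ->]]] := t1P _ (ideal_pow_prod (fun i => am (lshift t2 i))).
  have := t2P _ (ideal_pow_prod (fun i => am (rshift t1 i))).
  rewrite /colon /= => Jb; rewrite mulrDl; apply: (submD Jid).
    by rewrite mulrC; exact: (submZ Jid).
  by rewrite -mulrA; exact: (submZ Jid).
Qed.

(** The hypothesis says that [y] lies in all N + m^t M. With D the intersection of these and D' = N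
    + mD, Nakayama reduces the claim to D = D', which is shown by a maximality argument in place of
    Artin-Rees. *)
Lemma krull_intersection N y : subm act N ->
  (forall t T, subm act T -> N `<=` T ->
     (forall c x, c \in ideal_pow m t -> T (act c x)) -> T y) -> N y.
Proof.
move=> Ns yP; have [aB aBl aA a1] := actP; have Mid := idealr_ideal m.
pose D := [set y | forall t T, subm act T -> N `<=` T ->
  (forall c x, c \in ideal_pow m t -> T (act c x)) -> T y].
have Ds : subm act D.
  split=> [t T Ts _ _|x z Dx Dz t T Ts NT Tc|a x Dx t T Ts NT Tc].
  - exact: subm0 Ts.
  - by apply: (submB Ts); [exact: (Dx t)|exact: (Dz t)].
  - by apply: (submZ Ts); exact: (Dx t).
have ND : N `<=` D by move=> x Nx t T _ /(_ x Nx).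
have [j [f [Df fP]]] := submodule_fg Ds.
pose D' := [set z | exists n c, [/\ N n, forall i, c i \in m & z = n + lincomb act f c]].
have D's : subm act D'.
  split=> [|_ _ [n [c [Nn cm ->]]] [n' [c' [Nn' cm' ->]]]|a _ [n [c [Nn cm ->]]]].
  - exists 0, (fun=> 0); rewrite lincomb0 // addr0; split=> // [|i]; first exact: subm0 Ns.
    exact: subm0 Mid.
  - exists (n - n'), (fun i => c i - c' i); rewrite lincombB // opprD addrACA; split=> //.
      exact: (submB Ns).
    by move=> i; exact: (submB Mid (cm i) (cm' i)).
  - exists (act a n), (fun i => a * c i); rewrite -lincombZ // act_actD //; split=> //.
      exact: (submZ Ns).
    by move=> i; exact: (submZ Mid _ (cm i)).
have D'N : N `<=` D'.
  move=> n Nn; exists n, (fun=> 0); rewrite lincomb0 // addr0; split=> // i.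
  exact: subm0 Mid.
have mD' a x : a \in m -> D x -> D' (act a x).
  move=> am /fP[c ->]; exists 0, (fun i => a * c i); rewrite -lincombZ // add0r.
  by split=> //; [exact: subm0 Ns|move=> i; rewrite mulrC; exact: (submZ Mid)].
suff DD' : D `<=` D'.
  have Nf : forall i, N (f i) by apply: (nakayama Rnoeth Rlocal actP Ns) => i; exact: DD'.
  by have [c ->] := fP y yP; exact: lincomb_subm.
(* The induction amounts to taking [L] maximal with these properties. Some m^t M then lies in [L],
   hence so does D, and D = L ∩ D lies in D'. *)
suff H : forall L, subm act L -> D' `<=` L -> L `&` D `<=` D' -> D `<=` D'.
  by apply: (H D' D's) => // x [].
apply: (acc_ind module_acc) => L Ls IH D'L LD.
have [//|nDD'] := pselect (D `<=` D').
(* Once the submodules L : a^i stabilize, L + a^i M still meets D inside D', because aD lies in D';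
   maximality of [L] gives a^i M inside [L]. *)
have powm a : a \in m -> exists i, forall x, L (act (a ^+ i) x).
  move=> am; pose K i := [set x | L (act (a ^+ i) x)].
  have Ks i : subm act (K i).
    split=> [|x z|b x]; rewrite /K /= ?act_act0 ?aB //.
    - exact: subm0 Ls.
    - exact: (submB Ls).
    - by rewrite aA mulrC -aA; exact: (submZ Ls).
  have KS i : K i `<=` K i.+1.
    by move=> x Kx; rewrite /K /= exprS -aA; exact: (submZ Ls).
  have [i Ki] := module_acc Ks KS.
  apply: contrapT => nex.
  pose im := [set z | exists x, z = act (a ^+ i) x].
  have ims : subm act im.
    split=> [|_ _ [x ->] [z ->]|b _ [x ->]].
    - by exists 0; rewrite act_act0.
    - by exists (x - z); rewrite aB.
    - by exists (act b x); rewrite !aA mulrC.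
  apply: nDD'; apply: (IH (addm L im)); first exact: addm_subm.
  - by move=> x Lx; exists x, 0; rewrite addr0; split=> //; exact: subm0 ims.
  - move=> le; apply: nex; exists i => x; apply: le; exists 0, (act (a ^+ i) x).
    by rewrite add0r; split=> //; [exact: subm0 Ls|exists x].
  - by move=> x /D'L Lx; exists x, 0; rewrite addr0; split=> //; exact: subm0 ims.
  - move=> _ [[l [_ [Ll [x ->] ->]]] Dy]; apply: LD; split=> //.
    apply: (submD Ls Ll); apply: (Ki i.+1).
    rewrite /K /= exprS -aA.
    have /D'L := mD' _ _ am Dy; rewrite act_actD // => La.
    by have := submB Ls La (submZ Ls a Ll); rewrite addrAC subrr add0r.
pose J := [set c | forall x, L (act c x)].
have Jid : ideal J.
  split=> [x|b c Jb Jc x|b c Jc x] /=.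
  - by rewrite act0 //; exact: subm0 Ls.
  - by rewrite aBl; exact: (submB Ls).
  - by rewrite -aA; exact: (submZ Ls).
have [t tJ] := ideal_pow_sub Jid powm.
move=> x Dx; apply: LD; split=> //; apply: (Dx t) => //.
  by move=> z /D'N /D'L.
by move=> c z /tJ.
Qed.

End NoetherianModules.

(** * The two closures *)

Section MulTensor.
Context (R : comNzRingType) (p : nat) (charRp : p \in [pchar R]) (n : nat) (N : lmodType R).
Local Notation F := (frob_push charRp n).
Local Notation id_R := (idfun : {rmorphism R -> R}).

Definition push_mul (r : R) : F -> F := fun x => r * (x : R).

Fact push_mul_linear r : linear (push_mul r).
Proof.
move=> a x y; rewrite /push_mul !frob_pushE /frob_act.
by rewrite -[LHS]/(r * (a ^+ (p ^ n) * x + y : R)) mulrDr mulrCA.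
Qed.

HB.instance Definition _ r := GRing.isLinear.Build R F F *:%R (push_mul r) (push_mul_linear r).

(* F^n_*(R) (x) N, with R acting by multiplication on F^n_*(R) = R rather than
   through the n-fold Frobenius. *)
Definition mul_tensor : Type := tensor id_R F N.

HB.instance Definition _ := GRing.Zmodule.on mul_tensor.

Definition mul_map (r : R) : {linear tensor id_R F N -> tensor id_R F N} :=
  tensor_map (f := id_R) (push_mul r) (idfun : {linear N -> N}).

Lemma mul_mapE r (x : F) y : mul_map r (tens id_R x y) = tens id_R (r * (x : R) : F) y.
Proof. exact: tensor_map_tens. Qed.

Lemma eq_tensor (f g : {linear tensor id_R F N -> tensor id_R F N}) :
  (forall x y, f (tens id_R x y) = g (tens id_R x y)) -> f =1 g.
Proof.
move=> fg; apply: (@tens_ind _ _ id_R F N [set z | f z = g z]) => [|//].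
by split=> [|x y fx fy|a x fx] /=; rewrite ?linear0 ?linearB ?linearZ ?fx ?fy.
Qed.

Definition mul_tensor_scale (r : R) (z : mul_tensor) : mul_tensor := mul_map r z.

Fact mul_tensor_scaleA a b v :
  mul_tensor_scale a (mul_tensor_scale b v) = mul_tensor_scale (a * b) v.
Proof.
apply: (@eq_tensor (mul_map a \o mul_map b) (mul_map (a * b))) => x y /=.
by rewrite !mul_mapE; congr (tens _ _ _); exact: mulrA.
Qed.

Fact mul_tensor_scale1 : left_id 1 mul_tensor_scale.
Proof.
apply: (@eq_tensor (mul_map 1) idfun) => x y /=.
by rewrite mul_mapE; congr (tens _ _ _); exact: mul1r.
Qed.

Fact mul_tensor_scaleDr : right_distributive mul_tensor_scale +%R.
Proof. by move=> a v w; exact: (linearD (mul_map a)). Qed.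

Fact mul_tensor_scaleDl v : {morph mul_tensor_scale^~ v : a b / a + b}.
Proof.
move=> a b; apply: (@eq_tensor (mul_map (a + b)) (mul_map a \+ mul_map b)) => x y /=.
by rewrite !mul_mapE -tensDl; congr (tens _ _ _); exact: mulrDl.
Qed.

HB.instance Definition _ := GRing.Zmodule_isLmodule.Build R mul_tensor
  mul_tensor_scaleA mul_tensor_scale1 mul_tensor_scaleDr mul_tensor_scaleDl.

Lemma mul_tensorZ r (x : F) y :
  r *: (tens id_R x y : mul_tensor) = (tens id_R (r * (x : R) : F) y : mul_tensor).
Proof. exact: mul_mapE. Qed.

End MulTensor.

Section FrobeniusPower.
Context (R : comNzRingType) (p : nat) (charRp : p \in [pchar R]).
Context (B : lmodType R).
Local Notation id_R := (idfun : {rmorphism R -> R}).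

Lemma quo_eq0 (A : submodClosed B) b : b \in A -> quo A b = 0.
Proof. by move=> bA; rewrite -(linear0 (quo A)); apply/quoP; rewrite subr0. Qed.

Lemma tens_frob_power n (A : submodClosed B) x b : b \in A ->
  tens (frob charRp n) (x : R^o) b \in frob_power charRp n A.
Proof.
move=> bA; apply/asboolP; exists (tens (frob charRp n) (x : R^o) (Submod bA)).
exact: tensor_map_tens.
Qed.

Lemma frob_power_le n (A : submodClosed B) (T : set (frob_base_change charRp n B)) :
  subm (fun (a : R) x => a *: x) T ->
  (forall x b, b \in A -> T (tens (frob charRp n) (x : R^o) b)) ->
  forall z, z \in frob_power charRp n A -> T z.
Proof.
move=> Ts TA z /asboolP[w <-]; move: w.
apply: (@tens_ind _ _ (frob charRp n) R^o (submod A)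
  [set w | T (tensor_map (f := frob charRp n) (idfun : {linear R^o -> R^o}) (incl A) w)]) => [|x b].
  split=> [|x y Tx Ty|a x Tx] /=; rewrite ?linear0 ?linearB ?linearZ.
  - exact: subm0 Ts.
  - exact: (submB Ts).
  - exact: (submZ Ts).
by rewrite /= tensor_map_tens; apply: TA; exact: (valP b).
Qed.

Lemma frob_power_sub n (A A' : submodClosed B) : {subset A <= A'} ->
  {subset frob_power charRp n A <= frob_power charRp n A'}.
Proof.
move=> AA' z.
apply: (frob_power_le (T := [set z | z \in frob_power charRp n A'])); first exact: subm_submod.
by move=> x b /AA'; exact: tens_frob_power.
Qed.

(* The n-th Frobenius base change of B/A is the quotient of that of B by A^[p^n],
   and has the same underlying group as F^n_*(R) (x) B/A. *)
Lemma tens_quo_eq0 n (A : submodClosed B) c b :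
  c *: frob_elt charRp n b \in frob_power charRp n A ->
  tens id_R (c : frob_push charRp n) (quo A b) = 0.
Proof.
move=> cb; pose E := mul_tensor charRp n (quomod A).
have [theta thetaE] : exists theta : {linear tensor (frob charRp n) R^o B -> E},
    forall x y, theta (tens (frob charRp n) x y) = tens id_R (x : frob_push charRp n) (quo A y).
  apply: tensor_lift => [s x x' y|x y y'|r x y].
  - rewrite mul_tensorZ; exact: (tensDl id_R (s * x : frob_push charRp n)).
  - by rewrite linearD; exact: (tensDr id_R (x : frob_push charRp n)).
  - rewrite linearZ /=.
    rewrite [LHS](tensZr id_R r (x : frob_push charRp n)).
    by rewrite -[LHS](tensZl id_R r (x : frob_push charRp n)).
have : theta (c *: frob_elt charRp n b) = 0.
  apply: (frob_power_le (T := [set z | theta z = 0]) _ _ cb).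
    split=> [|x y fx fy|a x fx] /=; rewrite ?linear0 ?linearB ?linearZ //=.
      by rewrite fx fy subrr.
    by rewrite fx scaler0.
  by move=> x a aA /=; rewrite thetaE quo_eq0 //; exact: tensr0.
rewrite linearZ /= /frob_elt thetaE mul_tensorZ => <-; congr (tens _ _ _).
exact: (esym (mulr1 c)).
Qed.

End FrobeniusPower.

(** * Two-sided control of the length of the image *)

Section TensorImage.
Context (R : comNzRingType) (m : idealr R) (p : nat) (charRp : p \in [pchar R]).
Context (Rnoeth : noetherian R) (Rlocal : local_ring m).
Context (B : lmodType R) (A A' : submodClosed B).
Local Notation id_R := (idfun : {rmorphism R -> R}).
Local Notation F := (frob_push charRp).

Lemma quo_subquo b : b \in A' -> quo A b \in subquo A A'.
Proof. by move=> bA'; apply/asboolP; exists (Submod bA'). Qed.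

Lemma tens_tensor_image (N : lmodType R) (x : N) b : b \in A' ->
  tens id_R x (quo A b) \in image_mod (tensor_map (f := id_R)
    (idfun : {linear N -> N}) (incl (subquo A A'))).
Proof.
move=> bA'; apply/asboolP; exists (tens id_R x (Submod (quo_subquo bA'))).
exact: tensor_map_tens.
Qed.

(* The coordinate alpha induces an R-linear map from F^(k+n)_*(R) (x) B/A to the
   k-th Frobenius base change of B/A. *)
Lemma coordinate_lift k n (T : finType) (u : T -> R) alpha g i :
  quasi_basis p n u alpha g ->
  exists phi : {linear tensor id_R (F (k + n)) (quomod A) ->
      restr (frob charRp k) (quomod (frob_power charRp k A))},
    forall (x : R) b, phi (tens id_R (x : F (k + n)) (quo A b)) =
      quo (frob_power charRp k A) (tens (frob charRp k) (alpha i x : R^o) b).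
Proof.
move=> qb; have [aB aZ _ _] := qb.
pose q := quo (frob_power charRp k A).
pose psi (x : F (k + n)) (y : quomod A) : restr (frob charRp k) (quomod (frob_power charRp k A)) :=
  q (tens (frob charRp k) (alpha i x : R^o) (repr y)).
have psiE x b : psi x (quo A b) = q (tens (frob charRp k) (alpha i x : R^o) b).
  apply/quoP.
  have bA : repr (quo A b) - b \in A by apply/quoP; rewrite /quo reprK.
  have := tens_frob_power charRp k (alpha i x) bA.
  by rewrite tensBr.
have qD x y : q (x + y) = q x + q y by exact: linearD.
have [phi phiE] : exists phi : {linear tensor id_R (F (k + n)) (quomod A) ->
      restr (frob charRp k) (quomod (frob_power charRp k A))},
      forall x y, phi (tens id_R x y) = psi x y.
  apply: tensor_lift => [s x x' y|x y y'|s x y].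
  - have [b ->] := quo_surj y; rewrite !psiE.
    have -> : alpha i (s *: x + x') = s ^+ (p ^ k) * alpha i x + alpha i x'.
      rewrite -aZ -exprM -expnD -(quasi_basisD _ _ _ qb) frob_pushE /frob_act.
      by [].
    rewrite -(frobE charRp) -[frob charRp k s * _]/(frob charRp k s *: (_ : R^o)).
    by rewrite tensDl tensZl qD; congr (_ + _); exact: quo_scalable.
  - have [b ->] := quo_surj y; have [b' ->] := quo_surj y'.
    by rewrite -quoD !psiE tensDr qD.
  - have [b ->] := quo_surj y; rewrite -quo_scalable !psiE.
    have -> : alpha i (id_R s *: x) = s ^+ (p ^ k) * alpha i x.
      by rewrite -aZ -exprM -expnD frob_pushE.
    by rewrite tensZr -tensZl -(frobE charRp).
by exists phi => x b; rewrite phiE psiE.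
Qed.

(** The elements u_i (x) b are independent modulo m: the i-th coordinate map sends a relation to c_i
    v = 0, where v is the nonzero class of g b^(p^k), and a unit c_i would kill v. *)
Lemma tensor_image_lower k n j (u : 'I_j -> R) alpha g b l :
  quasi_basis p n u alpha g -> b \in A' ->
  g *: frob_elt charRp k b \notin frob_power charRp k A ->
  has_length (tensor_image A A' (F (k + n))) l -> (j <= l)%N.
Proof.
move=> qb bA' nb Hl; have Mp := local_primei Rnoeth Rlocal.
have [phi phiE] := choice (fun i => coordinate_lift k i qb).
have [_ _ _ ad] := qb.
pose S : submodClosed (tensor id_R (F (k + n)) (quomod A)) := image_mod (tensor_map (f := id_R)
  (idfun : {linear F (k + n) -> F (k + n)}) (incl (subquo A A'))).
pose V := tensor_image A A' (F (k + n)).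
pose t i : V := Submod (tens_tensor_image (u i : F (k + n)) bA').
pose U := restr (frob charRp k) (quomod (frob_power charRp k A)).
pose v : U := quo (frob_power charRp k A) (g *: frob_elt charRp k b).
have phit i i' : phi i (\val (t i')) = (if i == i' then v else 0).
  rewrite /= phiE ad; case: eqP => _.
    rewrite mulr1 /v /frob_elt -tensZl; congr (quo _ (tens _ _ _)).
    exact: (esym (mulr1 g)).
  by rewrite mulr0 tens0; exact: linear0.
have zs := subm_zero (scale_action V).
apply: (has_length_lenle Hl).
apply: (@chain_weaken _ _ _ _ (~` [set x | x \in m])).
  by move=> _ ->; case: Mp.
apply: (indep_chain (u := t) (scale_action V) zs) => // c c0 i /=.
apply: contrapT => /negP cm.
have [s sc] := local_unit Rnoeth Rlocal cm.
have cv : c i *: v = 0.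
  have : phi i (incl S (\sum_i' c i' *: t i')) = 0 by rewrite [\sum_i' _]c0 !linear0.
  rewrite linear_sum linear_sum (bigD1 i) //= big1 ?addr0 => [|i' ii'].
    by rewrite linearZ /= phit eqxx.
  by rewrite linearZ /= phit eq_sym (negPf ii') scaler0.
move/negP: nb; apply; rewrite -[g *: _]subr0; apply/quoP.
rewrite [RHS]linear0 -[LHS]/v -[v]scale1r -sc -scalerA cv.
exact: scaler0.
Qed.

Lemma tensor_image_upper n s t k (b : 'I_k -> B) c l :
  (forall i, b i \in A') ->
  (forall x, x \in A' -> exists r : 'I_k -> R, x = \sum_i r i *: b i) ->
  (forall i, c *: frob_elt charRp n (b i) \in frob_power charRp n A) ->
  (forall r x, r \in ideal_pow m t -> r *: x \in A) -> (t <= p ^ s)%N ->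
  lenle (frob_act p n) [set 1] (addi (adjoin [set 0] c) (max_power m p (n + s))) [set: R] l ->
  exists2 l', has_length (tensor_image A A' (F n)) l' & (l' <= k * l)%N.
Proof.
move=> bA' bP cb mt ts Hl.
have actP := frob_act_action charRp n.
pose T := tensor id_R (F n) (quomod A); pose V := tensor_image A A' (F n).
pose f (i : 'I_k) (x : R) : T := tens id_R (x : F n) (quo A (b i)).
pose S : submodClosed T := image_mod (tensor_map (f := id_R)
  (idfun : {linear F n -> F n}) (incl (subquo A A'))).
have fD i x y : f i (x + y) = f i x + f i y by exact: tensDl.
have fP i : act_linear (frob_act p n) (fun (a : R) (x : T) => a *: x) (f i).
  split=> [x y|a x]; last by rewrite /f -tensZl frob_pushE.
  by have := fD i (x - y) y; rewrite subrK => ->; rewrite addrK.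
have zT := subm_zero (scale_action T).
have zV := subm_zero (scale_action V).
(* The kernel is an ideal of R and not merely a submodule of F^n_*(R), because R also acts by plain
   multiplication on the left factor; this is the purpose of [mul_tensor]. *)
have Kid i : ideal [set x | f i x = 0].
  split=> [|x y fx fy|a x fx] /=; first exact: tens0.
    by rewrite (fP i).1 fx fy subrr.
  have -> : f i (a * x) = a *: (f i x : mul_tensor charRp n (quomod A)).
    exact: (esym (mul_tensorZ a (x : F n) (quo A (b i)))).
  by rewrite fx; exact: (@scaler0 _ (mul_tensor charRp n (quomod A)) a).
have fK i x : addi (adjoin [set 0] c) (max_power m p (n + s)) x -> f i x = 0.
  apply: (addi_le (Kid i)).
    apply: adjoin_le; first exact: Kid.
      by move=> _ ->; exact: subm0 (Kid i).
    exact: tens_quo_eq0.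
  apply: geni_le; first exact: Kid.
  move=> _ [y my ->] /=.
  (* y^(p^(n+s)) is y^(p^s) acting on 1 in F^n_*(R); moved across the tensor sign, y^(p^s) lies in
     m^t and kills B/A. This is why the exponent n + s appears. *)
  have yt : y ^+ (p ^ s) \in ideal_pow m t.
    rewrite -(subnK ts) exprD; apply: (submZ (ideal_pow_ideal m t)).
    have := ideal_pow_prod (a := fun _ : 'I_t => y) (fun=> my).
    by rewrite prodr_const card_ord.
  pose o : F n := (1 : R).
  have -> : f i (y ^+ (p ^ (n + s))) = tens id_R (y ^+ (p ^ s) *: o) (quo A (b i)).
    by congr (tens _ _ _); rewrite frob_pushE /frob_act mulr1 -exprM -expnD addnC.
  rewrite tensZl -tensZr -quo_scalable quo_eq0 ?tensr0 //.
  exact: mt.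
apply: lenle_has_length.
have inclP : act_linear (fun (a : R) (x : V) => a *: x) (fun (a : R) (x : T) => a *: x) (incl S).
  by split=> [x y|a x]; rewrite ?linearB ?linearZ.
apply: (lenle_inj (N2 := [set 0]) (N2' := [set x | x \in S]) inclP (scale_action T) zV zT
  (subm_submod S)).
- by move=> _ ->; exact: rpred0.
- by move=> x _; exact: (valP x).
- by move=> x _ /= x0; apply: val_inj.
apply: (lenle_gens (f := f) (N1' := [set: R]) (scale_action T) (mulclosed1 R) fP
  _ _ fK zT _ Hl) => //.
pose tm : {linear tensor id_R (F n) (submod (subquo A A')) -> T} :=
  tensor_map (f := id_R) (idfun : {linear F n -> F n}) (incl (subquo A A')).
suff tmP w : exists y : 'I_k -> R, tm w = \sum_i f i (y i).
  move=> z /asboolP[w <-]; have [y wy] := tmP w.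
  by exists 0, y; rewrite add0r -wy.
move: w; apply: (@tens_ind _ _ id_R (F n) (submod (subquo A A'))
  [set w | exists y : 'I_k -> R, tm w = \sum_i f i (y i)]).
  split=> [|w w' [y wy] [y' wy']|a w [y wy]] /=.
  - by exists (fun=> 0); rewrite linear0 big1 // => i _; exact: tens0.
  - exists (fun i => y i - y' i); rewrite linearB wy wy' -sumrB.
    by apply: eq_bigr => i _; rewrite (fP i).1.
  - exists (fun i => frob_act p n a (y i)); rewrite linearZ /= wy scaler_sumr.
    by apply: eq_bigr => i _; rewrite (fP i).2.
move=> x [q qP] /=; have /asboolP[a' qE] := qP.
have [r rE] := bP _ (valP a').
have {}qE : q = \sum_i r i *: quo A (b i).
  rewrite -qE -[LHS]/(quo A (\val a')) rE linear_sum; apply: eq_bigr => i _.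
  exact: quo_scalable.
have e : incl (subquo A A') (Submod qP) = q by [].
exists (fun i => frob_act p n (r i) x); rewrite /tm tensor_map_tens.
rewrite e qE.
rewrite tens_sum.
apply: eq_bigr => i _; rewrite (fP i).2.
exact: erefl.
Qed.

End TensorImage.

Section Dimension.
Context (R : comNzRingType) (d : nat) (Rdim : krull_dim R d).

Lemma krull_dim_unique d' : krull_dim R d' -> d' = d.
Proof.
by case: Rdim => c b [c' b']; apply/eqP; rewrite eqn_leq (b _ c') (b' _ c).
Qed.

Lemma primes_above_le (P : set R) l : primes_above l P -> (l <= d)%N.
Proof. by move=> /primes_above_prime_chain; exact: Rdim.2. Qed.

Lemma primes_above_minimal (P : prime_idealr R) l : primes_above l [set x | x \in P] ->
  (l < d)%N \/ minimal_prime P.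
Proof.
move=> ch; have [|nmin] := pselect (minimal_prime P); [by right|left].
have [Q [QP nPQ]] : exists Q : prime_idealr R, {subset Q <= P} /\ ~ {subset P <= Q}.
  apply: contrapT => nex; apply: nmin => Q QP; apply: contrapT => nPQ.
  by apply: nex; exists Q.
apply: (@primes_above_le [set x | x \in Q] l.+1); split; first exact: prime_idealr_primei.
by exists [set x | x \in P]; split.
Qed.

Lemma equidim_primes_above (P : prime_idealr R) : same_krull_dim {ideal_quot P} R ->
  primes_above d [set x | x \in P].
Proof.
move=> [d' [[[Q QS] _] /krull_dim_unique e]]; rewrite {}e in QS.
pose pi : {rmorphism R -> {ideal_quot P}} := \pi_{ideal_quot P}.
pose T i := [set x | pi x \in Q i].
have Tp i : primei (T i).
  have [[Q0 QB QZ] Q1 QM] := prime_idealr_primei (Q i).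
  rewrite /T; split; [split=> [|x y|a x]|..] => /=.
  - by rewrite rmorph0.
  - by rewrite rmorphB; exact: QB.
  - by rewrite rmorphM; exact: QZ.
  - by rewrite rmorph1.
  - by move=> a b; rewrite rmorphM; exact: QM.
have chT : primes_above d (T 0%N).
  apply: primes_above_seq => // i id; have [le nle] := QS i id; split=> [x /le //|nT].
  by apply: nle => y; rewrite -[y]reprK; exact: nT.
have PT : [set x | x \in P] `<=` T 0%N.
  move=> x /= xP; have pix : pi x = 0.
    have := Quotient.idealrBE P x 0; rewrite subr0 xP => /esym/eqP e.
    exact: etrans e (rmorph0 pi).
  by rewrite /T /= pix; exact: rpred0.
(* The chain pulled back from R/P starts at a prime containing P; were it not P itself, prepending P
   would give d + 1 inclusions. *)
have [TP|nTP] := pselect (T 0%N `<=` [set x | x \in P]).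
  by rewrite (_ : [set x | x \in P] = T 0%N) //; apply/seteqP.
suff /primes_above_le : primes_above d.+1 [set x | x \in P] by rewrite ltnn.
by split; [exact: prime_idealr_primei|exists (T 0%N)].
Qed.

End Dimension.

(** * Comparison of the sequence closure with tight closure *)

Section Closures.
Context (R : comNzRingType) (m : idealr R) (p : nat) (charRp : p \in [pchar R]).
Context (Rnoeth : noetherian R) (Rlocal : local_ring m).
Context (r : nat) (r0 : (0 < r)%N) (g : R).
Context (gP : forall P : prime_idealr R, minimal_prime P -> g \notin P).
Context (basis : forall n, exists (u : 'I_(r ^ n) -> R) alpha, quasi_basis p n u alpha g).
Context (growth : forall c, (forall P : prime_idealr R, minimal_prime P -> c \notin P) ->
  exists C, forall n, exists2 l,
    lenle (frob_act p n) [set 1] (addi (adjoin [set 0] c) (max_power m p n)) [set: R] l &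
    (l * p ^ n <= C * r ^ n)%N).
Local Notation F := (frob_push charRp).
Context (alpha : lmodType R -> nat) (C0 : nat).
Context (alpha_ge : forall n, (r ^ n <= alpha (F n))%N).
Context (alpha_le : forall n, (alpha (F n) <= C0 * r ^ n)%N).
Context (B : lmodType R) (Bfg : fin_gen B).
Implicit Types (A : submodClosed B).

Lemma admissible_tight A A' b k : admissible F alpha A A' -> b \in A' ->
  g *: frob_elt charRp k b \in frob_power charRp k A.
Proof.
move=> [_ small] bA'; apply: contrapT => /negP nb.
(* With this choice the length at index k + n0 is at most C0 r^(k+n0) / (C0 r^k + 1), strictly below
   r^n0, against the lower bound from [tensor_image_lower]. *)
pose eps : rat := ((C0 * r ^ k)%N.+1%:R)^-1.
have eps0 : 0 < eps by rewrite invr_gt0 ltr0n.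
have [n0 H] := small eps eps0.
have [l Hl le] := H (k + n0)%N (leq_addl _ _).
have [u [al qb]] := basis n0.
have := tensor_image_lower Rnoeth Rlocal qb bA' nb Hl.
have := alpha_le (k + n0).
move: le; rewrite /eps mulrC ler_pdivlMr ?ltr0n // -natrM ler_nat.
rewrite expnD => h1 h2 h3; have rn : (0 < r ^ n0)%N by rewrite expn_gt0 r0.
have h4 : (r ^ n0 * (C0 * r ^ k).+1 <= l * (C0 * r ^ k).+1)%N by rewrite leq_mul2r h3 orbT.
have := leq_trans (leq_trans h4 h1) h2; rewrite mulnA mulnS; lia.
Qed.

Lemma tight_subm A : subm (fun (a : R) (x : B) => a *: x) (tight_closure charRp A).
Proof.
split=> [|x y [c cP [n xn]] [c' cP' [n' yn]]|a x [c cP [n xn]]].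
- exists 1 => [P _|]; first by rewrite idealr1.
  by exists 0%N => n _; rewrite /frob_elt tensr0 scaler0; exact: rpred0.
- exists (c * c') => [P Pmin|].
    by rewrite prime_idealrM (negPf (cP P Pmin)) (negPf (cP' P Pmin)).
  exists (maxn n n') => i; rewrite geq_max => /andP[/xn xi /yn yi].
  have e : frob_elt charRp i (x - y) = frob_elt charRp i x - frob_elt charRp i y.
    exact: tensBr.
  rewrite e scalerBr -scaleN1r rpredD //; first by rewrite mulrC -scalerA rpredZ.
  by rewrite rpredZ // -scalerA rpredZ.
- exists c => //; exists n => i /xn xi.
  by rewrite /frob_elt tensZr scalerA mulrC -scalerA rpredZ.
Qed.

Lemma tight_mono A A' : {subset A <= A'} -> tight_closure charRp A `<=` tight_closure charRp A'.
Proof.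
move=> AA' b [c cP [n bn]]; exists c => //; exists n => i /bn.
exact: frob_power_sub.
Qed.

Lemma sub_tight A b : b \in A -> tight_closure charRp A b.
Proof.
move=> bA; exists 1 => [P _|]; first by rewrite idealr1.
by exists 0%N => n _; rewrite scale1r; exact: tens_frob_power.
Qed.

Lemma tight_admissible A A' t :
  (forall a x, a \in ideal_pow m t -> a *: x \in A) -> {subset A <= A'} ->
  (forall b, b \in A' -> tight_closure charRp A b) -> admissible F alpha A A'.
Proof.
move=> At AA' A'P; split=> // eps eps0.
have [kB [eB eBP]] := Bfg.
have [k [b [bA' bP]]] := submodule_fg Rnoeth (scale_action B) (e := eB) eBP (subm_submod A').
have cP i : exists c, (forall P : prime_idealr R, minimal_prime P -> c \notin P) /\
    exists n0, forall n, (n0 <= n)%N -> c *: frob_elt charRp n (b i) \in frob_power charRp n A.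
  by have [c ? [n0 ?]] := A'P _ (bA' i); exists c; split=> //; exists n0.
have [c /all_and2[cP1 cP2]] := choice cP; have [n0 n0P] := choice cP2.
pose cc := \prod_i c i.
have ccP (P : prime_idealr R) : minimal_prime P -> cc \notin P.
  move=> Pmin; apply/negP; apply: (primei_prod (prime_idealr_primei P)) => i.
  exact/negP/cP1.
have [C HC] := growth ccP.
have p1 := prime_gt1 (pprime charRp).
(* Only t <= p^s matters; [s] stays fixed as n grows, so it costs the constant factor r^s. *)
pose s := t; have ts : (t <= p ^ s)%N by apply/ltnW/ltn_expl.
pose K := (k * (C * r ^ s))%N.
pose n1 := (Num.truncn (K%:R / eps : rat)).+1.
exists (maxn (\max_i n0 i) n1) => n; rewrite geq_max => /andP[nn0 nn1].
have [l Hl lC] := HC (n + s)%N.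
have WX (a : R) i : [set 1] a -> [set 1] (a ^+ i) by move=> ->; rewrite /= expr1n.
have cb i : cc *: frob_elt charRp n (b i) \in frob_power charRp n A.
  rewrite /cc (bigD1 i) //= mulrC -scalerA rpredZ //; apply: n0P.
  by apply: leq_trans nn0; exact: leq_bigmax.
(* Submodules of F^n_*(R) are also submodules of F^(n+s)_*(R), so the bound for n + s applies to
   chains for n. *)
have Hn : lenle (frob_act p n) [set 1] (addi (adjoin [set 0] cc) (max_power m p (n + s)))
    [set: R] l by move=> j /(frob_act_chain s WX) /Hl.
have [l' Hl' l'le] := tensor_image_upper bA' bP cb At ts Hn.
exists l' => //.
have l'K : (l' * p ^ n <= K * r ^ n)%N.
  apply: (@leq_trans (k * (l * p ^ (n + s)))).
    by rewrite mulnA leq_mul // leq_pexp2l ?leq_addr // ltnW.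
  by rewrite /K -!mulnA leq_mul2l -expnD addnC [(s + n)%N]addnC lC orbT.
have Kn : K%:R <= eps * (p ^ n)%:R.
  rewrite mulrC -ler_pdivrMr //; apply/ltW.
  apply: (lt_le_trans (truncnS_gt _)); rewrite ler_nat.
  by apply: leq_trans nn1 _; apply/ltnW/ltn_expl.
have pn0 : 0 < (p ^ n)%:R :> rat by rewrite ltr0n expn_gt0 ltnW.
rewrite -(ler_pM2r pn0); apply: (@le_trans _ _ ((K * r ^ n)%:R)).
  by rewrite -natrM ler_nat.
rewrite natrM; apply: (@le_trans _ _ (eps * (p ^ n)%:R * (r ^ n)%:R)).
  by rewrite ler_wpM2r ?ler0n.
rewrite -!mulrA; apply: ler_wpM2l; first exact: ltW.
rewrite [leRHS]mulrC; apply: ler_wpM2l; first by rewrite ler0n.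
rewrite ler_nat.
exact: alpha_ge.
Qed.

Lemma add_pow_pow A t a x : a \in ideal_pow m t -> a *: x \in add_pow m A t.
Proof. by move=> am; apply/asboolP => S; apply; right; exists a => //; exists x. Qed.

Lemma sub_add_pow A t : {subset A <= add_pow m A t}.
Proof. by move=> x xA; apply/asboolP => S; apply; left. Qed.

Lemma frob_power_add_pow A n (y : frob_base_change charRp n B) :
  (forall t, y \in frob_power charRp n (add_pow m A t)) ->
  y \in frob_power charRp n A.
Proof.
move=> yP; have [kB [eB eBP]] := Bfg.
pose e i := frob_elt charRp n (eB i).
have eP x : exists c, x = lincomb (fun (a : R) x => a *: x) e c.
  move: x; apply: (@tens_ind _ _ (frob charRp n) R^o B
    [set x | exists c, x = lincomb (fun (a : R) x => a *: x) e c]).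
    have actP := scale_action (frob_base_change charRp n B).
    split=> [|_ _ [c ->] [c' ->]|a _ [c ->]].
    - by exists (fun=> 0); rewrite lincomb0.
    - by exists (fun i => c i - c' i); rewrite lincombB.
    - by exists (fun i => a * c i); rewrite (lincombZ actP).
  move=> x b /=; have [c ->] := eBP b.
  exists (fun i => x * frob charRp n (c i)); rewrite tens_sum; apply: eq_bigr => i _.
  rewrite mulrC -scalerA /e /frob_elt; congr (_ *: _).
  by rewrite -tensZl; congr (tens _ _ _); exact: (esym (mulr1 x)).
apply: (krull_intersection Rnoeth (scale_action _) eP Rlocal
  (subm_submod (frob_power charRp n A))) => t T Ts AT Tm.
apply: (frob_power_le Ts _ (yP t)) => x b bA.
have [S SP] : exists S : submodClosed B,
    forall b, b \in S <-> forall x : R^o, T (tens (frob charRp n) x b).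
  apply: submod_subm; split=> [x'|b1 b2 T1 T2 x'|a b1 T1 x'].
  - by rewrite tensr0; exact: subm0 Ts.
  - by rewrite tensBr; exact: (submB Ts).
  - by rewrite tensZr; exact: (submZ Ts).
apply: (SP b).1 => //; apply: (span_le _ bA) => z /= [zA|[a am [w ->]]]; apply/SP => x'.
  by apply: AT; exact: tens_frob_power.
(* For a in m^t the power a^(p^n) is again in m^t, so Frobenius powers of A + m^t B lie in the
   Frobenius power of A plus m^t times the base change. *)
have aE : frob charRp n a = (a : R) ^+ (p ^ n).-1 * a.
  by rewrite frobE -exprSr prednK ?(pexp_gt0 charRp).
rewrite tensZr [X in X *: _]aE -scalerA.
by apply: (submZ Ts); exact: Tm.
Qed.

(** The tight closure of A + m^t B is itself the largest admissible submodule: it is admissible, and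
    the multiplier [g] puts every admissible one inside it. Since [g] does not depend on t, Krull's
    theorem can then be applied for each Frobenius power separately. *)
Lemma seq_closureE A : seq_closure m F alpha A = tight_closure charRp A.
Proof.
apply/seteqP; split=> b.
  move=> bcl; exists g => //; exists 0%N => n _; apply: frob_power_add_pow => t.
  by have [A' [adm _] bA'] := bcl t; exact: admissible_tight adm bA'.
move=> bA t; have [A' A'P] := submod_subm (tight_subm (add_pow m A t)).
exists A'; last by apply/A'P; apply: tight_mono bA => x; exact: sub_add_pow.
split=> [|A'' adm x xA''].
  apply: (@tight_admissible _ _ t).
  - by move=> a x; exact: add_pow_pow.
  - by move=> x xA; apply/A'P; exact: sub_tight.
  - by move=> x /A'P.
apply/A'P; exists g => //; exists 0%N => n _; exact: admissible_tight adm xA''.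
Qed.

End Closures.

Theorem theorem7p9 (R : comNzRingType) (m : idealr R) (p d : nat)
    (charRp : p \in [pchar R])
    (Rnoeth : noetherian R) (Rlocal : local_ring m)
    (Rred : reduced_ring R) (Rfin : F_finite charRp)
    (Rdim : krull_dim R d) (Requi : equidimensional R)
    (B : lmodType R) (A : submodClosed B)
    (Bfg : fin_gen B) (Afg : fin_gen (submod A)) :
  seq_closure m (frob_push charRp) (@rank R) A =
    seq_closure m (frob_push charRp) (nu m) A /\
  seq_closure m (frob_push charRp) (nu m) A = tight_closure charRp A.
Proof.
have [k [e eP]] : exists k (e : 'I_k -> R), fgens p 1 e.
  have [k [e eP]] := Rfin; exists k, e => x; have [c ->] := eP x.
  by exists c; exact: esym (lincomb_frob_push charRp 1 e c).
have Mp := local_primei Rnoeth Rlocal.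
have [a fM] := frank_exists charRp Mp eP.
have dmax := primes_above_le Rdim.
have [s [P [t [Pp Pt tP tPj Pmin]]]] := minimal_primes_list Rnoeth Rred.
have [i0 _] := Pmin _ Mp.
have [Q QP] := choice (fun i => primei_prime_idealr (Pp i)).
(* For a prime Q' inside P_i, the product t_i P_i = 0 lies in Q' while t_i does not, so P_i lies in
   Q'. *)
have Qmin i : minimal_prime (Q i).
  move=> Q' Q'Q x xQ; have := Pt i; rewrite -QP => tQ.
  have := tP i x ((QP i x).1 xQ) => tx.
  have : t i * x \in Q' by rewrite tx idealr0.
  rewrite prime_idealrM => /orP[/Q'Q //|//].
have QE i : [set x | x \in Q i] = P i by apply/seteqP; split=> x /QP.
(* Equidimensionality supplies, for each minimal prime, the chain that makes its rank equal to a
   p^d. *)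
have Pd i : primes_above d (P i).
  by rewrite -QE; apply: equidim_primes_above => //; exact: Requi.
pose r := (a * p ^ d)%N.
have fP i : frank p (P i) r.
  have [r' fr'] := frank_exists charRp (Pp i) eP.
  by rewrite /r -(frank_eq charRp Rnoeth Rlocal eP fM dmax (Pd i) fr').
have [u [al [c [qb cP]]]] := quasi_basis_glue charRp Pp Pt tP tPj eP fP.
have minQ (T : prime_idealr R) : minimal_prime T -> exists i, forall x, x \in T <-> P i x.
  move=> Tmin; have [i PT] := Pmin _ (prime_idealr_primei T); exists i => x.
  have QT : {subset Q i <= T} by move=> y /QP /PT.
  by split=> [/(Tmin _ QT) /QP|/PT].
have gP (T : prime_idealr R) : minimal_prime T -> c ^+ 2 \notin T.
  move=> /minQ[i TP]; apply/negP => /TP /(primeiX (Pp i)); exact: cP.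
have basis := quasi_basis_iter charRp qb.
have r0 : (0 < r)%N.
  by rewrite muln_gt0 (frank_gt0 Mp fM) expn_gt0 (prime_gt0 (pprime charRp)).
have [C0 HC0] := minimal_gens charRp Rnoeth Rlocal eP fM dmax.
have nuP n : (r ^ n <= nu m (frob_push charRp n) <= C0 * r ^ n)%N.
  have [j [w [wP wspan wgen jC]]] := HC0 n.
  rewrite (nuE charRp Rnoeth Rlocal wP wspan wgen) jC andbT.
  exact: frank_exp_le (Pp i0) (fP i0) wgen.
have growth (b : R) : (forall T : prime_idealr R, minimal_prime T -> b \notin T) ->
    exists C, forall n, exists2 l,
    lenle (frob_act p n) [set 1] (addi (adjoin [set 0] b) (max_power m p n)) [set: R] l &
    (l * p ^ n <= C * r ^ n)%N.
  move=> bP; have bid := adjoin_ideal b (ideal0 R).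
  (* A prime containing [b] is not minimal, so chains above it have fewer than d inclusions; using d
     where I = 0 needed d + 1 gains the factor p^n. *)
  have [T l bT ch|C HC] := length_growth charRp Rnoeth Rlocal eP fM bid (d := d).
    have [T' T'P] := primei_prime_idealr (primes_above_primei ch).
    have TE : [set x | x \in T'] = T by apply/seteqP; split=> x /T'P.
    rewrite -TE in ch; have [//|/bP] := primes_above_minimal Rdim ch.
    by move/negP; case; apply/T'P; apply: bT; exact: adjoin_elt (ideal0 R).
  exists C => n; have [l Hl lC] := HC n; exists l => //.
  by rewrite expnMn -expnM [(d * n)%N]mulnC mulnA.
have rankP n : rank (frob_push charRp n) = (r ^ n)%N.
  have [u' [al' qb']] := basis n.
  apply: (rankE charRp qb'); last by exists (Q i0); [exact: Qmin|exact: Requi].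
  move=> T' T'min; split; first exact: gP.
  have [i TP] := minQ _ T'min; exists (t i); first by apply/negP => /TP /Pt.
  by move=> x /TP; exact: tP.
have E (alpha : lmodType R -> nat) C :
    (forall n, (r ^ n <= alpha (frob_push charRp n) <= C * r ^ n)%N) ->
    seq_closure m (frob_push charRp) alpha A = tight_closure charRp A.
  move=> H; apply: (seq_closureE Rnoeth Rlocal r0 gP basis growth (C0 := C)) => // n.
    by have /andP[] := H n.
  by have /andP[] := H n.
rewrite (E (@rank R) 1%N) => [|n]; last by rewrite rankP mul1n leqnn.
by rewrite (E (nu m) C0).
Qed.
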